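(* Let $q \geq 2$ be an integer and let $\chi_1,\chi_2$ be primitive Dirichlet characters modulo $q$. Let $(s_1,s_2)\in\mathbb{C}^2$, $s_j=\sigma_j+it_j$, with $\sigma_1+\sigma_2>0$, $0<\sigma_2<1$ and $|t_2|\geq 2$, and put $\delta=\max\{0,1-\sigma_1-\sigma_2\}$. Then for every $\varepsilon>0$: if $\chi_2(-1)=1$, \[ L_2(s_1,s_2;\chi_1,\chi_2)\ll (q|t_2|)^{\frac12+\delta+\varepsilon}, \] and if $\chi_2(-1)=-1$, \[ L_2(s_1,s_2;\chi_1,\chi_2)\ll (q|t_2|)^{\frac12+\delta+\varepsilon}+(1+|t_1+t_2|)\,q^{\frac32+\varepsilon}(q|t_2|)^{-\min\{1,\frac{\sigma_1+\sigma_2}{2}\}}, \] where the implied constants are independent of $q$, $t_1$ and $t_2$.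
   Context: For Dirichlet characters $\chi_1,\chi_2$ modulo $q$, the double $L$-function is defined by \[ L_2(s_1,s_2;\chi_1,\chi_2)=\sum_{m=1}^\infty\sum_{n=1}^\infty \frac{\chi_1(m)\chi_2(n)}{m^{s_1}(m+n)^{s_2}} \] for $\sigma_2>1$, $\sigma_1+\sigma_2>2$; when $\chi_1,\chi_2$ are primitive it continues to an entire function on $\mathbb{C}^2$, and $L_2$ denotes this continuation. *)

(* Defs.v *)
(* Vanilla Stdlib reals, with Coquelicot for complex numbers, series and
   Frechet differentiability. *)
From Stdlib Require Export Reals ZArith Znumtheory.
From Coquelicot Require Export Coquelicot.

Local Open Scope C_scope.

(* The value [chi 1 = 1] follows from multiplicativity and [chi 1 <> 0]. *)
Definition dirichlet_character (q : Z) (chi : Z -> C) : Prop :=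
  (forall a : Z, chi (a + q)%Z = chi a) /\
  (forall a b : Z, chi (a * b)%Z = chi a * chi b) /\
  (forall a : Z, chi a <> 0 <-> rel_prime a q).

(* A character is primitive when no character modulo a proper divisor of [q]
   induces it. *)
Definition primitive_character (q : Z) (chi : Z -> C) : Prop :=
  dirichlet_character q chi /\
  forall (d : Z) (psi : Z -> C),
    (0 < d < q)%Z -> (d | q)%Z -> dirichlet_character d psi ->
    ~ (forall a : Z, rel_prime a q -> chi a = psi a).

Definition Cexp (z : C) : C :=
  (exp (Re z) * cos (Im z), exp (Re z) * sin (Im z))%R.

(* Meaningful for [0 < x] only, as [ln] is [0] elsewhere. *)
Definition real_Cpow (x : R) (s : C) : C := Cexp (s * RtoC (ln x)).

(* Indices are shifted: [i], [j] stand for m = i + 1, n = j + 1. *)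
Definition double_L_term (chi1 chi2 : Z -> C) (s1 s2 : C) (i j : nat) : C :=
  let m := S i in
  let n := S j in
  chi1 (Z.of_nat m) * chi2 (Z.of_nat n) /
    (real_Cpow (INR m) s1 * real_Cpow (INR (m + n)) s2).

Definition is_double_series (a : nat -> nat -> C) (l : C) : Prop :=
  exists b : nat -> C,
    (forall i : nat, is_series (a i) (b i)) /\ is_series b l.

(* Linearity of the differential is over the scalars [C_AbsRing], so this is
   complex differentiability in both variables jointly. *)
Definition entire2 (f : C * C -> C) : Prop :=
  forall p : C * C,
    @ex_filterdiff C_AbsRing
      (prod_NormedModule C_AbsRing C_NormedModule C_NormedModule)
      C_NormedModule f (locally p).

(* [L] is the entire continuation of the double series; by the identity theorem
   there is at most one such [L]. *)
Definition is_double_L (chi1 chi2 : Z -> C) (L : C * C -> C) : Prop :=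
  entire2 L /\
  forall s1 s2 : C,
    (1 < Re s2)%R -> (2 < Re s1 + Re s2)%R ->
    is_double_series (double_L_term chi1 chi2 s1 s2) (L (s1, s2)).

(* Main.v *)
Require Import Defs.
From Stdlib Require Import Lra Lia Classical ClassicalEpsilon.
Local Open Scope R_scope.

(* Write [phi(m)] for the inner sum of [chi2(n) (m + n)^{-s2}] over [n], and put
   [N = q |t2|], [c = L(0, chi2)].  Expanding [chi2] in additive characters with
   Gauss sums of size [sqrt q], a Kusmin-Landau estimate gives
   [phi(m) = c m^{-s2} + O(sqrt q log q (N / m) m^{-sigma2})] for [m >= N].  For every
   [m], cutting the sum into blocks of relative length [1 / sqrt |t2|], on which the
   phase is nearly linear, and counting the resonances of its slope with the
   fractions [b / q] gives [phi(m) = O(sqrt N (log N)^2 m^{-sigma2})].  Summing over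
   [m] against [chi1(m) m^{-s1}] yields the bound; the term [c m^{-s2}], which
   vanishes for even [chi2], produces the extra term through the Dirichlet test.

   These sums converge locally uniformly for [sigma2 > 0], [sigma1 + sigma2 > 0], and
   must agree there with the entire function [L]: on the line
   [(s1 + z, s2 + z)] the difference is a uniform limit of entire functions vanishing
   for [Re z = 2], hence vanishes at [z = 0] by Goursat's theorem with a Gaussian
   weight. *)

(** The implied constant may depend on sigma1, sigma2 and [eps] only, so all estimates keep q, t1
    and t2 explicit, with numerical constants.

    On a block starting at x of length x / sqrt |t2| the slope |t2| / (2 pi x) drifts by about the
    reciprocal of the length; this is the longest block whose terms still behave like a geometric
    progression. A single block may resonate with a fraction b / q, and using the worst case for all
    of the roughly sqrt |t2| log N blocks would be too costly. The saving comes from adding up the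
    blocks: their slopes decrease geometrically, so each integer frequency is closely approached by
    few of them.

    The double series is not absolutely convergent where the bound is wanted. A partial sum over n
    rows therefore cuts its rows at a length depending on n, so large that all the cuts together
    cost O(1 / n). The comparison with [L] is made on these finite sums, without forming their
    limit; hence one complex variable and contour integrals over rectangles suffice. *)

Notation ex_CInt := (ex_RInt (V := C_R_NormedModule)).
Notation is_C_derive := (is_derive (K := C_AbsRing) (V := C_NormedModule)).

Ltac C_components := apply injective_projections; simpl; ring.

(** * Complex differentiability and integrals along segments *)

Lemma is_C_derive_spec (f : C -> C) (p d : C) :
  is_C_derive f p d <->
  forall eps : R, 0 < eps -> exists delta : R, 0 < delta /\
    forall z : C, Cmod (z - p) < delta ->
      Cmod (f z - f p - d * (z - p)) <= eps * Cmod (z - p).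
Proof.
  split.
  - intros [_ H] eps Heps.
    destruct (H p (fun P HP => HP) (mkposreal eps Heps)) as [del Hdel].
    exists del; split; [apply cond_pos|].
    intros z Hz.
    specialize (Hdel z Hz).
    change (Cmod ((f z - f p) - (z - p) * d) <= eps * Cmod (z - p)) in Hdel.
    replace (f z - f p - d * (z - p))%C with ((f z - f p) - (z - p) * d)%C by ring.
    exact Hdel.
  - intros H. split; [apply (is_linear_scal_l (K := C_AbsRing) (V := C_NormedModule))|].
    intros x Hx eps.
    (* [x] is a limit of the filter [locally p], and such a limit is unique. *)
    assert (Hxp : p = x).
    { apply (is_filter_lim_locally_unique (K := C_AbsRing) (V := AbsRing_NormedModule C_AbsRing)). exact Hx. }
    subst x.
    destruct (H eps (cond_pos eps)) as [del [Hd Hdel]].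
    exists (mkposreal del Hd). intros z Hz.
    specialize (Hdel z Hz).
    change (Cmod ((f z - f p) - (z - p) * d) <= eps * Cmod (z - p)).
    replace ((f z - f p) - (z - p) * d)%C with (f z - f p - d * (z - p))%C by ring.
    exact Hdel.
Qed.

Lemma norm_C_R (x : C) : norm (V := C_R_NormedModule) x = Cmod x.
Proof. symmetry. apply Cmod_norm. Qed.

(** The uniform structure of [C_R_NormedModule] is the product one, so closeness in [Cmod] has to be
    passed on to both coordinates. *)
Lemma continuous_C_R (f : R -> C) (x0 : R) :
  (forall eps, 0 < eps -> exists delta, 0 < delta /\ forall x, Rabs (x - x0) < delta -> Cmod (f x - f x0) < eps) ->
  continuous (U := C_R_NormedModule) f x0.
Proof.
  intros H. apply filterlim_locally. intros eps.
  destruct (H eps (cond_pos eps)) as [d [Hd Hx]].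
  exists (mkposreal d Hd). intros x Hxd.
  specialize (Hx x Hxd).
  pose proof (Rmax_Cmod (f x - f x0)%C) as Hm.
  split.
  - change (Rabs (Re (f x) - Re (f x0)) < eps).
    eapply Rle_lt_trans; [|exact Hx]. eapply Rle_trans; [|exact Hm]. apply Rmax_l.
  - change (Rabs (Im (f x) - Im (f x0)) < eps).
    eapply Rle_lt_trans; [|exact Hx]. eapply Rle_trans; [|exact Hm]. apply Rmax_r.
Qed.

(** Asked on the whole plane, because the functions met below (finite sums of powers, the Gaussian
    weight, [L] along a complex line) are all entire. *)
Definition C_differentiable (f : C -> C) : Prop :=
  forall p : C, exists d : C, is_C_derive f p d.

Lemma C_differentiable_continuous (f : C -> C) (p : C) (eps : R) :
  C_differentiable f -> 0 < eps ->
  exists delta, 0 < delta /\ forall z, Cmod (z - p) < delta -> Cmod (f z - f p) < eps.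
Proof.
  intros Hf Heps. destruct (Hf p) as [d Hd].
  rewrite is_C_derive_spec in Hd.
  destruct (Hd 1 ltac:(lra)) as [del [Hdel H]].
  pose proof (Cmod_ge_0 d) as Hd0.
  set (k := Cmod d + 1).
  assert (Hk : 0 < k) by (unfold k; lra).
  exists (Rmin del (eps / k)). split.
  - apply Rmin_glb_lt; auto. apply Rdiv_lt_0_compat; lra.
  - intros z Hz.
    assert (Hz1 : Cmod (z - p) < del) by (eapply Rlt_le_trans; [exact Hz|apply Rmin_l]).
    assert (Hz2 : Cmod (z - p) < eps / k) by (eapply Rlt_le_trans; [exact Hz|apply Rmin_r]).
    specialize (H z Hz1).
    replace (f z - f p)%C with ((f z - f p - d * (z - p)) + d * (z - p))%C by ring.
    eapply Rle_lt_trans; [apply Cmod_triangle|].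
    rewrite Cmod_mult.
    apply Rle_lt_trans with (k * Cmod (z - p)); [unfold k; lra|].
    apply (Rmult_lt_compat_l k) in Hz2; auto.
    replace (k * (eps / k)) with eps in Hz2 by (field; lra). exact Hz2.
Qed.

Lemma ex_RInt_horizontal (f : C -> C) (y a b : R) :
  C_differentiable f -> ex_CInt (fun x => f (x, y)) a b.
Proof.
  intros Hf. apply (ex_RInt_continuous (V := C_R_CompleteNormedModule)).
  intros x _. apply continuous_C_R. intros eps Heps.
  destruct (C_differentiable_continuous f (x, y) eps Hf Heps) as [d [Hd H]].
  exists d; split; auto. intros x' Hx'. apply H.
  replace ((x', y) - (x, y))%C with (RtoC (x' - x)).
  - now rewrite Cmod_R.
  - C_components.
Qed.

Lemma ex_RInt_vertical (f : C -> C) (x a b : R) :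
  C_differentiable f -> ex_CInt (fun y => f (x, y)) a b.
Proof.
  intros Hf. apply (ex_RInt_continuous (V := C_R_CompleteNormedModule)).
  intros y _. apply continuous_C_R. intros eps Heps.
  destruct (C_differentiable_continuous f (x, y) eps Hf Heps) as [d [Hd H]].
  exists d; split; auto. intros y' Hy'. apply H.
  replace ((x, y') - (x, y))%C with (Ci * RtoC (y' - y))%C.
  - rewrite Cmod_mult, Cmod_Ci, Cmod_R. lra.
  - C_components.
Qed.

(** * Goursat's theorem *)

Definition Cint (f : R -> C) (a b : R) : C := RInt (V := C_R_CompleteNormedModule) f a b.

Lemma Cmod_Cint_le (f : R -> C) (a b M : R) :
  a <= b -> ex_CInt f a b ->
  (forall x, a <= x <= b -> Cmod (f x) <= M) -> Cmod (Cint f a b) <= (b - a) * M.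
Proof.
  intros Hab Hf HM. rewrite <- norm_C_R.
  apply (norm_RInt_le_const (V := C_R_NormedModule) f); auto.
  - intros x Hx. rewrite norm_C_R. auto.
  - now apply (RInt_correct (V := C_R_CompleteNormedModule)).
Qed.

(** The contour integral around [a,b] x [c,d], counterclockwise; dz = i dy on the vertical sides
    gives the factor [Ci]. *)
Definition rectangle_integral (f : C -> C) (a b c d : R) : C :=
  (Cint (fun x => f (x, c)) a b + Ci * Cint (fun y => f (b, y)) c d
   - Cint (fun x => f (x, d)) a b - Ci * Cint (fun y => f (a, y)) c d)%C.

Lemma Cint_Chasles (f : R -> C) (a b c : R) :
  ex_CInt f a b -> ex_CInt f b c ->
  Cint f a c = (Cint f a b + Cint f b c)%C.
Proof.
  intros H1 H2. symmetry. exact (RInt_Chasles (V := C_R_CompleteNormedModule) f a b c H1 H2).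
Qed.

Lemma rectangle_integral_split_x (f : C -> C) (a m b c d : R) :
  C_differentiable f ->
  rectangle_integral f a b c d =
  (rectangle_integral f a m c d + rectangle_integral f m b c d)%C.
Proof.
  intros Hf. unfold rectangle_integral.
  rewrite (Cint_Chasles (fun x => f (x, c)) a m b), (Cint_Chasles (fun x => f (x, d)) a m b)
    by now apply ex_RInt_horizontal.
  ring.
Qed.

Lemma rectangle_integral_split_y (f : C -> C) (a b c m d : R) :
  C_differentiable f ->
  rectangle_integral f a b c d =
  (rectangle_integral f a b c m + rectangle_integral f a b m d)%C.
Proof.
  intros Hf. unfold rectangle_integral.
  rewrite (Cint_Chasles (fun y => f (b, y)) c m d), (Cint_Chasles (fun y => f (a, y)) c m d)
    by now apply ex_RInt_vertical.
  ring.
Qed.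

Lemma is_RInt_affine (u v a b : R) :
  is_RInt (fun x => u + x * v) a b ((b - a) * u + (b * b - a * a) / 2 * v).
Proof.
  set (F := fun x => x * u + x * x / 2 * v).
  replace ((b - a) * u + (b * b - a * a) / 2 * v) with (minus (F b) (F a)).
  - apply (is_RInt_derive F).
    + intros x _. unfold F. auto_derive; auto. field.
    + intros x _. apply (ex_derive_continuous (fun x => u + x * v)). auto_derive; auto.
  - unfold F, minus, plus, opp; simpl. field.
Qed.

Lemma Cint_affine (u v : C) (a b : R) :
  Cint (fun x => u + RtoC x * v)%C a b =
  (RtoC (b - a) * u + RtoC ((b * b - a * a) / 2) * v)%C.
Proof.
  apply (is_RInt_unique (V := C_R_CompleteNormedModule)).
  apply (is_RInt_ext (V := C_R_NormedModule)
    (fun x => (Re u + x * Re v, Im u + x * Im v))).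
  { intros x _. destruct u, v. C_components. }
  replace (RtoC (b - a) * u + RtoC ((b * b - a * a) / 2) * v)%C with
    ((b - a) * Re u + (b * b - a * a) / 2 * Re v, (b - a) * Im u + (b * b - a * a) / 2 * Im v)
    by (destruct u, v; apply injective_projections; simpl; field).
  apply (is_RInt_fct_extend_pair (U := R_NormedModule) (V := R_NormedModule)); apply is_RInt_affine.
Qed.

(** An affine function has a primitive; the four sides are simply computed and cancel. *)
Lemma rectangle_integral_affine (u v : C) (a b c d : R) :
  rectangle_integral (fun z => u + v * z)%C a b c d = 0%C.
Proof.
  assert (Hh : forall y, Cint (fun x => u + v * (x, y))%C a b =
    (RtoC (b - a) * (u + v * (Ci * y)) + RtoC ((b * b - a * a) / 2) * v)%C).
  { intros y. rewrite <- Cint_affine. apply (RInt_ext (V := C_R_CompleteNormedModule)).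
    intros x _. destruct u, v; C_components. }
  assert (Hv : forall x, Cint (fun y => u + v * (x, y))%C c d =
    (RtoC (d - c) * (u + v * x) + RtoC ((d * d - c * c) / 2) * (v * Ci))%C).
  { intros x. rewrite <- Cint_affine. apply (RInt_ext (V := C_R_CompleteNormedModule)).
    intros y _. destruct u, v; C_components. }
  unfold rectangle_integral. rewrite !Hh, !Hv.
  destruct u, v; apply injective_projections; simpl; field.
Qed.

Lemma Cmod_rectangle_integral_le (f : C -> C) (a b c d M : R) :
  C_differentiable f -> a <= b -> c <= d ->
  (forall x y, a <= x <= b -> c <= y <= d -> Cmod (f (x, y)) <= M) ->
  Cmod (rectangle_integral f a b c d) <= 2 * ((b - a) + (d - c)) * M.
Proof.
  intros Hf Hab Hcd HM. unfold rectangle_integral.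
  assert (Hh : forall y, c <= y <= d -> Cmod (Cint (fun x => f (x, y)) a b) <= (b - a) * M).
  { intros y Hy. apply Cmod_Cint_le; auto. now apply ex_RInt_horizontal. }
  assert (Hv : forall x, a <= x <= b -> Cmod (Ci * Cint (fun y => f (x, y)) c d) <= (d - c) * M).
  { intros x Hx. rewrite Cmod_mult, Cmod_Ci, Rmult_1_l.
    apply Cmod_Cint_le; auto. now apply ex_RInt_vertical. }
  pose proof (Hh c ltac:(lra)). pose proof (Hh d ltac:(lra)).
  pose proof (Hv a ltac:(lra)). pose proof (Hv b ltac:(lra)).
  unfold Cminus.
  eapply Rle_trans; [apply Cmod_triangle|]. rewrite Cmod_opp.
  eapply Rle_trans; [apply Rplus_le_compat_r, Cmod_triangle|]. rewrite Cmod_opp.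
  eapply Rle_trans; [apply Rplus_le_compat_r, Rplus_le_compat_r, Cmod_triangle|].
  lra.
Qed.

Lemma Cint_minus (f g : R -> C) (a b : R) :
  ex_CInt f a b -> ex_CInt g a b ->
  Cint (fun x => f x - g x)%C a b = (Cint f a b - Cint g a b)%C.
Proof.
  intros Hf Hg. exact (RInt_minus (V := C_R_CompleteNormedModule) f g a b Hf Hg).
Qed.

Lemma rectangle_integral_minus (f g : C -> C) (a b c d : R) :
  C_differentiable f -> C_differentiable g ->
  rectangle_integral (fun z => f z - g z)%C a b c d =
  (rectangle_integral f a b c d - rectangle_integral g a b c d)%C.
Proof.
  intros Hf Hg. unfold rectangle_integral.
  rewrite !(Cint_minus (fun x => f (x, _)) (fun x => g (x, _)))
    by now apply ex_RInt_horizontal.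
  rewrite !(Cint_minus (fun y => f (_, y)) (fun y => g (_, y)))
    by now apply ex_RInt_vertical.
  ring.
Qed.

Lemma C_differentiable_affine (u v : C) : C_differentiable (fun z => u + v * z)%C.
Proof.
  intros p. exists v. apply is_C_derive_spec. intros eps Heps.
  exists 1; split; [lra|]. intros z _.
  replace (u + v * z - (u + v * p) - v * (z - p))%C with (RtoC 0) by ring.
  rewrite Cmod_0. apply Rmult_le_pos; [lra|apply Cmod_ge_0].
Qed.

Lemma C_differentiable_minus (f g : C -> C) :
  C_differentiable f -> C_differentiable g -> C_differentiable (fun z => f z - g z)%C.
Proof.
  intros Hf Hg p. destruct (Hf p) as [df Hdf], (Hg p) as [dg Hdg].
  exists (df - dg)%C.
  exact (is_derive_minus (K := C_AbsRing) (V := C_NormedModule) f g p df dg Hdf Hdg).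
Qed.

Lemma nested_intervals (a b : nat -> R) :
  (forall n, a n <= a (S n)) -> (forall n, b (S n) <= b n) -> (forall n, a n <= b n) ->
  exists x, forall n, a n <= x <= b n.
Proof.
  intros Ha Hb Hab.
  assert (Ha' : forall n k, a n <= a (n + k)%nat).
  { intros n k; induction k as [|k IH]; [rewrite Nat.add_0_r; lra|].
    rewrite Nat.add_succ_r. specialize (Ha (n + k)%nat). lra. }
  assert (Hb' : forall n k, b (n + k)%nat <= b n).
  { intros n k; induction k as [|k IH]; [rewrite Nat.add_0_r; lra|].
    rewrite Nat.add_succ_r. specialize (Hb (n + k)%nat). lra. }
  assert (Hm : forall n m, a n <= b m).
  { intros n m. specialize (Ha' n m). specialize (Hb' m n).
    specialize (Hab (n + m)%nat). rewrite (Nat.add_comm m n) in Hb'. lra. }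
  destruct (completeness (fun x => exists n, x = a n)) as [x [Hx1 Hx2]].
  - exists (b 0%nat). intros x [n ->]. apply Hm.
  - exists (a 0%nat), 0%nat; reflexivity.
  - exists x. intros n; split.
    + apply Hx1. exists n; reflexivity.
    + apply Hx2. intros y [m ->]. apply Hm.
Qed.

(** ((a, b), (c, d)) stands for [a,b] x [c,d]. *)
Definition rect : Type := ((R * R) * (R * R))%type.

Definition rect_integral (f : C -> C) (r : rect) : C :=
  rectangle_integral f (fst (fst r)) (snd (fst r)) (fst (snd r)) (snd (snd r)).

Definition larger_rect (f : C -> C) (r r' : rect) : rect :=
  if Rle_dec (Cmod (rect_integral f r)) (Cmod (rect_integral f r')) then r' else r.

(** Halving one coordinate at a time reduces each choice to two candidates. A round of [half_x] and
    [half_y] divides the area by 4 and keeps at least a quarter of the integral. *)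
Definition half_x (f : C -> C) (r : rect) : rect :=
  let m := (fst (fst r) + snd (fst r)) / 2 in
  larger_rect f ((fst (fst r), m), snd r) ((m, snd (fst r)), snd r).

Definition half_y (f : C -> C) (r : rect) : rect :=
  let m := (fst (snd r) + snd (snd r)) / 2 in
  larger_rect f (fst r, (fst (snd r), m)) (fst r, (m, snd (snd r))).

Lemma Cmod_larger_rect (f : C -> C) (r r' : rect) :
  Cmod (rect_integral f r + rect_integral f r') <= 2 * Cmod (rect_integral f (larger_rect f r r')).
Proof.
  eapply Rle_trans; [apply Cmod_triangle|].
  unfold larger_rect. destruct Rle_dec; lra.
Qed.

Lemma Cmod_half_x (f : C -> C) (r : rect) :
  C_differentiable f ->
  Cmod (rect_integral f r) <= 2 * Cmod (rect_integral f (half_x f r)).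
Proof.
  intros Hf. unfold half_x. eapply Rle_trans; [|apply Cmod_larger_rect].
  right; f_equal. unfold rect_integral; simpl. now apply rectangle_integral_split_x.
Qed.

Lemma Cmod_half_y (f : C -> C) (r : rect) :
  C_differentiable f ->
  Cmod (rect_integral f r) <= 2 * Cmod (rect_integral f (half_y f r)).
Proof.
  intros Hf. unfold half_y. eapply Rle_trans; [|apply Cmod_larger_rect].
  right; f_equal. unfold rect_integral; simpl. now apply rectangle_integral_split_y.
Qed.

(** Subdivision: the n-th rectangle keeps 4^-n of the integral, while near the limit point f differs
    from an affine function by o(1) times the diameter, which allows only o(4^-n). *)
Theorem Goursat (f : C -> C) (a b c d : R) :
  C_differentiable f -> a <= b -> c <= d -> rectangle_integral f a b c d = 0%C.
Proof.
  intros Hf Hab Hcd.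
  destruct (Req_dec (Cmod (rectangle_integral f a b c d)) 0) as [H0|H0];
    [now apply Cmod_eq_0|exfalso].
  assert (Hj : 0 < Cmod (rectangle_integral f a b c d))
    by (pose proof (Cmod_ge_0 (rectangle_integral f a b c d)); lra).
  set (rs := fix rs (n : nat) : rect :=
    match n with O => ((a, b), (c, d)) | S n => half_y f (half_x f (rs n)) end).
  set (an := fun n => fst (fst (rs n))). set (bn := fun n => snd (fst (rs n))).
  set (cn := fun n => fst (snd (rs n))). set (dn := fun n => snd (snd (rs n))).
  assert (Hstep : forall n,
    an n <= bn n /\ cn n <= dn n ->
    (an n <= an (S n) /\ bn (S n) <= bn n /\ bn (S n) - an (S n) = (bn n - an n) / 2) /\
    (cn n <= cn (S n) /\ dn (S n) <= dn n /\ dn (S n) - cn (S n) = (dn n - cn n) / 2)).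
  { intros n. unfold an, bn, cn, dn; simpl.
    destruct (rs n) as [[a1 b1] [c1 d1]]; simpl. intros [H1 H2].
    unfold half_y, half_x, larger_rect; simpl.
    repeat destruct Rle_dec; simpl; lra. }
  assert (Hord : forall n, an n <= bn n /\ cn n <= dn n).
  { induction n as [|n IH]; [unfold an, bn, cn, dn; simpl; lra|].
    specialize (Hstep n IH). lra. }
  assert (Hwx : forall n, bn n - an n = (b - a) * (/ 2) ^ n).
  { induction n as [|n IH]; [unfold an, bn; simpl; lra|].
    destruct (Hstep n (Hord n)) as [[_ [_ ->]] _]. rewrite IH. simpl. lra. }
  assert (Hwy : forall n, dn n - cn n = (d - c) * (/ 2) ^ n).
  { induction n as [|n IH]; [unfold cn, dn; simpl; lra|].
    destruct (Hstep n (Hord n)) as [_ [_ [_ ->]]]. rewrite IH. simpl. lra. }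
  assert (HJ : forall n, Cmod (rectangle_integral f a b c d) <= 4 ^ n * Cmod (rect_integral f (rs n))).
  { induction n as [|n IH]; [simpl; unfold rect_integral; simpl; lra|].
    eapply Rle_trans; [exact IH|].
    pose proof (Cmod_half_x f (rs n) Hf) as H1.
    pose proof (Cmod_half_y f (half_x f (rs n)) Hf) as H2.
    change (rs (S n)) with (half_y f (half_x f (rs n))).
    assert (H4 : 0 < 4 ^ n) by (apply pow_lt; lra).
    simpl (4 ^ S n).
    apply Rle_trans with (4 ^ n * (2 * (2 * Cmod (rect_integral f (half_y f (half_x f (rs n)))))));
      [|lra].
    apply Rmult_le_compat_l; lra. }
  destruct (nested_intervals an bn) as [px Hpx].
  { intros n; apply (Hstep n (Hord n)). } { intros n; apply (Hstep n (Hord n)). } { apply Hord. }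
  destruct (nested_intervals cn dn) as [py Hpy].
  { intros n; apply (Hstep n (Hord n)). } { intros n; apply (Hstep n (Hord n)). } { apply Hord. }
  destruct (Hf (px, py)) as [df Hdf]. rewrite is_C_derive_spec in Hdf.
  set (w := (b - a) + (d - c)).
  set (j := Cmod (rectangle_integral f a b c d)) in *.
  (* Small enough that 2 w^2 eps < j; the [+ 1] covers w = 0. *)
  set (eps := j / (4 * (w * w + 1))).
  assert (Hw0 : 0 <= w) by (unfold w; lra).
  assert (Hww : 0 < w * w + 1) by (pose proof (Rmult_le_pos w w); lra).
  assert (Heps : 0 < eps) by (unfold eps; apply Rdiv_lt_0_compat; lra).
  destruct (Hdf eps Heps) as [del [Hdel Hlin]].
  assert (Hn : exists n, w * (/ 2) ^ n < del).
  { destruct (pow_lt_1_zero (/ 2) ltac:(rewrite Rabs_pos_eq; lra) (del / (w + 1))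
      ltac:(apply Rdiv_lt_0_compat; lra)) as [n Hn].
    exists n. specialize (Hn n (le_n n)). rewrite Rabs_pos_eq in Hn by (apply pow_le; lra).
    apply (Rmult_lt_compat_l (w + 1)) in Hn; [|lra].
    replace ((w + 1) * (del / (w + 1))) with del in Hn by (field; lra).
    assert (0 <= (/ 2) ^ n) by (apply pow_le; lra). lra. }
  destruct Hn as [n Hn].
  set (lin := fun z : C => ((f (px, py) - df * (px, py)) + df * z)%C).
  set (wn := w * (/ 2) ^ n) in *.
  assert (Hwn : (bn n - an n) + (dn n - cn n) = wn)
    by (rewrite Hwx, Hwy; unfold wn, w; ring).
  (* Subtracting the linearisation [lin] leaves the integral unchanged; the remainder is at most eps
     wn on a boundary of length 2 wn. *)
  assert (Hsmall : Cmod (rect_integral f (rs n)) <= 2 * wn * (eps * wn)).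
  { unfold rect_integral. fold (an n) (bn n) (cn n) (dn n).
    replace (rectangle_integral f (an n) (bn n) (cn n) (dn n)) with
      (rectangle_integral (fun z => f z - lin z)%C (an n) (bn n) (cn n) (dn n)).
    2:{ rewrite rectangle_integral_minus; auto; [|apply C_differentiable_affine].
        unfold lin. rewrite rectangle_integral_affine. ring. }
    rewrite <- Hwn at 1.
    apply Cmod_rectangle_integral_le; try apply Hord.
    { apply C_differentiable_minus; auto. apply C_differentiable_affine. }
    intros x y Hx Hy.
    assert (Hd : Cmod ((x, y) - (px, py)) <= wn).
    { replace ((x, y) - (px, py))%C with (RtoC (x - px) + Ci * RtoC (y - py))%C
        by (C_components).
      eapply Rle_trans; [apply Cmod_triangle|].
      rewrite Cmod_mult, Cmod_Ci, !Cmod_R. rewrite <- Hwn.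
      specialize (Hpx n). specialize (Hpy n).
      assert (Rabs (x - px) <= bn n - an n) by (apply Rabs_le; lra).
      assert (Rabs (y - py) <= dn n - cn n) by (apply Rabs_le; lra). lra. }
    unfold lin.
    replace (f (x, y) - (f (px, py) - df * (px, py) + df * (x, y)))%C with
      (f (x, y) - f (px, py) - df * ((x, y) - (px, py)))%C by ring.
    eapply Rle_trans; [apply Hlin; lra|]. apply Rmult_le_compat_l; lra. }
  specialize (HJ n).
  assert (H4n : 4 ^ n * ((/ 2) ^ n * (/ 2) ^ n) = 1).
  { rewrite <- !Rpow_mult_distr. replace (4 * (/ 2 * / 2)) with 1 by field. apply pow1. }
  assert (Hfin : j <= 2 * (w * w) * eps).
  { eapply Rle_trans; [exact HJ|].
    apply Rle_trans with (4 ^ n * (2 * wn * (eps * wn))).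
    - apply Rmult_le_compat_l; [apply pow_le; lra|exact Hsmall].
    - right. unfold wn. transitivity (2 * (w * w) * eps * (4 ^ n * ((/ 2) ^ n * (/ 2) ^ n))); [ring|].
      rewrite H4n. ring. }
  assert (Hje : j = 4 * (w * w + 1) * eps) by (unfold eps; field; lra).
  pose proof (Rmult_le_pos (w * w) eps ltac:(apply Rmult_le_pos; lra) ltac:(lra)). lra.
Qed.

(** * The complex exponential *)

Lemma Cexp_0 : Cexp 0 = 1%C.
Proof.
  unfold Cexp; simpl. rewrite exp_0, cos_0, sin_0. C_components.
Qed.

Lemma Cexp_plus (u v : C) : Cexp (u + v) = (Cexp u * Cexp v)%C.
Proof.
  unfold Cexp; destruct u, v; simpl. rewrite exp_plus, cos_plus, sin_plus.
  C_components.
Qed.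

Lemma Cmod_Cexp (z : C) : Cmod (Cexp z) = exp (Re z).
Proof.
  unfold Cexp, Cmod; simpl.
  pose proof (sin2_cos2 (Im z)) as H. unfold Rsqr in H.
  replace (_ + _) with (exp (Re z) * exp (Re z)).
  - apply sqrt_square. left; apply exp_pos.
  - transitivity (exp (Re z) * exp (Re z) * (sin (Im z) * sin (Im z) + cos (Im z) * cos (Im z)));
      [rewrite H|]; ring.
Qed.

Lemma Cexp_neq_0 (z : C) : Cexp z <> 0%C.
Proof. apply Cmod_gt_0. rewrite Cmod_Cexp. apply exp_pos. Qed.

Lemma Cexp_opp (z : C) : Cexp (- z) = (/ Cexp z)%C.
Proof.
  assert (H : (Cexp z * Cexp (- z) = 1)%C)
    by (rewrite <- Cexp_plus, <- Cexp_0; f_equal; ring).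
  rewrite <- (Cmult_1_r (/ Cexp z)), <- H.
  field. apply Cexp_neq_0.
Qed.

Lemma exp_le_mono (x y : R) : x <= y -> exp x <= exp y.
Proof.
  intros H. destruct (Rle_lt_or_eq_dec _ _ H) as [Hlt| ->]; [left; now apply exp_increasing|lra].
Qed.

(** Mean value inequality for a plane curve: the real mean value theorem is applied to the
    projection of the curve onto its own increment (a, b). *)
Lemma Cmod_increment_le (h1 h2 d1 d2 : R -> R) (M : R) :
  (forall t, 0 <= t <= 1 -> is_derive h1 t (d1 t)) ->
  (forall t, 0 <= t <= 1 -> is_derive h2 t (d2 t)) ->
  (forall t, 0 <= t <= 1 -> Cmod (d1 t, d2 t) <= M) ->
  Cmod ((h1 1, h2 1) - (h1 0, h2 0)) <= M.
Proof.
  intros H1 H2 HM.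
  set (a := h1 1 - h1 0). set (b := h2 1 - h2 0).
  replace ((h1 1, h2 1) - (h1 0, h2 0))%C with ((a, b) : C)
    by (apply injective_projections; reflexivity).
  destruct (MVT_gen (fun t => a * h1 t + b * h2 t) 0 1 (fun t => a * d1 t + b * d2 t))
    as [xi [Hxi Heq]].
  - intros t Ht. rewrite Rmin_left, Rmax_right in Ht by lra.
    apply (is_derive_plus (V := R_NormedModule)); apply is_derive_scal;
      [apply H1|apply H2]; lra.
  - intros t Ht. rewrite Rmin_left, Rmax_right in Ht by lra.
    apply derivable_continuous_pt. exists (a * d1 t + b * d2 t). apply is_derive_Reals.
    apply (is_derive_plus (V := R_NormedModule)); apply is_derive_scal;
      [apply H1|apply H2]; lra.
  - rewrite Rmin_left, Rmax_right in Hxi by lra.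
    assert (Hsq : Cmod (a, b) * Cmod (a, b) = a * d1 xi + b * d2 xi).
    { transitivity (a * a + b * b).
      - unfold Cmod; simpl. rewrite sqrt_sqrt; [ring|nra].
      - unfold a, b in *. lra. }
    (* Cauchy-Schwarz, read off from |Re (v conj w)| <= |v| |w|. *)
    assert (Hcs : a * d1 xi + b * d2 xi <= Cmod (a, b) * Cmod (d1 xi, d2 xi)).
    { rewrite <- (Cmod_conj (d1 xi, d2 xi)), <- Cmod_mult.
      eapply Rle_trans; [|eapply Rle_trans; [apply Rle_abs|apply re_le_Cmod]].
      right; simpl; ring. }
    specialize (HM xi Hxi).
    pose proof (Cmod_ge_0 (a, b)) as Hp.
    destruct (Req_dec (Cmod (a, b)) 0) as [H0|H0].
    + rewrite H0. pose proof (Cmod_ge_0 (d1 xi, d2 xi)). lra.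
    + apply Rmult_le_reg_l with (Cmod (a, b)); [lra|].
      rewrite Hsq. eapply Rle_trans; [exact Hcs|]. apply Rmult_le_compat_l; lra.
Qed.

(** Mean value inequality along t -> exp (t w), whose derivative has modulus |w| exp (t Re w). *)
Lemma Cmod_Cexp_sub_1_le (w : C) : Cmod (Cexp w - 1) <= Cmod w * exp (Rmax 0 (Re w)).
Proof.
  destruct w as [x y].
  assert (H := Cmod_increment_le
    (fun t => exp (t * x) * cos (t * y)) (fun t => exp (t * x) * sin (t * y))
    (fun t => exp (t * x) * (x * cos (t * y) - y * sin (t * y)))
    (fun t => exp (t * x) * (x * sin (t * y) + y * cos (t * y)))
    (Cmod (x, y) * exp (Rmax 0 x))).
  match type of H with _ -> _ -> _ -> Cmod ?z <= _ => replace (Cexp (x, y) - 1)%C with z end.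
  - apply H.
    + intros t _. auto_derive; auto. ring.
    + intros t _. auto_derive; auto. ring.
    + intros t Ht.
      replace (exp (t * x) * (x * cos (t * y) - y * sin (t * y)),
               exp (t * x) * (x * sin (t * y) + y * cos (t * y)))
        with ((x, y) * Cexp (t * x, t * y)%R)%C
        by (unfold Cexp; C_components).
      rewrite Cmod_mult, Cmod_Cexp. simpl.
      apply Rmult_le_compat_l; [apply Cmod_ge_0|].
      assert (Hm : t * x <= Rmax 0 x).
      { destruct (Rle_dec 0 x) as [H0|H0].
        - rewrite Rmax_right by lra. nra.
        - rewrite Rmax_left by lra. nra. }
      now apply exp_le_mono.
  - unfold Cexp; simpl. rewrite !Rmult_1_l, !Rmult_0_l, exp_0, cos_0, sin_0.
    C_components.
Qed.

(** The same with t -> exp (t w) - t w, whose derivative w (exp (t w) - 1) is bounded by the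
    previous lemma; the 3 bounds exp 1. *)
Lemma Cmod_Cexp_sub_affine_le (w : C) :
  Cmod w <= 1 -> Cmod (Cexp w - 1 - w) <= 3 * (Cmod w * Cmod w).
Proof.
  intros Hw. destruct w as [x y].
  assert (H := Cmod_increment_le
    (fun t => exp (t * x) * cos (t * y) - t * x) (fun t => exp (t * x) * sin (t * y) - t * y)
    (fun t => exp (t * x) * (x * cos (t * y) - y * sin (t * y)) - x)
    (fun t => exp (t * x) * (x * sin (t * y) + y * cos (t * y)) - y)
    (3 * (Cmod (x, y) * Cmod (x, y)))).
  match type of H with _ -> _ -> _ -> Cmod ?z <= _ => replace (Cexp (x, y) - 1 - (x, y))%C with z end.
  - apply H.
    + intros t _. auto_derive; auto. ring.
    + intros t _. auto_derive; auto. ring.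
    + intros t Ht.
      replace (exp (t * x) * (x * cos (t * y) - y * sin (t * y)) - x,
               exp (t * x) * (x * sin (t * y) + y * cos (t * y)) - y)
        with ((x, y) * (Cexp (t * x, t * y)%R - 1))%C
        by (unfold Cexp; C_components).
      rewrite Cmod_mult.
      pose proof (Cmod_Cexp_sub_1_le (t * x, t * y)%R) as He. simpl in He.
      pose proof (Cmod_ge_0 (x, y)) as H0.
      assert (Hs : Cmod (t * x, t * y)%R <= Cmod (x, y)).
      { replace ((t * x, t * y)%R : C) with (RtoC t * (x, y))%C
          by (C_components).
        rewrite Cmod_mult, Cmod_R, Rabs_pos_eq by lra. nra. }
      assert (Hx : exp (Rmax 0 (t * x)) <= 3).
      { eapply Rle_trans; [|apply exp_le_3].
        assert (Hm : Rmax 0 (t * x) <= 1).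
        { apply Rmax_lub; [lra|].
          pose proof (re_le_Cmod (t * x, t * y)%R) as Hr. simpl in Hr.
          pose proof (Rle_abs (t * x)). lra. }
        now apply exp_le_mono. }
      pose proof (Cmod_ge_0 (t * x, t * y)%R). pose proof (exp_pos (Rmax 0 (t * x))).
      rewrite (Rmult_comm 3), Rmult_assoc. apply Rmult_le_compat_l; auto.
      eapply Rle_trans; [exact He|]. apply Rmult_le_compat; lra.
  - unfold Cexp; simpl. rewrite !Rmult_1_l, !Rmult_0_l, exp_0, cos_0, sin_0.
    C_components.
Qed.

Lemma is_derive_Cexp (p : C) :
  is_C_derive Cexp p (Cexp p).
Proof.
  apply is_C_derive_spec. intros eps Heps.
  set (k := 3 * Cmod (Cexp p) + 1).
  assert (Hk : 1 <= k) by (unfold k; pose proof (Cmod_ge_0 (Cexp p)); lra).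
  exists (Rmin 1 (eps / k)). split.
  { apply Rmin_glb_lt; [lra|apply Rdiv_lt_0_compat; lra]. }
  intros z Hz.
  assert (Hz1 : Cmod (z - p) < 1) by (eapply Rlt_le_trans; [exact Hz|apply Rmin_l]).
  assert (Hz2 : Cmod (z - p) < eps / k) by (eapply Rlt_le_trans; [exact Hz|apply Rmin_r]).
  apply (Rmult_lt_compat_l k) in Hz2; [|lra].
  replace (k * (eps / k)) with eps in Hz2 by (field; lra).
  replace (Cexp z) with (Cexp p * Cexp (z - p))%C by (rewrite <- Cexp_plus; f_equal; ring).
  replace (Cexp p * Cexp (z - p) - Cexp p - Cexp p * (z - p))%C with
    (Cexp p * (Cexp (z - p) - 1 - (z - p)))%C by ring.
  rewrite Cmod_mult.
  pose proof (Cmod_Cexp_sub_affine_le (z - p) ltac:(lra)) as H.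
  pose proof (Cmod_ge_0 (z - p)) as H0. pose proof (Cmod_ge_0 (Cexp p)) as H1.
  apply Rle_trans with (Cmod (Cexp p) * (3 * (Cmod (z - p) * Cmod (z - p)))).
  - now apply Rmult_le_compat_l.
  - unfold k in Hz2. nra.
Qed.

(** [C] carries two normed module structures: the product and chain rules concern functions into the
    scalar ring, whereas [entire2] is stated with [C_NormedModule]. *)
Lemma is_derive_C_AbsRing (f : C -> C) (p d : C) :
  is_C_derive f p d <->
  is_derive (K := C_AbsRing) (V := AbsRing_NormedModule C_AbsRing) f p d.
Proof.
  split; intros [_ H].
  - split; [exact (is_linear_scal_l (K := C_AbsRing) (V := AbsRing_NormedModule C_AbsRing) d)|].
    exact H.
  - split; [exact (is_linear_scal_l (K := C_AbsRing) (V := C_NormedModule) d)|].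
    exact H.
Qed.

Lemma C_differentiable_mult (f g : C -> C) :
  C_differentiable f -> C_differentiable g -> C_differentiable (fun z => f z * g z)%C.
Proof.
  intros Hf Hg p. destruct (Hf p) as [df Hdf], (Hg p) as [dg Hdg].
  exists (df * g p + f p * dg)%C.
  apply is_derive_C_AbsRing in Hdf, Hdg. apply is_derive_C_AbsRing.
  apply (is_derive_mult (K := C_AbsRing) f g p df dg Hdf Hdg).
  intros n m; apply Cmult_comm.
Qed.

Lemma C_differentiable_plus (f g : C -> C) :
  C_differentiable f -> C_differentiable g -> C_differentiable (fun z => f z + g z)%C.
Proof.
  intros Hf Hg p. destruct (Hf p) as [df Hdf], (Hg p) as [dg Hdg].
  exists (df + dg)%C.
  exact (is_derive_plus (K := C_AbsRing) (V := C_NormedModule) f g p df dg Hdf Hdg).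
Qed.

Lemma C_differentiable_Cexp (f : C -> C) :
  C_differentiable f -> C_differentiable (fun z => Cexp (f z)).
Proof.
  intros Hf p. destruct (Hf p) as [df Hdf]. exists (df * Cexp (f p))%C.
  apply is_derive_C_AbsRing in Hdf.
  exact (is_derive_comp (K := C_AbsRing) (V := C_NormedModule) Cexp f p _ _ (is_derive_Cexp (f p)) Hdf).
Qed.

Lemma C_differentiable_ext (f g : C -> C) :
  (forall z, f z = g z) -> C_differentiable f -> C_differentiable g.
Proof.
  intros Hfg Hf p. destruct (Hf p) as [d Hd]. exists d.
  exact (is_derive_ext (K := C_AbsRing) (V := C_NormedModule) f g p d Hfg Hd).
Qed.

Lemma C_differentiable_const (u : C) : C_differentiable (fun _ => u).
Proof.
  apply (C_differentiable_ext (fun z => u + 0 * z)%C); [intros; ring|].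
  apply C_differentiable_affine.
Qed.

Lemma C_differentiable_id : C_differentiable (fun z => z).
Proof.
  apply (C_differentiable_ext (fun z => 0 + 1 * z)%C); [intros; ring|].
  apply C_differentiable_affine.
Qed.

(** * Unique continuation *)

Lemma C_differentiable_bounded_segment (f : C -> C) (u v : C) (a b : R) :
  C_differentiable f -> a <= b ->
  exists B, 0 <= B /\ forall t, a <= t <= b -> Cmod (f (u + t * v)%C) <= B.
Proof.
  intros Hf Hab.
  destruct (continuity_ab_maj (fun t => Cmod (f (u + t * v)%C)) a b Hab) as [m [Hm _]].
  - intros t _. intros eps Heps.
    destruct (C_differentiable_continuous f (u + t * v)%C eps Hf Heps) as [d [Hd H]].
    set (k := Cmod v + 1).
    assert (Hk : 0 < k) by (unfold k; pose proof (Cmod_ge_0 v); lra).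
    exists (d / k). split; [apply Rdiv_lt_0_compat; lra|].
    intros s [_ Hs]. simpl in Hs |- *. unfold Rdist in *.
    assert (Hd' : Cmod (u + s * v - (u + t * v)) < d).
    { replace (u + s * v - (u + t * v))%C with (RtoC (s - t) * v)%C
        by (rewrite RtoC_minus; ring).
      rewrite Cmod_mult, Cmod_R.
      apply (Rmult_lt_compat_r k) in Hs; auto.
      replace (d / k * k) with d in Hs by (field; lra).
      eapply Rle_lt_trans; [|exact Hs].
      apply Rmult_le_compat_l; [apply Rabs_pos|unfold k; lra]. }
    specialize (H _ Hd').
    set (p := f (u + s * v)%C) in *. set (q := f (u + t * v)%C) in *.
    apply Rabs_def1.
    + replace p with ((p - q) + q)%C by ring.
      pose proof (Cmod_triangle (p - q) q). lra.
    + assert (Hq : Cmod q <= Cmod (p - q) + Cmod p).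
      { replace q with (- (p - q) + p)%C at 1 by ring.
        eapply Rle_trans; [apply Cmod_triangle|]. rewrite Cmod_opp. lra. }
      lra.
  - exists (Cmod (f (u + m * v)%C)). split; [apply Cmod_ge_0|exact Hm].
Qed.

Lemma continuous_gauss (lam t : R) : continuous (fun y => exp (- lam * (y * y))) t.
Proof.
  apply (ex_derive_continuous (fun y => exp (- lam * (y * y)))). auto_derive; auto.
Qed.

Lemma ex_RInt_gauss (lam a b : R) : ex_RInt (fun y => exp (- lam * (y * y))) a b.
Proof.
  apply (ex_RInt_continuous (V := R_CompleteNormedModule)).
  intros t _. apply continuous_gauss.
Qed.

(** Only the middle half is kept: its rate eta^2 / 4 wins, as lam grows, over the rate eta^2 that
    holds on the left side outside [-eta, eta]. *)
Lemma RInt_gauss_ge (lam eta : R) :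
  0 < lam -> 0 < eta ->
  eta * exp (- lam * (eta * eta) / 4) <= RInt (fun y => exp (- lam * (y * y))) (- eta) eta.
Proof.
  intros Hlam Heta.
  set (g := fun y => exp (- lam * (y * y))).
  assert (Hg : forall a b, a <= b -> 0 <= RInt g a b).
  { intros a b Hab. apply RInt_ge_0; auto. { apply ex_RInt_gauss. }
    intros x _. left; apply exp_pos. }
  rewrite <- (RInt_Chasles g (- eta) (- (eta / 2)) eta) by apply ex_RInt_gauss.
  rewrite <- (RInt_Chasles g (- (eta / 2)) (eta / 2) eta) by apply ex_RInt_gauss.
  unfold plus; simpl.
  pose proof (Hg (- eta) (- (eta / 2)) ltac:(lra)).
  pose proof (Hg (eta / 2) eta ltac:(lra)).
  assert (Hmid : RInt (fun _ => exp (- lam * (eta * eta) / 4)) (- (eta / 2)) (eta / 2)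
                 <= RInt g (- (eta / 2)) (eta / 2)).
  { apply RInt_le; try lra.
    - apply ex_RInt_const.
    - apply ex_RInt_gauss.
    - intros x Hx. apply exp_le_mono.
      assert (x * x <= eta * eta / 4) by nra. nra. }
  rewrite RInt_const in Hmid. unfold scal in Hmid; simpl in Hmid. unfold mult in Hmid; simpl in Hmid.
  replace ((eta / 2 - - (eta / 2)) * exp (- lam * (eta * eta) / 4))
    with (eta * exp (- lam * (eta * eta) / 4)) in Hmid by field.
  lra.
Qed.

Definition gauss (lam : R) (z : C) : C := Cexp (RtoC lam * (z * z))%C.

Lemma C_differentiable_gauss (lam : R) : C_differentiable (gauss lam).
Proof.
  apply C_differentiable_Cexp.
  apply (C_differentiable_mult (fun _ => RtoC lam) (fun z => z * z)%C).
  - apply C_differentiable_const.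
  - apply (C_differentiable_mult (fun z => z) (fun z => z)); apply C_differentiable_id.
Qed.

Lemma Cmod_gauss (lam x y : R) : Cmod (gauss lam (x, y)) = exp (lam * (x * x - y * y)).
Proof. unfold gauss. rewrite Cmod_Cexp. f_equal. simpl. ring. Qed.

Lemma gauss_imaginary (lam y : R) : gauss lam (0, y) = RtoC (exp (- lam * (y * y))).
Proof.
  unfold gauss, Cexp. simpl.
  replace (lam * (0 * 0 - y * y) - 0 * (0 * y + y * 0)) with (- lam * (y * y)) by ring.
  replace (lam * (0 * y + y * 0) + 0 * (0 * 0 - y * y)) with 0 by ring.
  rewrite cos_0, sin_0. C_components.
Qed.

(* Goursat for [g * gauss lam]: on the imaginary axis the weight concentrates at
   [0], while it is exponentially small on the horizontal sides. *)
Lemma gauss_contour_estimate (g : C -> C) (c eta lam B e k : R) (w : C) :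
  C_differentiable g -> 0 < c -> 0 < lam -> 0 < eta <= c -> 0 <= B -> 0 <= e -> 0 <= k ->
  (forall y, -(2 * c) <= y <= 2 * c -> Cmod (g (0, y)) <= B) ->
  (forall x, 0 <= x <= c -> Cmod (g (x, -(2 * c))) <= B /\ Cmod (g (x, 2 * c)) <= B) ->
  (forall y, -(2 * c) <= y <= 2 * c -> Cmod (g (c, y)) <= e) ->
  (forall y, - eta <= y <= eta -> Cmod (g (0, y) - w) <= k) ->
  (Cmod w - k) * RInt (fun y => exp (- lam * (y * y))) (- eta) eta <=
    6 * c * B * exp (- lam * (eta * eta)) + 4 * c * e * exp (lam * (c * c)).
Proof.
  intros Hg Hc Hlam Heta HB He Hk Hleft Hhor Hright Hw.
  set (f := fun z => (g z * gauss lam z)%C).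
  assert (Hf : C_differentiable f)
    by (apply C_differentiable_mult; auto; apply C_differentiable_gauss).
  assert (HexV : forall x a b, ex_CInt (fun y => f (x, y)) a b)
    by (intros; now apply ex_RInt_vertical).
  assert (HexH : forall y a b, ex_CInt (fun x => f (x, y)) a b)
    by (intros; now apply ex_RInt_horizontal).
  pose proof (Goursat f 0 c (-(2 * c)) (2 * c) Hf ltac:(lra) ltac:(lra)) as HG.
  unfold rectangle_integral in HG.
  set (bot := Cint (fun x => f (x, -(2 * c))) 0 c) in HG.
  set (top := Cint (fun x => f (x, 2 * c)) 0 c) in HG.
  set (right := Cint (fun y => f (c, y)) (-(2 * c)) (2 * c)) in HG.
  assert (Hsplit : Cint (fun y => f (0, y)) (-(2 * c)) (2 * c) =
    (Cint (fun y => f (0, y)) (-(2 * c)) (- eta) + (Cint (fun y => f (0, y)) (- eta) eta +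
     Cint (fun y => f (0, y)) eta (2 * c)))%C).
  { rewrite <- !Cint_Chasles by apply HexV. reflexivity. }
  rewrite Hsplit in HG. clear Hsplit.
  set (lo := Cint (fun y => f (0, y)) (-(2 * c)) (- eta)) in HG.
  set (hi := Cint (fun y => f (0, y)) eta (2 * c)) in HG.
  set (mid := Cint (fun y => f (0, y)) (- eta) eta) in HG.
  set (E := exp (- lam * (eta * eta))).
  assert (HE : 0 < E) by apply exp_pos.
  (* The half-height 2c is chosen for this: on the horizontal sides x^2 - y^2 <= c^2 - 4 c^2 <= -
     eta^2, because eta <= c. *)
  assert (Hf_le : forall x y K, Cmod (g (x, y)) <= K -> x * x - y * y <= - (eta * eta) ->
    Cmod (f (x, y)) <= K * E).
  { intros x y K HK Hxy. unfold f. rewrite Cmod_mult, Cmod_gauss.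
    apply Rmult_le_compat; [apply Cmod_ge_0|left; apply exp_pos|exact HK|].
    apply exp_le_mono. nra. }
  assert (HBE : 0 <= B * E) by (apply Rmult_le_pos; lra).
  assert (Hbot : Cmod bot <= (c - 0) * (B * E)).
  { apply Cmod_Cint_le; auto; [lra|]. intros x Hx. apply Hf_le; [now apply Hhor|nra]. }
  assert (Htop : Cmod top <= (c - 0) * (B * E)).
  { apply Cmod_Cint_le; auto; [lra|]. intros x Hx. apply Hf_le; [now apply Hhor|nra]. }
  assert (Hlo : Cmod lo <= (- eta - - (2 * c)) * (B * E)).
  { apply Cmod_Cint_le; auto; [lra|]. intros y Hy. apply Hf_le; [apply Hleft; lra|nra]. }
  assert (Hhi : Cmod hi <= (2 * c - eta) * (B * E)).
  { apply Cmod_Cint_le; auto; [lra|]. intros y Hy. apply Hf_le; [apply Hleft; lra|nra]. }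
  assert (Hrt : Cmod right <= (2 * c - - (2 * c)) * (e * exp (lam * (c * c)))).
  { apply Cmod_Cint_le; auto; [lra|]. intros y Hy. unfold f. rewrite Cmod_mult, Cmod_gauss.
    apply Rmult_le_compat; [apply Cmod_ge_0|left; apply exp_pos|now apply Hright|].
    apply exp_le_mono. apply Rmult_le_compat_l; [lra|]. nra. }
  set (I := RInt (fun y => exp (- lam * (y * y))) (- eta) eta).
  assert (HI0 : 0 <= I).
  { apply RInt_ge_0; [lra|apply ex_RInt_gauss|]. intros; left; apply exp_pos. }
  assert (HIw : is_RInt (V := C_R_NormedModule)
            (fun y => w * RtoC (exp (- lam * (y * y))))%C (- eta) eta (w * RtoC I)%C).
  { apply (is_RInt_ext (V := C_R_NormedModule)
      (fun y => (scal (Re w) (exp (- lam * (y * y))), scal (Im w) (exp (- lam * (y * y)))))).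
    { intros y _. destruct w; apply injective_projections; unfold scal; simpl; unfold mult; simpl; ring. }
    replace (w * RtoC I)%C with ((scal (Re w) I, scal (Im w) I) : C)
      by (destruct w; apply injective_projections; unfold scal; simpl; unfold mult; simpl; ring).
    apply (is_RInt_fct_extend_pair (U := R_NormedModule) (V := R_NormedModule));
      apply (is_RInt_scal (V := R_NormedModule)); apply (RInt_correct (V := R_CompleteNormedModule));
      apply ex_RInt_gauss. }
  assert (Hmid : Cmod (mid - w * RtoC I) <= k * I).
  { rewrite <- norm_C_R.
    apply (norm_RInt_le (V := C_R_NormedModule)
      (fun y => f (0, y) - w * RtoC (exp (- lam * (y * y))))%C
      (fun y => k * exp (- lam * (y * y))) (- eta) eta); [lra| | |].
    - intros y Hy. rewrite norm_C_R. unfold f. rewrite gauss_imaginary.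
      replace (g (0%R, y) * RtoC (exp (- lam * (y * y))) - w * RtoC (exp (- lam * (y * y))))%C
        with ((g (0%R, y) - w) * RtoC (exp (- lam * (y * y))))%C by ring.
      rewrite Cmod_mult, Cmod_R, Rabs_pos_eq by (left; apply exp_pos).
      apply Rmult_le_compat_r; [left; apply exp_pos|]. now apply Hw.
    - apply (is_RInt_minus (V := C_R_NormedModule)); [|exact HIw].
      apply (RInt_correct (V := C_R_CompleteNormedModule)), HexV.
    - apply (is_RInt_scal (V := R_NormedModule)). apply (RInt_correct (V := R_CompleteNormedModule)).
      apply ex_RInt_gauss. }
  assert (Hw1 : Cmod w * I <= Cmod mid + k * I).
  { replace (Cmod w * I) with (Cmod (w * RtoC I)) by (rewrite Cmod_mult, Cmod_R, Rabs_pos_eq; auto).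
    replace (w * RtoC I)%C with (mid + - (mid - w * RtoC I))%C by ring.
    eapply Rle_trans; [apply Cmod_triangle|]. rewrite Cmod_opp. lra. }
  assert (Hm : Cmod mid <= Cmod bot + Cmod top + Cmod right + Cmod lo + Cmod hi).
  { assert (Heq : (Ci * mid = bot + Ci * right + - top + - (Ci * lo) + - (Ci * hi))%C).
    { transitivity (Ci * mid + (bot + Ci * right - top - Ci * (lo + (mid + hi))))%C;
        [rewrite HG|]; ring. }
    replace (Cmod mid) with (Cmod (Ci * mid)) by (rewrite Cmod_mult, Cmod_Ci; ring).
    rewrite Heq.
    eapply Rle_trans; [apply Cmod_triangle|].
    eapply Rle_trans; [apply Rplus_le_compat_r, Cmod_triangle|].
    eapply Rle_trans; [apply Rplus_le_compat_r, Rplus_le_compat_r, Cmod_triangle|].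
    eapply Rle_trans; [apply Rplus_le_compat_r, Rplus_le_compat_r, Rplus_le_compat_r, Cmod_triangle|].
    rewrite !Cmod_opp, !Cmod_mult, Cmod_Ci. lra. }
  (* Lengths: c + c for the horizontal sides and at most 4c for the left side outside [-eta, eta]
     make 6c; the right side has length 4c. *)
  fold I E. nra.
Qed.

(** A uniformly Cauchy sequence stands in for its limit. If [h n 0] did not tend to 0, the Gaussian
    estimate would bound a multiple of exp (- lam eta^2 / 4) by one of exp (- lam eta^2), plus the
    right side's contribution e exp (lam c^2), where e can be made small after lam is fixed. *)
Lemma unique_continuation (h : nat -> C -> C) (c : R) :
  0 < c ->
  (forall n, C_differentiable (h n)) ->
  (forall eps, 0 < eps -> exists N, forall n m x y, (N <= n)%nat -> (N <= m)%nat ->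
     0 <= x <= c -> -(2 * c) <= y <= 2 * c -> Cmod (h n (x, y) - h m (x, y)) <= eps) ->
  (forall y, -(2 * c) <= y <= 2 * c -> forall eps, 0 < eps -> exists N, forall n, (N <= n)%nat ->
     Cmod (h n (c, y)) <= eps) ->
  forall eps, 0 < eps -> exists N, forall n, (N <= n)%nat -> Cmod (h n 0) <= eps.
Proof.
  intros Hc Hd Hcauchy Hlim eps Heps. apply NNPP. intros Hcontra.
  assert (Hbig : forall N, exists n, (N <= n)%nat /\ eps < Cmod (h n 0)).
  { intros N. apply NNPP. intros Hn. apply Hcontra. exists N. intros n HNn.
    apply Rnot_lt_le. intros Hlt. apply Hn. exists n; auto. }
  clear Hcontra.
  destruct (Hcauchy (eps / 8) ltac:(lra)) as [N1 HN1].
  destruct (Hbig N1) as [n0 [Hn0 Hw]].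
  set (w := h n0 0%C) in *.
  destruct (C_differentiable_continuous (h n0) 0%C (eps / 8) (Hd n0) ltac:(lra)) as [d [Hdpos Hcont]].
  set (eta := Rmin (d / 2) c).
  assert (Heta : 0 < eta <= c).
  { split; [apply Rmin_glb_lt; lra|apply Rmin_r]. }
  assert (Hetad : eta <= d / 2) by apply Rmin_l.
  destruct (C_differentiable_bounded_segment (h n0) 0 Ci (-(2 * c)) (2 * c) (Hd n0) ltac:(lra))
    as [B1 [HB1 Hb1]].
  destruct (C_differentiable_bounded_segment (h n0) (0, -(2 * c)) 1 0 c (Hd n0) ltac:(lra))
    as [B2 [HB2 Hb2]].
  destruct (C_differentiable_bounded_segment (h n0) (0, 2 * c) 1 0 c (Hd n0) ltac:(lra))
    as [B3 [HB3 Hb3]].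
  set (B := B1 + B2 + B3 + eps).
  assert (Hnear : forall n x y K, (N1 <= n)%nat -> 0 <= x <= c -> -(2 * c) <= y <= 2 * c ->
    Cmod (h n0 (x, y)) <= K -> Cmod (h n (x, y)) <= K + eps / 8).
  { intros n x y K Hn Hx Hy HK.
    replace (h n (x, y)) with ((h n (x, y) - h n0 (x, y)) + h n0 (x, y))%C by ring.
    eapply Rle_trans; [apply Cmod_triangle|].
    specialize (HN1 n n0 x y Hn Hn0 Hx Hy). lra. }
  (* The index n depends on e, but [w], [B] and [eta] come from the fixed [n0]. Being uniformly
     Cauchy turns pointwise smallness on the right side into the uniform bound e. *)
  assert (Hest : forall lam e, 0 < lam -> 0 < e ->
    eps / 2 * (eta * exp (- lam * (eta * eta) / 4)) <=
      6 * c * B * exp (- lam * (eta * eta)) + 4 * c * e * exp (lam * (c * c))).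
  { intros lam e Hlam He.
    destruct (Hcauchy (e / 2) ltac:(lra)) as [N2 HN2].
    set (n := Nat.max N1 N2).
    assert (Hn1 : (N1 <= n)%nat) by (unfold n; lia).
    assert (Hn2 : (N2 <= n)%nat) by (unfold n; lia).
    assert (HI := RInt_gauss_ge lam eta Hlam ltac:(lra)).
    apply Rle_trans with ((Cmod w - eps / 4) *
      RInt (fun y => exp (- lam * (y * y))) (- eta) eta).
    { apply Rmult_le_compat; try lra.
      apply Rmult_le_pos; [lra|left; apply exp_pos]. }
    apply (gauss_contour_estimate (h n)); auto; try lra.
    - unfold B; lra.
    - intros y Hy. eapply Rle_trans; [apply (Hnear n 0 y B1); auto; [lra|]|unfold B; lra].
      specialize (Hb1 y Hy).
      replace (0 + y * Ci)%C with ((0, y) : C) in Hb1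
        by (C_components). exact Hb1.
    - intros x Hx. split.
      + eapply Rle_trans; [apply (Hnear n x (-(2 * c)) B2); auto; [lra|]|unfold B; lra].
        specialize (Hb2 x Hx).
        replace ((0%R, (-(2 * c))%R) + x * 1)%C with ((x, -(2 * c)) : C) in Hb2
          by (C_components). exact Hb2.
      + eapply Rle_trans; [apply (Hnear n x (2 * c) B3); auto; [lra|]|unfold B; lra].
        specialize (Hb3 x Hx).
        replace ((0%R, (2 * c)%R) + x * 1)%C with ((x, 2 * c) : C) in Hb3
          by (C_components). exact Hb3.
    - intros y Hy.
      destruct (Hlim y Hy (e / 2) ltac:(lra)) as [N3 HN3].
      set (m := Nat.max N2 N3).
      replace (h n (c, y)) with ((h n (c, y) - h m (c, y)) + h m (c, y))%C by ring.
      eapply Rle_trans; [apply Cmod_triangle|].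
      specialize (HN3 m ltac:(unfold m; lia)).
      specialize (HN2 n m c y Hn2 ltac:(unfold m; lia) ltac:(lra) Hy). lra.
    - intros y Hy.
      replace (h n (0, y) - w)%C with ((h n (0%R, y) - h n0 (0%R, y)) + (h n0 (0%R, y) - w))%C by ring.
      eapply Rle_trans; [apply Cmod_triangle|].
      specialize (HN1 n n0 0 y Hn1 Hn0 ltac:(lra) ltac:(lra)).
      assert (Hc2 : Cmod (h n0 (0, y) - w) < eps / 8).
      { apply Hcont. replace ((0%R, y) - 0)%C with (Ci * RtoC y)%C
          by (C_components).
        rewrite Cmod_mult, Cmod_Ci, Cmod_R, Rmult_1_l.
        assert (Rabs y <= eta) by (apply Rabs_le; lra). lra. }
      lra. }
  assert (HB : 0 < B) by (unfold B; lra).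
  set (D := 6 * c * B). assert (HD : 0 < D) by (unfold D; apply Rmult_lt_0_compat; lra).
  (* Makes 3/4 lam eta^2 equal to X = 4 D / (eps eta); then exp X > 1 + X yields D exp (-X) < eps
     eta / 4. *)
  set (lam := (4 * D / (eps * eta)) * (4 / 3 / (eta * eta))).
  assert (Hee : 0 < eta * eta) by (apply Rmult_lt_0_compat; lra).
  assert (Hepe : 0 < eps * eta) by (apply Rmult_lt_0_compat; lra).
  assert (Hlam : 0 < lam).
  { unfold lam. apply Rmult_lt_0_compat; apply Rdiv_lt_0_compat; lra. }
  set (X := 4 * D / (eps * eta)).
  assert (HX : 3 / 4 * lam * (eta * eta) = X) by (unfold lam, X; field; lra).
  assert (HX0 : 0 < X) by (unfold X; apply Rdiv_lt_0_compat; lra).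
  set (G := exp (- lam * (eta * eta) / 4)).
  assert (HG0 : 0 < G) by apply exp_pos.
  assert (HGe : exp (- lam * (eta * eta)) = G * exp (- X)).
  { unfold G. rewrite <- exp_plus. f_equal. rewrite <- HX. field. }
  assert (HeX : D * exp (- X) < eps * eta / 4).
  { assert (H1 : 1 + X < exp X) by (apply exp_ineq1; lra).
    rewrite exp_Ropp. apply Rmult_lt_reg_r with (exp X); [apply exp_pos|].
    rewrite Rmult_assoc, Rinv_l, Rmult_1_r by (apply Rgt_not_eq, exp_pos).
    apply Rlt_trans with (eps * eta / 4 * (1 + X)).
    - rewrite Rmult_plus_distr_l.
      replace (eps * eta / 4 * X) with D by (unfold X; field; lra). lra.
    - apply Rmult_lt_compat_l; lra. }
  set (F := 4 * c * exp (lam * (c * c))).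
  assert (HF : 0 < F) by (unfold F; apply Rmult_lt_0_compat; [lra|apply exp_pos]).
  (* With e = gap / F the right side contributes exactly [gap], and [Hest] reads G eps eta / 2 <= G
     eps eta / 4. *)
  set (gap := G * (eps * eta / 4 - D * exp (- X))).
  assert (Hgap : 0 < gap) by (unfold gap; apply Rmult_lt_0_compat; lra).
  specialize (Hest lam (gap / F) Hlam ltac:(apply Rdiv_lt_0_compat; lra)).
  fold G D in Hest. rewrite HGe in Hest.
  replace (4 * c * (gap / F) * exp (lam * (c * c))) with gap in Hest
    by (unfold F; field; split; [apply Rgt_not_eq, exp_pos|lra]).
  assert (Hpos : 0 < G * (eps * eta)) by (apply Rmult_lt_0_compat; lra).
  unfold gap in Hest. nra.
Qed.

(** * Finite complex and real sums *)

Fixpoint csum (f : nat -> C) (n : nat) : C :=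
  match n with O => 0%C | S k => (csum f k + f k)%C end.

Fixpoint rsum (f : nat -> R) (n : nat) : R :=
  match n with O => 0 | S k => rsum f k + f k end.

Lemma csum_ext (f g : nat -> C) (n : nat) :
  (forall i, (i < n)%nat -> f i = g i) -> csum f n = csum g n.
Proof.
  induction n as [|n IH]; intros H; simpl; auto.
  rewrite IH, H by (auto; intros; apply H; lia). reflexivity.
Qed.

Lemma csum_plus (f g : nat -> C) (n : nat) :
  csum (fun i => f i + g i)%C n = (csum f n + csum g n)%C.
Proof. induction n as [|n IH]; simpl; [|rewrite IH]; ring. Qed.

Lemma csum_minus (f g : nat -> C) (n : nat) :
  csum (fun i => f i - g i)%C n = (csum f n - csum g n)%C.
Proof. induction n as [|n IH]; simpl; [|rewrite IH]; ring. Qed.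

Lemma csum_mult_l (c : C) (f : nat -> C) (n : nat) :
  csum (fun i => c * f i)%C n = (c * csum f n)%C.
Proof. induction n as [|n IH]; simpl; [|rewrite IH]; ring. Qed.

Lemma csum_mult_r (c : C) (f : nat -> C) (n : nat) :
  csum (fun i => f i * c)%C n = (csum f n * c)%C.
Proof. induction n as [|n IH]; simpl; [|rewrite IH]; ring. Qed.

Lemma csum_0 (n : nat) : csum (fun _ => 0%C) n = 0%C.
Proof. induction n as [|n IH]; simpl; [|rewrite IH]; ring. Qed.

Lemma csum_const (c : C) (n : nat) : csum (fun _ => c) n = (RtoC (INR n) * c)%C.
Proof. induction n as [|n IH]; [simpl; ring|]. rewrite S_INR, RtoC_plus. simpl. rewrite IH. ring. Qed.

Lemma csum_swap (f : nat -> nat -> C) (n m : nat) :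
  csum (fun i => csum (f i) m) n = csum (fun j => csum (fun i => f i j) n) m.
Proof.
  induction n as [|n IH]; simpl; [now rewrite csum_0|]. now rewrite IH, csum_plus.
Qed.

Lemma csum_add (f : nat -> C) (n m : nat) :
  csum f (n + m) = (csum f n + csum (fun i => f (n + i)%nat) m)%C.
Proof.
  induction m as [|m IH]; [rewrite Nat.add_0_r; simpl; ring|].
  rewrite Nat.add_succ_r. simpl. rewrite IH. ring.
Qed.

Lemma csum_S_l (f : nat -> C) (n : nat) : csum f (S n) = (f 0%nat + csum (fun i => f (S i)) n)%C.
Proof. change (S n) with (1 + n)%nat. rewrite csum_add. simpl. ring. Qed.

Lemma csum_conj (f : nat -> C) (n : nat) : Cconj (csum f n) = csum (fun i => Cconj (f i)) n.
Proof.
  induction n as [|n IH]; simpl; [C_components|].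
  now rewrite Cplus_conj, IH.
Qed.

Lemma rsum_ext (f g : nat -> R) (n : nat) :
  (forall i, (i < n)%nat -> f i = g i) -> rsum f n = rsum g n.
Proof.
  induction n as [|n IH]; intros H; simpl; auto.
  rewrite IH, H by (auto; intros; apply H; lia). reflexivity.
Qed.

Lemma rsum_le (f g : nat -> R) (n : nat) :
  (forall i, (i < n)%nat -> f i <= g i) -> rsum f n <= rsum g n.
Proof.
  induction n as [|n IH]; intros H; simpl; [lra|].
  apply Rplus_le_compat; [apply IH; intros; apply H; lia|apply H; lia].
Qed.

Lemma rsum_plus (f g : nat -> R) (n : nat) :
  rsum (fun i => f i + g i) n = rsum f n + rsum g n.
Proof. induction n as [|n IH]; simpl; [|rewrite IH]; ring. Qed.

Lemma rsum_mult_l (c : R) (f : nat -> R) (n : nat) : rsum (fun i => c * f i) n = c * rsum f n.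
Proof. induction n as [|n IH]; simpl; [|rewrite IH]; ring. Qed.

Lemma rsum_const (c : R) (n : nat) : rsum (fun _ => c) n = INR n * c.
Proof. induction n as [|n IH]; [simpl; ring|]. rewrite S_INR. simpl. rewrite IH. ring. Qed.

Lemma rsum_nonneg (f : nat -> R) (n : nat) :
  (forall i, (i < n)%nat -> 0 <= f i) -> 0 <= rsum f n.
Proof.
  intros H. rewrite <- (Rmult_0_r (INR n)), <- rsum_const. now apply rsum_le.
Qed.

Lemma rsum_swap (f : nat -> nat -> R) (n m : nat) :
  rsum (fun i => rsum (f i) m) n = rsum (fun j => rsum (fun i => f i j) n) m.
Proof.
  induction n as [|n IH]; simpl.
  - rewrite rsum_const. ring.
  - now rewrite IH, rsum_plus.
Qed.

Lemma rsum_add (f : nat -> R) (n m : nat) :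
  rsum f (n + m) = rsum f n + rsum (fun i => f (n + i)%nat) m.
Proof.
  induction m as [|m IH]; [rewrite Nat.add_0_r; simpl; ring|].
  rewrite Nat.add_succ_r. simpl. rewrite IH. ring.
Qed.

Lemma rsum_S_l (f : nat -> R) (n : nat) : rsum f (S n) = f 0%nat + rsum (fun i => f (S i)) n.
Proof. change (S n) with (1 + n)%nat. rewrite rsum_add. simpl. ring. Qed.

Lemma Cmod_csum_le (f : nat -> C) (n : nat) : Cmod (csum f n) <= rsum (fun i => Cmod (f i)) n.
Proof.
  induction n as [|n IH]; simpl; [rewrite Cmod_0; lra|].
  eapply Rle_trans; [apply Cmod_triangle|]. lra.
Qed.

Lemma Cmod_csum_le_rsum (f : nat -> C) (g : nat -> R) (n : nat) :
  (forall i, (i < n)%nat -> Cmod (f i) <= g i) -> Cmod (csum f n) <= rsum g n.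
Proof. intros H. eapply Rle_trans; [apply Cmod_csum_le|now apply rsum_le]. Qed.

Lemma csum_RtoC (f : nat -> R) (n : nat) : csum (fun i => RtoC (f i)) n = RtoC (rsum f n).
Proof. induction n as [|n IH]; simpl; [reflexivity|]. now rewrite IH, RtoC_plus. Qed.

(** * Additive characters *)

(** The standard additive character e(x) = exp (2 pi i x). *)
Definition eul (x : R) : C := Cexp (0, 2 * PI * x).

Lemma eul_plus (x y : R) : eul (x + y) = (eul x * eul y)%C.
Proof.
  unfold eul. rewrite <- Cexp_plus. f_equal.
  C_components.
Qed.

Lemma Cmod_eul (x : R) : Cmod (eul x) = 1.
Proof. unfold eul. rewrite Cmod_Cexp. simpl. apply exp_0. Qed.

Lemma eul_0 : eul 0 = 1%C.
Proof. unfold eul. rewrite Rmult_0_r. apply Cexp_0. Qed.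

Lemma eul_1 : eul 1 = 1%C.
Proof.
  unfold eul, Cexp. simpl. rewrite Rmult_1_r, exp_0, cos_2PI, sin_2PI.
  C_components.
Qed.

Lemma eul_INR (n : nat) : eul (INR n) = 1%C.
Proof.
  induction n as [|n IH]; [apply eul_0|]. rewrite S_INR, eul_plus, IH, eul_1. ring.
Qed.

Lemma eul_opp (x : R) : eul (- x) = Cconj (eul x).
Proof.
  unfold eul, Cexp. simpl. rewrite Ropp_mult_distr_r_reverse, cos_neg, sin_neg.
  C_components.
Qed.

Lemma eul_IZR (k : Z) : eul (IZR k) = 1%C.
Proof.
  destruct (Z_le_gt_dec 0 k) as [H|H].
  - rewrite <- (Z2Nat.id k H), <- INR_IZR_INZ. apply eul_INR.
  - replace k with (- Z.of_nat (Z.to_nat (- k)))%Z by lia.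
    rewrite opp_IZR, <- INR_IZR_INZ, eul_opp, eul_INR.
    C_components.
Qed.

(** Factor out e(x/2): what remains, e(x/2) - e(-x/2), is 2 i sin (pi x). *)
Lemma Cmod_eul_sub_1 (x : R) : Cmod (eul x - 1) = 2 * Rabs (sin (PI * x)).
Proof.
  replace (eul x - 1)%C with (eul (x / 2) * (RtoC (2 * sin (PI * x)) * Ci))%C.
  - rewrite !Cmod_mult, Cmod_eul, Cmod_Ci, Cmod_R, Rabs_mult, (Rabs_pos_eq 2) by lra. ring.
  - replace (eul x) with (eul (x / 2 + x / 2)) by (f_equal; field).
    rewrite eul_plus. unfold eul, Cexp. simpl. rewrite exp_0.
    replace (2 * PI * (x / 2)) with (PI * x) by field.
    pose proof (sin2_cos2 (PI * x)) as H. unfold Rsqr in H.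
    apply injective_projections; simpl; nra.
Qed.

Lemma sin_ge_chord (x : R) : 0 <= x <= PI / 2 -> 2 / PI * x <= sin x.
Proof.
  intros Hx. pose proof PI_RGT_0 as Hpi.
  destruct (Req_dec x 0) as [->|Hx0]; [rewrite sin_0; lra|].
  destruct (Req_dec x (PI / 2)) as [->|Hx1].
  { rewrite sin_PI2. right; field; lra. }
  assert (Hx' : 0 < x < PI / 2) by lra.
  (* Concavity, through the mean value theorem on both sides of [x]. *)
  destruct (MVT_cor2 sin cos 0 x ltac:(lra)) as [c1 [Hc1 Hc1']].
  { intros c _. apply derivable_pt_lim_sin. }
  destruct (MVT_cor2 sin cos x (PI / 2) ltac:(lra)) as [c2 [Hc2 Hc2']].
  { intros c _. apply derivable_pt_lim_sin. }
  rewrite sin_0 in Hc1. rewrite sin_PI2 in Hc2.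
  assert (Hcos : cos c2 <= cos c1) by (apply cos_decr_1; lra).
  set (s := sin x) in *. set (k1 := cos c1) in *. set (k2 := cos c2) in *.
  assert (H1 : s = k1 * x) by lra.
  assert (H2 : 1 - s = k2 * (PI / 2 - x)) by lra.
  assert (H3 : 1 <= k1 * (PI / 2)).
  { apply Rle_trans with (k1 * x + k2 * (PI / 2 - x)); [lra|]. nra. }
  rewrite H1. apply Rmult_le_compat_r; [lra|].
  apply Rmult_le_reg_r with (PI / 2); [lra|].
  replace (2 / PI * (PI / 2)) with 1 by (field; lra). exact H3.
Qed.

Lemma Cmod_eul_sub_1_ge (x : R) : Rabs x <= 1 / 2 -> 4 * Rabs x <= Cmod (eul x - 1).
Proof.
  intros Hx. pose proof PI_RGT_0 as Hpi. rewrite Cmod_eul_sub_1.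
  assert (H : 2 / PI * (PI * Rabs x) <= sin (PI * Rabs x)).
  { apply sin_ge_chord. pose proof (Rabs_pos x). split; [nra|]. nra. }
  replace (2 / PI * (PI * Rabs x)) with (2 * Rabs x) in H by (field; lra).
  assert (Hs : sin (PI * Rabs x) <= Rabs (sin (PI * x))).
  { unfold Rabs at 1. destruct (Rcase_abs x).
    - replace (PI * - x) with (- (PI * x)) by ring. rewrite sin_neg.
      rewrite <- Rabs_Ropp. apply Rle_abs.
    - apply Rle_abs. }
  lra.
Qed.

Lemma Cmod_eul_sub_1_le (x : R) : Cmod (eul x - 1) <= 2 * PI * Rabs x.
Proof.
  eapply Rle_trans; [apply Cmod_Cexp_sub_1_le|]. simpl.
  rewrite Rmax_left, exp_0 by lra.
  replace ((0, 2 * PI * x) : C) with (Ci * RtoC (2 * PI * x))%C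
    by (C_components).
  rewrite Cmod_mult, Cmod_Ci, Cmod_R, !Rabs_mult, (Rabs_pos_eq 2), (Rabs_pos_eq PI);
    pose proof PI_RGT_0; lra.
Qed.

Lemma geometric_csum (z : C) (n : nat) : ((z - 1) * csum (fun i => z ^ i) n = z ^ n - 1)%C.
Proof.
  induction n as [|n IH]; simpl; [ring|].
  rewrite Cmult_plus_distr_l, IH. ring.
Qed.

Lemma eul_pow (x : R) (n : nat) : (eul x ^ n)%C = eul (INR n * x).
Proof.
  induction n as [|n IH]; [simpl; rewrite Rmult_0_l, eul_0; reflexivity|].
  rewrite S_INR, Rmult_plus_distr_r, Rmult_1_l, eul_plus, <- IH. simpl. ring.
Qed.

Definition ez (q : nat) (k : Z) : C := eul (IZR k / INR q).

Lemma ez_plus (q : nat) (k l : Z) : ez q (k + l) = (ez q k * ez q l)%C.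
Proof. unfold ez. rewrite <- eul_plus. f_equal. rewrite plus_IZR. unfold Rdiv; ring. Qed.

Lemma Cmod_ez (q : nat) (k : Z) : Cmod (ez q k) = 1.
Proof. apply Cmod_eul. Qed.

Lemma ez_opp (q : nat) (k : Z) : ez q (- k) = Cconj (ez q k).
Proof. unfold ez. rewrite <- eul_opp. f_equal. rewrite opp_IZR. unfold Rdiv; ring. Qed.

Lemma ez_0 (q : nat) : ez q 0 = 1%C.
Proof. unfold ez. unfold Rdiv. rewrite Rmult_0_l. apply eul_0. Qed.

Lemma ez_mult_q (q : nat) (k : Z) : (0 < q)%nat -> ez q (Z.of_nat q * k) = 1%C.
Proof.
  intros Hq. unfold ez. rewrite mult_IZR, <- INR_IZR_INZ.
  replace (INR q * IZR k / INR q) with (IZR k); [apply eul_IZR|].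
  field. apply not_0_INR; lia.
Qed.

Lemma ez_divide (q : nat) (k l : Z) : (0 < q)%nat -> (Z.of_nat q | k - l)%Z -> ez q k = ez q l.
Proof.
  intros Hq [c Hc]. replace k with (Z.of_nat q * c + l)%Z by lia.
  rewrite ez_plus, ez_mult_q by auto. ring.
Qed.

Lemma ez_eq_1 (q : nat) (k : Z) : (0 < q)%nat -> ez q k = 1%C -> (Z.of_nat q | k)%Z.
Proof.
  intros Hq H. pose proof PI_RGT_0 as Hpi.
  assert (Hq0 : 0 < INR q) by (apply lt_0_INR; lia).
  set (r := (k mod Z.of_nat q)%Z).
  assert (Hr : (0 <= r < Z.of_nat q)%Z) by (apply Z.mod_pos_bound; lia).
  assert (Hk : k = (Z.of_nat q * (k / Z.of_nat q) + r)%Z) by (apply Z.div_mod; lia).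
  rewrite Hk, ez_plus, ez_mult_q in H by auto.
  assert (H' : Cmod (ez q r - 1) = 0).
  { rewrite <- Cmod_0. f_equal. rewrite <- H. ring. }
  destruct (Z.eq_dec r 0) as [Hr0|Hr0].
  { exists (k / Z.of_nat q)%Z. lia. }
  exfalso. unfold ez in H'. rewrite Cmod_eul_sub_1 in H'.
  assert (Hpos : 0 < sin (PI * (IZR r / INR q))).
  { assert (H1 : 0 < IZR r) by (apply IZR_lt; lia).
    assert (H2 : IZR r < INR q) by (rewrite INR_IZR_INZ; apply IZR_lt; lia).
    assert (H3 : 0 < IZR r / INR q) by (apply Rdiv_lt_0_compat; lra).
    assert (H4 : IZR r / INR q < 1).
    { apply Rmult_lt_reg_r with (INR q); auto. field_simplify; lra. }
    apply sin_gt_0; nra. }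
  rewrite Rabs_pos_eq in H' by lra. lra.
Qed.

Lemma ez_mul_nat (q : nat) (k : Z) (i : nat) : ez q (k * Z.of_nat i) = (ez q k ^ i)%C.
Proof.
  unfold ez. rewrite eul_pow. f_equal. rewrite mult_IZR, <- INR_IZR_INZ. unfold Rdiv; ring.
Qed.

Definition residue_indicator (q : nat) (k : Z) : C :=
  if Zdivide_dec (Z.of_nat q) k then 1%C else 0%C.

(** Orthogonality of additive characters: unless q divides k, the ratio e(k/q) differs from 1 and
    the geometric sum closes up to 0. *)
Lemma csum_ez (q : nat) (k : Z) : (0 < q)%nat ->
  csum (fun b => ez q (k * Z.of_nat b)) q = (RtoC (INR q) * residue_indicator q k)%C.
Proof.
  intros Hq. unfold residue_indicator. destruct Zdivide_dec as [[c Hc]|Hn].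
  - rewrite (csum_ext _ (fun _ => 1%C)); [apply csum_const|].
    intros i _. replace (k * Z.of_nat i)%Z with (Z.of_nat q * (c * Z.of_nat i))%Z by (rewrite Hc; ring).
    now apply ez_mult_q.
  - rewrite (csum_ext _ (fun b => ez q k ^ b)%C) by (intros; apply ez_mul_nat).
    assert (Hne : (ez q k - 1)%C <> 0%C).
    { intros H. apply Hn. apply ez_eq_1; auto.
      transitivity (ez q k - 1 + 1)%C; [ring|rewrite H; ring]. }
    pose proof (geometric_csum (ez q k) q) as Hg.
    rewrite <- ez_mul_nat, Z.mul_comm, ez_mult_q in Hg by auto.
    rewrite Cmult_0_r.
    replace (csum (fun i => (ez q k ^ i)%C) q) with
      (/ (ez q k - 1) * ((ez q k - 1) * csum (fun i => (ez q k ^ i)%C) q))%C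
      by (field; auto).
    rewrite Hg. ring.
Qed.

Lemma csum_single (f : nat -> C) (n k : nat) : (k < n)%nat ->
  (forall i, (i < n)%nat -> i <> k -> f i = 0%C) -> csum f n = f k.
Proof.
  induction n as [|n IH]; intros Hk H; [lia|]. simpl.
  destruct (Nat.eq_dec k n) as [->|Hne].
  - rewrite (csum_ext f (fun _ => 0%C)), csum_0; [ring|]. intros i Hi. apply H; lia.
  - rewrite IH; [|lia|intros; apply H; lia]. rewrite (H n); [ring|lia|lia].
Qed.

Definition q_periodic (q : nat) (F : Z -> C) : Prop :=
  forall a b, (Z.of_nat q | a - b)%Z -> F a = F b.

Lemma csum_residue_indicator (q : nat) (F : Z -> C) (k : Z) : (0 < q)%nat -> q_periodic q F ->
  csum (fun a => residue_indicator q (Z.of_nat a - k) * F (Z.of_nat a))%C q = F k.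
Proof.
  intros Hq HF.
  assert (Hr : (0 <= k mod Z.of_nat q < Z.of_nat q)%Z) by (apply Z.mod_pos_bound; lia).
  assert (Hk : k = (Z.of_nat q * (k / Z.of_nat q) + k mod Z.of_nat q)%Z) by (apply Z.div_mod; lia).
  set (r := (k mod Z.of_nat q)%Z) in *.
  rewrite (csum_single _ q (Z.to_nat r)); [|lia|].
  - rewrite Z2Nat.id by lia. unfold residue_indicator. destruct Zdivide_dec as [Hd|Hd].
    + rewrite Cmult_1_l. now apply HF.
    + exfalso. apply Hd. exists (- (k / Z.of_nat q))%Z. lia.
  - intros i Hi Hne. unfold residue_indicator. destruct Zdivide_dec as [[c Hc]|Hd]; [|ring].
    exfalso. apply Hne.
    assert (Z.of_nat i = r); [|lia].
    assert (Heq : (Z.of_nat i - r = (c + k / Z.of_nat q) * Z.of_nat q)%Z) by lia.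
    assert ((c + k / Z.of_nat q = 0)%Z) by nia. nia.
Qed.

(** Multiplication by a unit permutes the residues. To avoid handling permutations, each value is
    spread over all residues by [residue_indicator]; after exchanging the sums, the congruence c = u
    a is solved as a = v c. *)
Lemma csum_residues_unit (q : nat) (F : Z -> C) (u v : Z) : (0 < q)%nat -> q_periodic q F ->
  (Z.of_nat q | u * v - 1)%Z ->
  csum (fun a => F (u * Z.of_nat a)%Z) q = csum (fun a => F (Z.of_nat a)) q.
Proof.
  intros Hq HF Huv.
  rewrite (csum_ext _ (fun a => csum (fun c => residue_indicator q (Z.of_nat c - u * Z.of_nat a)
    * F (Z.of_nat c))%C q)) by (intros; now rewrite csum_residue_indicator).
  rewrite csum_swap. apply csum_ext. intros c _.
  rewrite csum_mult_r.
  rewrite (csum_ext _ (fun a => residue_indicator q (Z.of_nat a - v * Z.of_nat c) * 1)%C).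
  - rewrite (csum_residue_indicator q (fun _ => 1%C)); [ring|auto|intros ? ? ?; reflexivity].
  - intros a _. rewrite Cmult_1_r. unfold residue_indicator.
    destruct Huv as [w Hw].
    assert (Hiff : (Z.of_nat q | Z.of_nat c - u * Z.of_nat a)%Z <->
                   (Z.of_nat q | Z.of_nat a - v * Z.of_nat c)%Z).
    { split; intros [k Hk].
      - exists (- v * k - w * Z.of_nat a)%Z.
        replace (Z.of_nat c) with (k * Z.of_nat q + u * Z.of_nat a)%Z by lia.
        transitivity (Z.of_nat a - (u * v) * Z.of_nat a - v * k * Z.of_nat q)%Z; [ring|].
        replace (u * v)%Z with (w * Z.of_nat q + 1)%Z by lia. ring.
      - exists (- u * k - w * Z.of_nat c)%Z.
        replace (Z.of_nat a) with (k * Z.of_nat q + v * Z.of_nat c)%Z by lia.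
        transitivity (Z.of_nat c - (u * v) * Z.of_nat c - u * k * Z.of_nat q)%Z; [ring|].
        replace (u * v)%Z with (w * Z.of_nat q + 1)%Z by lia. ring. }
    destruct Zdivide_dec, Zdivide_dec; tauto.
Qed.

(** * Gauss sums *)

Lemma dirichlet_periodic (q : nat) (chi : Z -> C) :
  dirichlet_character (Z.of_nat q) chi -> q_periodic q chi.
Proof.
  intros [Hper _] a b [k Hk]. replace a with (b + k * Z.of_nat q)%Z by lia.
  clear Hk a.
  assert (Hnat : forall n b, chi (b + Z.of_nat n * Z.of_nat q)%Z = chi b).
  { induction n as [|n IH]; intros c; [f_equal; lia|].
    replace (c + Z.of_nat (S n) * Z.of_nat q)%Z with
      ((c + Z.of_nat n * Z.of_nat q) + Z.of_nat q)%Z by lia.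
    now rewrite Hper. }
  destruct (Z_le_gt_dec 0 k) as [H|H].
  - rewrite <- (Z2Nat.id k H). apply Hnat.
  - rewrite <- (Hnat (Z.to_nat (- k)) (b + k * Z.of_nat q)%Z). f_equal. lia.
Qed.

Lemma dirichlet_1 (q : Z) (chi : Z -> C) : dirichlet_character q chi -> chi 1%Z = 1%C.
Proof.
  intros [_ [Hm Hu]].
  assert (H1 : chi 1%Z <> 0%C) by (apply Hu; apply rel_prime_sym, rel_prime_1 || apply rel_prime_1).
  specialize (Hm 1%Z 1%Z). rewrite Z.mul_1_r in Hm.
  replace (chi 1%Z) with (chi 1%Z * chi 1%Z * / chi 1%Z)%C at 1 by (field; auto).
  rewrite <- Hm. field; auto.
Qed.

Lemma rel_prime_inverse (a q : Z) : rel_prime a q -> exists v, (q | a * v - 1)%Z.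
Proof.
  intros H. destruct (rel_prime_bezout _ _ H) as [u v Huv].
  exists u, (- v)%Z. lia.
Qed.

Lemma inverse_rel_prime (a v q : Z) : (q | a * v - 1)%Z -> rel_prime a q.
Proof.
  intros [k Hk]. apply bezout_rel_prime. apply Bezout_intro with v (- k)%Z. lia.
Qed.

Lemma dirichlet_inverse (q : nat) (chi : Z -> C) (a v : Z) :
  dirichlet_character (Z.of_nat q) chi -> (Z.of_nat q | a * v - 1)%Z -> (chi a * chi v = 1)%C.
Proof.
  intros H Hav. destruct H as [Hp [Hm Hu]] eqn:He. rewrite <- Hm.
  rewrite (dirichlet_periodic q chi H (a * v)%Z 1%Z Hav).
  apply (dirichlet_1 _ chi H).
Qed.

Lemma q_periodic_bounded (q : nat) (chi : Z -> C) : (0 < q)%nat -> q_periodic q chi ->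
  exists M, forall a, Cmod (chi a) <= M.
Proof.
  intros Hq Hp. exists (rsum (fun i => Cmod (chi (Z.of_nat i))) q). intros a.
  set (r := (a mod Z.of_nat q)%Z).
  assert (Hr : (0 <= r < Z.of_nat q)%Z) by (apply Z.mod_pos_bound; lia).
  rewrite (Hp a (Z.of_nat (Z.to_nat r))).
  2:{ rewrite Z2Nat.id by lia. exists (a / Z.of_nat q)%Z.
      pose proof (Z.div_mod a (Z.of_nat q) ltac:(lia)). unfold r. lia. }
  assert (Hlt : (Z.to_nat r < q)%nat) by lia.
  revert Hlt. generalize (Z.to_nat r). intros k Hk. clear - Hk.
  induction q as [|n IH]; [lia|]. simpl.
  pose proof (Cmod_ge_0 (chi (Z.of_nat n))).
  pose proof (rsum_nonneg (fun i => Cmod (chi (Z.of_nat i))) n (fun i _ => Cmod_ge_0 _)).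
  destruct (Nat.eq_dec k n) as [->|Hne]; [lra|]. specialize (IH ltac:(lia)). lra.
Qed.

(** A periodic function is bounded, whereas a value of modulus above 1 would make chi(a^n) =
    chi(a)^n unbounded. *)
Lemma dirichlet_Cmod_le_1 (q : nat) (chi : Z -> C) (a : Z) : (0 < q)%nat ->
  dirichlet_character (Z.of_nat q) chi -> Cmod (chi a) <= 1.
Proof.
  intros Hq H. destruct (q_periodic_bounded q chi Hq (dirichlet_periodic q chi H)) as [M HM].
  assert (Hpow : forall n, chi (a ^ Z.of_nat n)%Z = (chi a ^ n)%C).
  { induction n as [|n IH]; [apply (dirichlet_1 _ chi H)|].
    rewrite Nat2Z.inj_succ, Z.pow_succ_r by lia.
    destruct H as [_ [Hm _]]. rewrite Hm, IH. reflexivity. }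
  apply Rnot_lt_le. intros Hlt.
  destruct (Pow_x_infinity (Cmod (chi a)) ltac:(rewrite Rabs_pos_eq; [lra|apply Cmod_ge_0]) (M + 1))
    as [n Hn].
  specialize (Hn n (le_n n)). rewrite <- Cmod_pow, Rabs_pos_eq in Hn by apply Cmod_ge_0.
  rewrite <- Hpow in Hn. specialize (HM (a ^ Z.of_nat n)%Z). lra.
Qed.

(** The values at a and at its inverse have product 1 and both have modulus at most 1. *)
Lemma dirichlet_Cmod_1 (q : nat) (chi : Z -> C) (a : Z) : (0 < q)%nat ->
  dirichlet_character (Z.of_nat q) chi -> rel_prime a (Z.of_nat q) -> Cmod (chi a) = 1.
Proof.
  intros Hq H Ha. destruct (rel_prime_inverse _ _ Ha) as [v Hv].
  pose proof (dirichlet_inverse q chi a v H Hv) as Hav.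
  apply (f_equal Cmod) in Hav. rewrite Cmod_mult, Cmod_1 in Hav.
  pose proof (dirichlet_Cmod_le_1 q chi a Hq H). pose proof (dirichlet_Cmod_le_1 q chi v Hq H).
  pose proof (Cmod_ge_0 (chi a)). pose proof (Cmod_ge_0 (chi v)). nra.
Qed.

Definition gauss_sum (q : nat) (chi : Z -> C) (b : Z) : C :=
  csum (fun a => chi (Z.of_nat a) * ez q (b * Z.of_nat a))%C q.

Lemma gauss_sum_periodic (q : nat) (chi : Z -> C) : (0 < q)%nat -> q_periodic q (gauss_sum q chi).
Proof.
  intros Hq a b [k Hk]. apply csum_ext. intros i _. f_equal. apply ez_divide; auto.
  exists (k * Z.of_nat i)%Z. replace a with (b + k * Z.of_nat q)%Z by lia. ring.
Qed.

Lemma gauss_sum_inversion (q : nat) (chi : Z -> C) (n : Z) : (0 < q)%nat -> q_periodic q chi ->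
  (RtoC (INR q) * chi n)%C =
  csum (fun b => gauss_sum q chi (Z.of_nat b) * ez q (- (Z.of_nat b * n)))%C q.
Proof.
  intros Hq Hp.
  rewrite <- (csum_residue_indicator q chi n Hq Hp), <- csum_mult_l.
  rewrite (csum_ext (fun b => gauss_sum q chi (Z.of_nat b) * ez q (- (Z.of_nat b * n)))%C
    (fun b => csum (fun a => chi (Z.of_nat a) * ez q ((Z.of_nat a - n) * Z.of_nat b))%C q)).
  - rewrite csum_swap. apply csum_ext. intros a _. rewrite csum_mult_l, csum_ez by auto. ring.
  - intros b _. unfold gauss_sum. rewrite <- csum_mult_r. apply csum_ext. intros a _.
    rewrite <- Cmult_assoc, <- ez_plus. do 2 f_equal. ring.
Qed.

Lemma gauss_sum_Parseval (q : nat) (chi : Z -> C) : (0 < q)%nat -> q_periodic q chi ->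
  rsum (fun b => Cmod (gauss_sum q chi (Z.of_nat b)) ^ 2) q =
  INR q * rsum (fun a => Cmod (chi (Z.of_nat a)) ^ 2) q.
Proof.
  intros Hq Hp. apply RtoC_inj. rewrite RtoC_mult, <- !csum_RtoC.
  rewrite (csum_ext (fun i => RtoC (Cmod (gauss_sum q chi (Z.of_nat i)) ^ 2))
    (fun b => csum (fun a => chi (Z.of_nat a) *
       (ez q (Z.of_nat b * Z.of_nat a) * Cconj (gauss_sum q chi (Z.of_nat b))))%C q)).
  - rewrite csum_swap, <- csum_mult_l. apply csum_ext. intros a _.
    rewrite csum_mult_l, Cmod2_conj.
    rewrite (csum_ext _ (fun b => Cconj (gauss_sum q chi (Z.of_nat b)
      * ez q (- (Z.of_nat b * Z.of_nat a))))%C).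
    + rewrite <- csum_conj, <- gauss_sum_inversion, Cmult_conj by auto.
      replace (Cconj (INR q)) with (RtoC (INR q)) by (C_components). ring.
    + intros b _. rewrite Cmult_conj, ez_opp, Cconj_conj. ring.
  - intros b _. rewrite Cmod2_conj. unfold gauss_sum at 1. rewrite <- csum_mult_r.
    apply csum_ext. intros a _. ring.
Qed.

(** Substitution a -> u a in the Gauss sum. It gives |G(b)| = |G(1)| at units b, and it detects
    induced characters at non-units. *)
Lemma gauss_sum_unit (q : nat) (chi : Z -> C) (u b : Z) : (0 < q)%nat ->
  dirichlet_character (Z.of_nat q) chi -> rel_prime u (Z.of_nat q) ->
  (chi u * gauss_sum q chi (u * b) = gauss_sum q chi b)%C.
Proof.
  intros Hq H Hu. destruct (rel_prime_inverse _ _ Hu) as [v Hv].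
  unfold gauss_sum. rewrite <- csum_mult_l.
  rewrite <- (csum_residues_unit q (fun n => chi n * ez q (b * n))%C u v); auto.
  - apply csum_ext. intros a _.
    destruct H as [_ [Hm _]]. rewrite Hm.
    replace (b * (u * Z.of_nat a))%Z with (u * b * Z.of_nat a)%Z by ring. ring.
  - intros x y Hxy. f_equal; [now apply (dirichlet_periodic q chi H)|].
    apply ez_divide; auto. destruct Hxy as [k Hk]. exists (b * k)%Z.
    replace x with (y + k * Z.of_nat q)%Z by lia. ring.
Qed.

(** k is what is left of q after dividing out the common factor with a until none remains; n only
    bounds the recursion. *)
Lemma coprime_part (a : Z) (n : nat) (q : Z) : (0 < q <= Z.of_nat n)%Z ->
  exists k, rel_prime k a /\ forall p, prime p -> (p | q)%Z -> (p | k)%Z \/ (p | a)%Z.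
Proof.
  revert q. induction n as [|n IH]; intros q Hq; [lia|].
  pose proof (Zgcd_is_gcd q a) as Hg. set (g := Z.gcd q a) in *.
  assert (Hg0 : (0 < g)%Z).
  { pose proof (Z.gcd_nonneg q a). destruct (Z.eq_dec g 0) as [Hz|Hz]; [|unfold g in *; lia].
    apply Z.gcd_eq_0_l in Hz. lia. }
  destruct (Z.eq_dec g 1) as [H1|H1].
  { exists q. split; [rewrite H1 in Hg; exact Hg|]. intros p _ Hp; now left. }
  destruct Hg as [[m Hm] Hga _].
  destruct (IH m) as [k [Hk Hkp]]; [nia|].
  exists k. split; auto. intros p Hp Hpq.
  rewrite Hm in Hpq. destruct (prime_mult p Hp m g Hpq) as [H|H]; [now apply Hkp|].
  right. now apply Z.divide_trans with g.
Qed.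

Lemma rel_prime_no_prime (a b : Z) : (0 < b)%Z ->
  (forall p, prime p -> (p | a)%Z -> (p | b)%Z -> False) -> rel_prime a b.
Proof.
  intros Hb H. pose proof (Zgcd_is_gcd a b) as Hg. set (g := Z.gcd a b) in *.
  assert (Hg0 : (0 < g)%Z).
  { pose proof (Z.gcd_nonneg a b). destruct (Z.eq_dec g 0) as [Hz|Hz]; [|unfold g in *; lia].
    apply Z.gcd_eq_0_r in Hz. lia. }
  destruct (Z.eq_dec g 1) as [H1|H1]; [unfold rel_prime; rewrite <- H1; exact Hg|].
  exfalso. destruct Hg as [Hga Hgb _].
  assert (Hp : exists p, prime p /\ (p | g)%Z).
  { clear - Hg0 H1. assert (Hg : (1 < g)%Z) by lia. clear Hg0 H1. revert Hg.
    assert (Hind : forall n g, (1 < g <= Z.of_nat n)%Z -> exists p, prime p /\ (p | g)%Z).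
    { induction n as [|n IH]; intros x Hx; [lia|].
      destruct (prime_dec x) as [Hpx|Hpx]; [exists x; split; auto; apply Z.divide_refl|].
      destruct (not_prime_divide x ltac:(lia) Hpx) as [y [Hy Hyx]].
      destruct (IH y ltac:(lia)) as [p [Hp Hpy]]. exists p; split; auto.
      now apply Z.divide_trans with y. }
    intros Hg. apply (Hind (Z.to_nat g)). lia. }
  destruct Hp as [p [Hp Hpg]].
  apply (H p Hp); eapply Z.divide_trans; eauto.
Qed.

(** Surjectivity of the map from units mod q to units mod d, through b = a + k d with the k of
    [coprime_part]: a prime of q dividing a divides neither k nor d, and a prime of q not dividing a
    divides k. *)
Lemma unit_lift (a d q : Z) : (0 < q)%Z -> (d | q)%Z -> rel_prime a d ->
  exists b, (d | b - a)%Z /\ rel_prime b q.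
Proof.
  intros Hq Hdq Had. destruct (coprime_part a (Z.to_nat q) q ltac:(lia)) as [k [Hk Hkp]].
  exists (a + k * d)%Z. split; [exists k; ring|].
  apply rel_prime_no_prime; auto. intros p Hp Hpb Hpq.
  assert (Hp1 : ~ (p | 1)%Z) by (intros H1; apply Z.divide_1_r_nonneg in H1; destruct Hp; lia).
  destruct (classic (p | a)%Z) as [Hpa|Hpa].
  - assert (Hkd : (p | k * d)%Z).
    { replace (k * d)%Z with (a + k * d - a)%Z by ring. now apply Z.divide_sub_r. }
    destruct (prime_mult p Hp k d Hkd) as [H|H].
    + apply Hp1. destruct Hk as [_ _ Hk]. now apply Hk.
    + apply Hp1. destruct Had as [_ _ Had]. now apply Had.
  - destruct (Hkp p Hp Hpq) as [H|H]; [|contradiction].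
    apply Hpa. replace a with (a + k * d - k * d)%Z by ring.
    apply Z.divide_sub_r; auto. now apply Z.divide_mul_l.
Qed.

Lemma rel_prime_divide_r (a d q : Z) : (d | q)%Z -> rel_prime a q -> rel_prime a d.
Proof.
  intros Hd [_ _ H]. constructor; [apply Z.divide_1_l|apply Z.divide_1_l|].
  intros x Hxa Hxd. apply H; auto. now apply Z.divide_trans with d.
Qed.

Lemma rel_prime_congr (a b d : Z) : (d | b - a)%Z -> rel_prime b d -> rel_prime a d.
Proof.
  intros Hd [_ _ H]. constructor; [apply Z.divide_1_l|apply Z.divide_1_l|].
  intros x Hxa Hxd. apply H; auto. replace b with (b - a + a)%Z by ring.
  apply Z.divide_add_r; auto. now apply Z.divide_trans with d.
Qed.

Lemma rel_prime_mult_iff (a b d : Z) : rel_prime (a * b) d <-> rel_prime a d /\ rel_prime b d.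
Proof.
  split.
  - intros [_ _ H]. split; (constructor; [apply Z.divide_1_l|apply Z.divide_1_l|]);
      intros x Hx Hxd; apply H; auto; [now apply Z.divide_mul_l|now apply Z.divide_mul_r].
  - intros [Ha Hb]. apply rel_prime_sym, rel_prime_mult; now apply rel_prime_sym.
Qed.

(** Triviality on units congruent to 1 mod d means that chi at a unit depends only on its class mod
    d. So psi(a) can be read off at any unit lift of a, which [epsilon] selects. *)
Lemma induced_character (q : nat) (chi : Z -> C) (d : Z) : (0 < q)%nat -> (0 < d)%Z ->
  (d | Z.of_nat q)%Z -> dirichlet_character (Z.of_nat q) chi ->
  (forall u, rel_prime u (Z.of_nat q) -> (d | u - 1)%Z -> chi u = 1%C) ->
  exists psi, dirichlet_character d psi /\
    forall a, rel_prime a (Z.of_nat q) -> chi a = psi a.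
Proof.
  intros Hq Hd Hdq H Htriv.
  assert (Hwd : forall a b, rel_prime a (Z.of_nat q) -> rel_prime b (Z.of_nat q) ->
    (d | a - b)%Z -> chi a = chi b).
  { intros a b Ha Hb Hab. destruct (rel_prime_inverse _ _ Hb) as [v Hv].
    assert (Hvq : rel_prime v (Z.of_nat q))
      by (apply (inverse_rel_prime v b); now rewrite Z.mul_comm).
    assert (H1 : chi (a * v)%Z = 1%C).
    { apply Htriv; [now apply rel_prime_mult_iff|].
      replace (a * v - 1)%Z with ((a - b) * v + (b * v - 1))%Z by ring.
      apply Z.divide_add_r; [now apply Z.divide_mul_l|now apply Z.divide_trans with (Z.of_nat q)]. }
    pose proof (dirichlet_inverse q chi b v H Hv) as H2.
    destruct H as [_ [Hm _]]. rewrite Hm in H1.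
    transitivity (chi a * (chi b * chi v))%C; [rewrite H2; ring|].
    transitivity (chi b * (chi a * chi v))%C; [ring|rewrite H1; ring]. }
  set (lift := fun a => epsilon (inhabits 0%Z)
     (fun b => (d | b - a)%Z /\ rel_prime b (Z.of_nat q))).
  assert (Hlift : forall a, rel_prime a d ->
     (d | lift a - a)%Z /\ rel_prime (lift a) (Z.of_nat q)).
  { intros a Ha. apply (epsilon_spec (inhabits 0%Z)
      (fun b => (d | b - a)%Z /\ rel_prime b (Z.of_nat q))).
    apply unit_lift; auto; lia. }
  exists (fun a => if rel_prime_dec a d then chi (lift a) else 0%C).
  assert (Hsub : forall x y z, (d | x - y)%Z -> (d | z - y)%Z -> (d | x - z)%Z).
  { intros x y z H1 H2. replace (x - z)%Z with ((x - y) - (z - y))%Z by ring.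
    now apply Z.divide_sub_r. }
  split; [split; [|split; [|intros a; split]]|].
  - intros a. destruct (rel_prime_dec (a + d) d) as [H1|H1], (rel_prime_dec a d) as [H2|H2]; auto.
    + destruct (Hlift _ H1) as [La Lb], (Hlift _ H2) as [La' Lb'].
      apply Hwd; auto. apply Hsub with a; auto.
      replace (lift (a + d)%Z - a)%Z with ((lift (a + d)%Z - (a + d)) + d)%Z by ring.
      apply Z.divide_add_r; auto. apply Z.divide_refl.
    + exfalso. apply H2. apply rel_prime_congr with (a + d)%Z; auto. exists 1%Z; ring.
    + exfalso. apply H1. apply rel_prime_congr with a; auto. exists (-1)%Z; ring.
  - intros a b.
    destruct (rel_prime_dec (a * b) d) as [H1|H1], (rel_prime_dec a d) as [H2|H2],
      (rel_prime_dec b d) as [H3|H3]; try ring;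
      try (exfalso; rewrite rel_prime_mult_iff in H1; tauto).
    destruct (Hlift _ H1) as [La Lb], (Hlift _ H2) as [La' Lb'], (Hlift _ H3) as [La'' Lb''].
    pose proof H as [_ [Hm _]]. rewrite <- Hm.
    apply Hwd; auto; [now apply rel_prime_mult_iff|].
    apply Hsub with (a * b)%Z; auto.
    replace (lift a * lift b - a * b)%Z with ((lift a - a) * lift b + a * (lift b - b))%Z by ring.
    apply Z.divide_add_r; [now apply Z.divide_mul_l|now apply Z.divide_mul_r].
  - destruct (rel_prime_dec a d) as [H1|H1]; [auto|]. intros Hc. now contradiction Hc.
  - destruct (rel_prime_dec a d) as [H1|H1]; [|contradiction]. intros _.
    apply H. now apply Hlift.
  - intros a Ha. destruct (rel_prime_dec a d) as [H1|H1].
    + destruct (Hlift _ H1) as [La Lb]. apply Hwd; auto.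
      replace (a - lift a)%Z with (- (lift a - a))%Z by ring. now apply Z.divide_opp_r.
    + exfalso. apply H1. now apply rel_prime_divide_r with (Z.of_nat q).
Qed.

(** Primitivity enters here. Put d = q / gcd(b, q). A unit u congruent to 1 mod d satisfies u b = b
    mod q, so G(b) <> 0 would force chi(u) = 1 for all such u, and chi would be induced from the
    proper divisor d. *)
Lemma gauss_sum_primitive_nonunit (q : nat) (chi : Z -> C) (b : Z) : (0 < q)%nat ->
  primitive_character (Z.of_nat q) chi -> ~ rel_prime b (Z.of_nat q) -> gauss_sum q chi b = 0%C.
Proof.
  intros Hq [H Hprim] Hb. apply NNPP. intros HG.
  pose proof (Zgcd_is_gcd b (Z.of_nat q)) as Hg. set (g := Z.gcd b (Z.of_nat q)) in *.
  assert (Hg0 : (0 < g)%Z).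
  { pose proof (Z.gcd_nonneg b (Z.of_nat q)).
    destruct (Z.eq_dec g 0) as [Hz|Hz]; [|unfold g in *; lia].
    apply Z.gcd_eq_0_r in Hz. lia. }
  assert (Hg1 : g <> 1%Z) by (intros H1; apply Hb; unfold rel_prime; rewrite <- H1; exact Hg).
  destruct Hg as [[b' Hb'] [d Hd] _].
  assert (Hd0 : (0 < d)%Z) by nia.
  destruct (induced_character q chi d Hq Hd0) as [psi [Hpsi Heq]]; auto.
  - exists g. lia.
  - intros u Hu [k Hk].
    pose proof (gauss_sum_unit q chi u b Hq H Hu) as H1.
    rewrite (gauss_sum_periodic q chi Hq (u * b)%Z b) in H1.
    + transitivity (chi u * gauss_sum q chi b * / gauss_sum q chi b)%C; [field; auto|].
      rewrite H1. field; auto.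
    + exists (k * b')%Z. rewrite Hd. replace u with (k * d + 1)%Z by lia. rewrite Hb' at 1 2. ring.
  - apply (Hprim d psi); auto; [nia|exists g; lia].
Qed.

(** |G| is constant on units and 0 elsewhere, as |chi| is; hence Parseval reads |G(1)|^2 S = q S,
    where S, the sum of |chi|^2, is positive. *)
Lemma Cmod_gauss_sum_primitive_le (q : nat) (chi : Z -> C) (b : Z) : (0 < q)%nat ->
  primitive_character (Z.of_nat q) chi -> Cmod (gauss_sum q chi b) <= sqrt (INR q).
Proof.
  intros Hq Hprim. pose proof (proj1 Hprim) as H.
  destruct (rel_prime_dec b (Z.of_nat q)) as [Hb|Hb].
  2:{ rewrite gauss_sum_primitive_nonunit, Cmod_0 by auto. apply sqrt_pos. }
  assert (Hunit : forall u, rel_prime u (Z.of_nat q) ->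
    Cmod (gauss_sum q chi u) = Cmod (gauss_sum q chi 1)).
  { intros u Hu. rewrite <- (gauss_sum_unit q chi u 1) by auto.
    rewrite Z.mul_1_r, Cmod_mult, (dirichlet_Cmod_1 q chi u) by auto. ring. }
  rewrite (Hunit b Hb).
  pose proof (gauss_sum_Parseval q chi Hq (dirichlet_periodic q chi H)) as HP.
  set (S := rsum (fun a => Cmod (chi (Z.of_nat a)) ^ 2) q) in HP.
  assert (HS : rsum (fun b => Cmod (gauss_sum q chi (Z.of_nat b)) ^ 2) q =
    Cmod (gauss_sum q chi 1) ^ 2 * S).
  { unfold S. rewrite <- rsum_mult_l. apply rsum_ext. intros i _.
    destruct (rel_prime_dec (Z.of_nat i) (Z.of_nat q)) as [Hi|Hi].
    - rewrite Hunit, (dirichlet_Cmod_1 q chi) by auto. ring.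
    - rewrite gauss_sum_primitive_nonunit by auto.
      replace (chi (Z.of_nat i)) with (RtoC 0).
      + rewrite Cmod_0. ring.
      + destruct H as [_ [_ Hu]]. symmetry. apply NNPP. rewrite Hu. exact Hi. }
  assert (HSpos : 0 < S).
  { destruct (rsum_nonneg (fun a => Cmod (chi (Z.of_nat a)) ^ 2) q) as [Hp|Hz]; auto.
    { intros; apply pow2_ge_0. }
    exfalso.
    assert (Hall : forall n, (n <= q)%nat -> rsum (fun a => Cmod (chi (Z.of_nat a)) ^ 2) n = 0 ->
      forall i, (i < n)%nat -> chi (Z.of_nat i) = 0%C).
    { induction n as [|n IH]; intros Hn Hs i Hi; [lia|]. simpl in Hs.
      pose proof (rsum_nonneg (fun a => Cmod (chi (Z.of_nat a)) ^ 2) n (fun i _ => pow2_ge_0 _)) as H1.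
      pose proof (pow2_ge_0 (Cmod (chi (Z.of_nat n)))) as H2. simpl in H1, H2.
      destruct (Nat.eq_dec i n) as [->|Hne].
      - apply Cmod_eq_0. apply Rsqr_0_uniq. unfold Rsqr. lra.
      - apply IH; try lia. simpl. lra. }
    pose proof (Hall q (le_n q) (eq_sym Hz)) as Hz0.
    assert (Hc : chi 1%Z = 0%C).
    { rewrite (dirichlet_periodic q chi H 1%Z (Z.of_nat (Z.to_nat (1 mod Z.of_nat q)))).
      - apply Hz0. pose proof (Z.mod_pos_bound 1 (Z.of_nat q)). lia.
      - pose proof (Z.mod_pos_bound 1 (Z.of_nat q)). rewrite Z2Nat.id by lia.
        exists (1 / Z.of_nat q)%Z. pose proof (Z.div_mod 1 (Z.of_nat q)). lia. }
    rewrite (dirichlet_1 _ chi H) in Hc. apply (f_equal Cmod) in Hc.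
    rewrite Cmod_1, Cmod_0 in Hc. lra. }
  rewrite HS in HP. apply Rmult_eq_reg_r in HP; [|lra].
  rewrite <- HP, <- Rsqr_pow2. rewrite sqrt_Rsqr; [lra|apply Cmod_ge_0].
Qed.

(** * The Kusmin-Landau estimate *)

(** x^{-s}, with the sign in the exponent so that terms are products instead of quotients. *)
Definition npow (x : R) (s : C) : C := Cexp (- (s * RtoC (ln x))).

Lemma Cmod_npow (x : R) (s : C) : Cmod (npow x s) = Rpower x (- Re s).
Proof.
  unfold npow, Rpower. rewrite Cmod_Cexp. f_equal. destruct s; simpl. ring.
Qed.

Lemma ln_le_sub_1 (x : R) : 0 < x -> ln x <= x - 1.
Proof.
  intros Hx. pose proof (exp_ineq1_le (ln x)) as H. rewrite exp_ln in H by auto. lra.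
Qed.

Lemma ln_ge_1_sub_inv (x : R) : 0 < x -> 1 - / x <= ln x.
Proof.
  intros Hx. pose proof (ln_le_sub_1 (/ x) ltac:(now apply Rinv_0_lt_compat)) as H.
  rewrite ln_Rinv in H by auto. lra.
Qed.

Lemma Rpower_pos (x a : R) : 0 < Rpower x a.
Proof. apply exp_pos. Qed.

Lemma Rpower_neg_antitone (x y a : R) : 0 <= a -> 0 < x <= y -> Rpower y (- a) <= Rpower x (- a).
Proof.
  intros Ha [Hx Hy]. unfold Rpower. apply exp_le_mono.
  pose proof (ln_le x y Hx Hy). nra.
Qed.

Definition log_step (x : R) : R := ln (1 + / x).

Lemma log_step_eq (x : R) : 0 < x -> ln (x + 1) = ln x + log_step x.
Proof.
  intros Hx. unfold log_step. assert (0 < / x) by now apply Rinv_0_lt_compat.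
  rewrite <- ln_mult by lra. f_equal. field. lra.
Qed.

Lemma log_step_nonneg (x : R) : 0 < x -> 0 <= log_step x.
Proof.
  intros Hx. unfold log_step. assert (0 < / x) by now apply Rinv_0_lt_compat.
  rewrite <- ln_1. apply ln_le; lra.
Qed.

Lemma log_step_le (x : R) : 0 < x -> log_step x <= / x.
Proof.
  intros Hx. assert (0 < / x) by now apply Rinv_0_lt_compat.
  unfold log_step. pose proof (ln_le_sub_1 (1 + / x)). lra.
Qed.

Lemma log_step_antitone (x y : R) : 0 < x -> x <= y -> log_step y <= log_step x.
Proof.
  intros Hx Hy. unfold log_step.
  assert (0 < / y) by (apply Rinv_0_lt_compat; lra).
  apply ln_le; [lra|]. apply Rplus_le_compat_l. now apply Rinv_le_contravar.
Qed.

Lemma log_step_variation (x y : R) : 0 < x -> x <= y -> log_step x - log_step y <= (y - x) / (x * x).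
Proof.
  intros Hx Hy. unfold log_step.
  assert (0 < / y) by (apply Rinv_0_lt_compat; lra).
  assert (0 < / x) by (apply Rinv_0_lt_compat; lra).
  assert (Hq : 0 < (1 + / x) / (1 + / y)) by (apply Rdiv_lt_0_compat; lra).
  unfold Rminus. rewrite <- ln_Rinv, <- ln_mult by (try apply Rinv_0_lt_compat; lra).
  eapply Rle_trans; [apply ln_le_sub_1; exact Hq|].
  replace ((1 + / x) * / (1 + / y) - 1) with ((y - x) / (x * (y + 1))) by (field; lra).
  unfold Rdiv. apply Rmult_le_compat_l; [lra|].
  apply Rinv_le_contravar; [nra|]. apply Rmult_le_compat_l; lra.
Qed.

(** Write exp(-s a) as exp(-s b) exp(-s (a - b)); Re s >= 0 keeps both factors in the unit disc. *)
Lemma Cmod_Cexp_neg_sub_le (s : C) (a b : R) : 0 <= Re s -> 0 <= b <= a ->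
  Cmod (Cexp (- (s * RtoC a)) - Cexp (- (s * RtoC b))) <= Cmod s * (a - b).
Proof.
  intros Hs Hab.
  replace (Cexp (- (s * RtoC a))) with (Cexp (- (s * RtoC b)) * Cexp (- (s * RtoC (a - b))))%C.
  2:{ rewrite <- Cexp_plus. f_equal. rewrite RtoC_minus. ring. }
  replace (Cexp (- (s * RtoC b)) * Cexp (- (s * RtoC (a - b))) - Cexp (- (s * RtoC b)))%C with
    (Cexp (- (s * RtoC b)) * (Cexp (- (s * RtoC (a - b))) - 1))%C by ring.
  rewrite Cmod_mult, Cmod_Cexp.
  assert (H1 : exp (Re (- (s * RtoC b))) <= 1).
  { rewrite <- exp_0. apply exp_le_mono. destruct s; simpl in *. nra. }
  pose proof (Cmod_Cexp_sub_1_le (- (s * RtoC (a - b)))) as H2.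
  rewrite Cmod_opp, Cmod_mult, Cmod_R, Rabs_pos_eq in H2 by lra.
  rewrite Rmax_left in H2.
  2:{ destruct s; simpl in *. nra. }
  rewrite exp_0, Rmult_1_r in H2.
  pose proof (exp_pos (Re (- (s * RtoC b)))).
  pose proof (Cmod_ge_0 (Cexp (- (s * RtoC (a - b))) - 1)).
  nra.
Qed.

(* Kusmin-Landau: each term is [w n * (g n - g (n + 1))] with [w = 1 / (1 - r)],
   and Abel summation moves the differences onto the slowly varying [w]. *)
Lemma ratio_summation (g r : nat -> C) (L : nat) :
  (forall n, g (S n) = (r n * g n)%C) -> (forall n, (n <= L)%nat -> (1 - r n)%C <> 0%C) ->
  csum g (S L) = (g 0%nat / (1 - r 0%nat) - g (S L) / (1 - r L) +
    csum (fun i => (/ (1 - r (S i)) - / (1 - r i)) * g (S i)) L)%C.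
Proof.
  intros Hg Hr. induction L as [|L IH].
  - simpl. rewrite Hg. field. apply Hr; lia.
  - change (csum g (S (S L))) with (csum g (S L) + g (S L))%C.
    rewrite IH by (intros; apply Hr; lia).
    change (csum ?f (S L)) with (csum f L + f L)%C. cbv beta.
    rewrite (Hg (S L)). field. repeat split; apply Hr; lia.
Qed.

Definition twisted_power (z : C) (x : R) (s : C) (n : nat) : C := (z ^ n * npow (x + INR n) s)%C.

Definition twisted_ratio (z : C) (x : R) (s : C) (n : nat) : C :=
  (z * Cexp (- (s * RtoC (log_step (x + INR n)))))%C.

Lemma twisted_power_S (z : C) (x : R) (s : C) (n : nat) : 0 < x ->
  twisted_power z x s (S n) = (twisted_ratio z x s n * twisted_power z x s n)%C.
Proof.
  intros Hx. unfold twisted_power, twisted_ratio, npow.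
  pose proof (pos_INR n) as Hn.
  rewrite S_INR, <- Rplus_assoc, log_step_eq by lra.
  replace (- (s * RtoC (ln (x + INR n) + log_step (x + INR n))))%C with
    (- (s * RtoC (log_step (x + INR n))) + - (s * RtoC (ln (x + INR n))))%C
    by (rewrite RtoC_plus; ring).
  rewrite Cexp_plus. simpl. ring.
Qed.

Lemma Cmod_twisted_power (z : C) (x : R) (s : C) (n : nat) : Cmod z = 1 ->
  Cmod (twisted_power z x s n) = Rpower (x + INR n) (- Re s).
Proof.
  intros Hz. unfold twisted_power. rewrite Cmod_mult, Cmod_pow, Hz, pow1, Cmod_npow. ring.
Qed.

(** The first boundary term is kept exactly, since these terms later add up to L(0, chi) x^{-s}. The
    variation of 1 / (1 - r) costs D^-2 times that of r, which telescopes through [log_step]. *)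
Lemma Kusmin_Landau (z : C) (x : R) (s : C) (D : R) (L : nat) :
  Cmod z = 1 -> 0 < x -> 0 <= Re s -> 0 < D ->
  (forall n, (n <= L)%nat -> D <= Cmod (1 - twisted_ratio z x s n)) ->
  Cmod (csum (twisted_power z x s) (S L) - npow x s / (1 - twisted_ratio z x s 0)) <=
    Rpower (x + INR (S L)) (- Re s) / D +
    Rpower x (- Re s) * (Cmod s * (log_step x - log_step (x + INR L)) / (D * D)).
Proof.
  intros Hz Hx Hs HD Hr.
  set (g := twisted_power z x s). set (r := twisted_ratio z x s) in *.
  assert (Hne : forall n, (n <= L)%nat -> (1 - r n)%C <> 0%C).
  { intros n Hn H0. specialize (Hr n Hn). rewrite H0, Cmod_0 in Hr. lra. }
  rewrite (ratio_summation g r L) by (auto; intros; now apply twisted_power_S).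
  assert (Hg0 : g 0%nat = npow x s).
  { unfold g, twisted_power. simpl. rewrite Rplus_0_r. ring. }
  rewrite Hg0.
  replace (npow x s / (1 - r 0%nat) - g (S L) / (1 - r L) +
    csum (fun i => (/ (1 - r (S i)) - / (1 - r i)) * g (S i)) L - npow x s / (1 - r 0%nat))%C
  with (- (g (S L) / (1 - r L)) + csum (fun i => (/ (1 - r (S i)) - / (1 - r i)) * g (S i)) L)%C
    by ring.
  eapply Rle_trans; [apply Cmod_triangle|]. apply Rplus_le_compat.
  - rewrite Cmod_opp, Cmod_div by (apply Hne; lia).
    unfold g. rewrite Cmod_twisted_power by auto.
    unfold Rdiv. apply Rmult_le_compat_l; [left; apply Rpower_pos|].
    apply Rinv_le_contravar; auto.
  - apply Rle_trans with (rsum (fun i => Rpower x (- Re s) * (Cmod s / (D * D)) *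
      (log_step (x + INR i) - log_step (x + INR (S i)))) L).
    + apply Cmod_csum_le_rsum. intros i Hi.
      pose proof (pos_INR i) as Hi0. pose proof (S_INR i) as HSi.
      assert (Hlog : log_step (x + INR (S i)) <= log_step (x + INR i))
        by (apply log_step_antitone; lra).
      assert (Hdr : Cmod (r (S i) - r i) <=
        Cmod s * (log_step (x + INR i) - log_step (x + INR (S i)))).
      { unfold r, twisted_ratio. rewrite <- Cmod_opp.
        match goal with |- Cmod ?u <= _ => replace u with
          (z * (Cexp (- (s * RtoC (log_step (x + INR i)))) -
                Cexp (- (s * RtoC (log_step (x + INR (S i)))))))%C by ring end.
        rewrite Cmod_mult, Hz, Rmult_1_l. apply Cmod_Cexp_neg_sub_le; auto.
        split; [apply log_step_nonneg; lra|auto]. }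
      assert (Hi1 := Hr i ltac:(lia)). assert (Hi2 := Hr (S i) ltac:(lia)).
      assert (Hn1 := Hne i ltac:(lia)). assert (Hn2 := Hne (S i) ltac:(lia)).
      replace ((/ (1 - r (S i)) - / (1 - r i)) * g (S i))%C with
        ((r (S i) - r i) * / ((1 - r (S i)) * (1 - r i)) * g (S i))%C by (field; auto).
      assert (Hnp : ((1 - r (S i)) * (1 - r i))%C <> 0%C) by now apply Cmult_neq_0.
      rewrite !Cmod_mult, Cmod_inv, Cmod_mult by auto.
      unfold g. rewrite Cmod_twisted_power by auto.
      assert (Hpow : Rpower (x + INR (S i)) (- Re s) <= Rpower x (- Re s))
        by (apply Rpower_neg_antitone; lra).
      assert (Hinv : / (Cmod (1 - r (S i)) * Cmod (1 - r i)) <= / (D * D)).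
      { apply Rinv_le_contravar; [apply Rmult_lt_0_compat; auto|].
        apply Rmult_le_compat; lra. }
      replace (Rpower x (- Re s) * (Cmod s / (D * D)) *
        (log_step (x + INR i) - log_step (x + INR (S i)))) with
        (Cmod s * (log_step (x + INR i) - log_step (x + INR (S i))) * / (D * D) * Rpower x (- Re s))
        by (unfold Rdiv; ring).
      assert (Hi0' : 0 < / (Cmod (1 - r (S i)) * Cmod (1 - r i))).
      { apply Rinv_0_lt_compat, Rmult_lt_0_compat; lra. }
      pose proof (Cmod_ge_0 (r (S i) - r i)).
      apply Rmult_le_compat; auto; [|left; apply Rpower_pos|].
      * apply Rmult_le_pos; lra.
      * apply Rmult_le_compat; lra.
    + rewrite rsum_mult_l.
      assert (Htel : forall n, rsum (fun i => log_step (x + INR i) - log_step (x + INR (S i))) n =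
        log_step x - log_step (x + INR n)).
      { induction n as [|n IH]; [simpl; rewrite Rplus_0_r; ring|].
        change (rsum ?f (S n)) with (rsum f n + f n). rewrite IH. ring. }
      rewrite Htel. right. unfold Rdiv. ring.
Qed.

(** Version for short blocks: the two boundary terms cost 1 / D each, and over L steps [log_step]
    varies by at most L / x^2. *)
Lemma Kusmin_Landau_block (z : C) (x : R) (s : C) (D : R) (L : nat) :
  Cmod z = 1 -> 0 < x -> 0 <= Re s -> 0 < D ->
  (forall n, (n <= L)%nat -> D <= Cmod (1 - twisted_ratio z x s n)) ->
  Cmod (csum (twisted_power z x s) (S L)) <=
    Rpower x (- Re s) * (2 / D + Cmod s * INR L / (x * x) / (D * D)).
Proof.
  intros Hz Hx Hs HD Hr.
  pose proof (Kusmin_Landau z x s D L Hz Hx Hs HD Hr) as H.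
  set (w := (npow x s / (1 - twisted_ratio z x s 0))%C) in *.
  assert (Hw : Cmod w <= Rpower x (- Re s) / D).
  { specialize (Hr 0%nat ltac:(lia)). unfold w.
    assert ((1 - twisted_ratio z x s 0)%C <> 0%C).
    { intros H0. rewrite H0, Cmod_0 in Hr. lra. }
    rewrite Cmod_div, Cmod_npow by auto.
    unfold Rdiv. apply Rmult_le_compat_l; [left; apply Rpower_pos|].
    apply Rinv_le_contravar; auto. }
  replace (csum (twisted_power z x s) (S L)) with ((csum (twisted_power z x s) (S L) - w) + w)%C by ring.
  eapply Rle_trans; [apply Cmod_triangle|].
  pose proof (pos_INR L) as HL. pose proof (S_INR L) as HSL.
  assert (Hpow : Rpower (x + INR (S L)) (- Re s) / D <= Rpower x (- Re s) / D).
  { unfold Rdiv. apply Rmult_le_compat_r; [left; now apply Rinv_0_lt_compat|].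
    apply Rpower_neg_antitone; lra. }
  assert (Hvar : log_step x - log_step (x + INR L) <= INR L / (x * x)).
  { eapply Rle_trans; [apply log_step_variation; lra|]. right. f_equal. ring. }
  assert (Hv2 : Rpower x (- Re s) * (Cmod s * (log_step x - log_step (x + INR L)) / (D * D)) <=
    Rpower x (- Re s) * (Cmod s * INR L / (x * x) / (D * D))).
  { apply Rmult_le_compat_l; [left; apply Rpower_pos|].
    unfold Rdiv. apply Rmult_le_compat_r; [left; apply Rinv_0_lt_compat; nra|].
    rewrite Rmult_assoc. apply Rmult_le_compat_l; [apply Cmod_ge_0|exact Hvar]. }
  replace (Rpower x (- Re s) * (2 / D + Cmod s * INR L / (x * x) / (D * D))) with
    (Rpower x (- Re s) / D + Rpower x (- Re s) / D +
     Rpower x (- Re s) * (Cmod s * INR L / (x * x) / (D * D))) by (unfold Rdiv; ring).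
  lra.
Qed.

Lemma Cmod_sub_twisted_ratio (z : C) (x : R) (s : C) (n : nat) :
  Cmod z = 1 -> 0 < x -> 0 <= Re s -> Cmod (z - twisted_ratio z x s n) <= Cmod s / x.
Proof.
  intros Hz Hx Hs. unfold twisted_ratio. pose proof (pos_INR n) as Hn.
  rewrite <- Cmod_opp.
  replace (- (z - z * Cexp (- (s * RtoC (log_step (x + INR n))))))%C with
    (z * (Cexp (- (s * RtoC (log_step (x + INR n)))) - Cexp (- (s * RtoC 0))))%C.
  2:{ replace (Cexp (- (s * RtoC 0))) with (RtoC 1); [ring|].
      rewrite <- Cexp_0. f_equal. ring. }
  rewrite Cmod_mult, Hz, Rmult_1_l.
  pose proof (log_step_nonneg (x + INR n) ltac:(lra)).
  eapply Rle_trans; [apply Cmod_Cexp_neg_sub_le; auto; lra|].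
  rewrite Rminus_0_r. apply Rmult_le_compat_l; [apply Cmod_ge_0|].
  eapply Rle_trans; [apply log_step_le; lra|]. apply Rinv_le_contravar; lra.
Qed.

(** When |s| / x is at most half of |1 - z|, every ratio keeps distance |1 - z| / 2 from 1, so the
    length L is unrestricted. The constant 6 is 4 from the variation of the ratios plus 2 from
    replacing the first ratio by z. *)
Lemma twisted_tail (z : C) (x : R) (s : C) (L : nat) :
  Cmod z = 1 -> 0 < x -> 0 <= Re s -> 0 < Cmod (1 - z) -> Cmod s / x <= Cmod (1 - z) / 2 ->
  Cmod (csum (twisted_power z x s) (S L) - npow x s / (1 - z)) <=
    2 * Rpower (x + INR (S L)) (- Re s) / Cmod (1 - z) +
    6 * Rpower x (- Re s) * (Cmod s / x) / (Cmod (1 - z) * Cmod (1 - z)).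
Proof.
  intros Hz Hx Hs Hz1 Hsx.
  set (d := Cmod (1 - z)) in *. set (r := twisted_ratio z x s).
  assert (Hr : forall n, d / 2 <= Cmod (1 - r n)).
  { intros n. pose proof (Cmod_sub_twisted_ratio z x s n Hz Hx Hs) as H. fold r in H.
    assert (Ht : d <= Cmod (1 - r n) + Cmod (- (z - r n))).
    { unfold d. replace (1 - z)%C with ((1 - r n) + - (z - r n))%C by ring. apply Cmod_triangle. }
    rewrite Cmod_opp in Ht. lra. }
  pose proof (Kusmin_Landau z x s (d / 2) L Hz Hx Hs ltac:(lra) (fun n _ => Hr n)) as H.
  fold r in H.
  assert (Hn0 : (1 - r 0%nat)%C <> 0%C).
  { intros H0. specialize (Hr 0%nat). rewrite H0, Cmod_0 in Hr. lra. }
  assert (Hnz : (1 - z)%C <> 0%C).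
  { intros H0. unfold d in Hz1. rewrite H0, Cmod_0 in Hz1. lra. }
  assert (Hw : Cmod (npow x s / (1 - r 0%nat) - npow x s / (1 - z)) <=
    Rpower x (- Re s) * ((Cmod s / x) * (2 / (d * d)))).
  { replace (npow x s / (1 - r 0%nat) - npow x s / (1 - z))%C with
      (npow x s * (- (z - r 0%nat) * / ((1 - r 0%nat) * (1 - z))))%C by (field; auto).
    rewrite !Cmod_mult, Cmod_npow, Cmod_opp.
    apply Rmult_le_compat_l; [left; apply Rpower_pos|].
    rewrite Cmod_inv, Cmod_mult by now apply Cmult_neq_0. fold d.
    apply Rmult_le_compat; [apply Cmod_ge_0| |now apply Cmod_sub_twisted_ratio|].
    - left. apply Rinv_0_lt_compat, Rmult_lt_0_compat; [specialize (Hr 0%nat); lra|lra].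
    - replace (2 / (d * d)) with (/ ((d / 2) * d)) by (field; lra).
      apply Rinv_le_contravar; [nra|]. apply Rmult_le_compat_r; [lra|apply Hr]. }
  replace (csum (twisted_power z x s) (S L) - npow x s / (1 - z))%C with
    ((csum (twisted_power z x s) (S L) - npow x s / (1 - r 0%nat)) +
     (npow x s / (1 - r 0%nat) - npow x s / (1 - z)))%C by ring.
  eapply Rle_trans; [apply Cmod_triangle|].
  assert (Hlog : log_step x - log_step (x + INR L) <= / x).
  { pose proof (pos_INR L). pose proof (log_step_le x Hx).
    pose proof (log_step_nonneg (x + INR L) ltac:(lra)). lra. }
  assert (Hm : Rpower x (- Re s) * (Cmod s * (log_step x - log_step (x + INR L)) / (d / 2 * (d / 2)))
     <= Rpower x (- Re s) * ((Cmod s / x) * (4 / (d * d)))).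
  { apply Rmult_le_compat_l; [left; apply Rpower_pos|].
    replace (4 / (d * d)) with (/ (d / 2 * (d / 2))) by (field; lra).
    unfold Rdiv at 1. apply Rmult_le_compat_r; [left; apply Rinv_0_lt_compat; nra|].
    unfold Rdiv. apply Rmult_le_compat_l; [apply Cmod_ge_0|exact Hlog]. }
  replace (Rpower (x + INR (S L)) (- Re s) / (d / 2)) with
    (2 * Rpower (x + INR (S L)) (- Re s) / d) in H by (field; lra).
  replace (6 * Rpower x (- Re s) * (Cmod s / x) / (d * d)) with
    (Rpower x (- Re s) * ((Cmod s / x) * (4 / (d * d))) +
     Rpower x (- Re s) * ((Cmod s / x) * (2 / (d * d)))) by (field; lra).
  lra.
Qed.

Lemma twisted_tail_bound (z : C) (x : R) (s : C) (L : nat) :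
  Cmod z = 1 -> 0 < x -> 0 <= Re s -> 0 < Cmod (1 - z) -> Cmod s / x <= Cmod (1 - z) / 2 ->
  Cmod (csum (twisted_power z x s) L) <= 6 * Rpower x (- Re s) / Cmod (1 - z).
Proof.
  intros Hz Hx Hs Hz1 Hsx. pose proof (Rpower_pos x (- Re s)) as Hp.
  destruct L as [|L].
  { simpl. rewrite Cmod_0. apply Rmult_le_pos; [lra|left; now apply Rinv_0_lt_compat]. }
  pose proof (twisted_tail z x s L Hz Hx Hs Hz1 Hsx) as H.
  set (d := Cmod (1 - z)) in *.
  assert (Hnz : (1 - z)%C <> 0%C).
  { intros H0. unfold d in Hz1. rewrite H0, Cmod_0 in Hz1. lra. }
  replace (csum (twisted_power z x s) (S L)) with
    ((csum (twisted_power z x s) (S L) - npow x s / (1 - z)) + npow x s / (1 - z))%C by ring.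
  eapply Rle_trans; [apply Cmod_triangle|].
  rewrite Cmod_div, Cmod_npow by auto. fold d.
  pose proof (pos_INR L) as HL. pose proof (S_INR L) as HSL.
  assert (Hpow : 2 * Rpower (x + INR (S L)) (- Re s) / d <= 2 * Rpower x (- Re s) / d).
  { unfold Rdiv. apply Rmult_le_compat_r; [left; now apply Rinv_0_lt_compat|].
    apply Rmult_le_compat_l; [lra|]. apply Rpower_neg_antitone; lra. }
  assert (H3 : 6 * Rpower x (- Re s) * (Cmod s / x) / (d * d) <= 3 * Rpower x (- Re s) / d).
  { replace (3 * Rpower x (- Re s) / d) with (6 * Rpower x (- Re s) * (d / 2) / (d * d)) by (field; lra).
    unfold Rdiv at 1 3. apply Rmult_le_compat_r; [left; apply Rinv_0_lt_compat; nra|].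
    apply Rmult_le_compat_l; lra. }
  replace (6 * Rpower x (- Re s) / d) with
    (2 * Rpower x (- Re s) / d + 3 * Rpower x (- Re s) / d + Rpower x (- Re s) / d) by (field; lra).
  lra.
Qed.

(** * Harmonic sums over the q-th roots of unity other than 1 *)

Lemma csum_rev (f : nat -> C) (n : nat) : csum f n = csum (fun i => f (n - 1 - i)%nat) n.
Proof.
  induction n as [|n IH]; auto. rewrite (csum_S_l (fun i => f (S n - 1 - i)%nat)).
  change (csum f (S n)) with (csum f n + f n)%C. rewrite IH.
  replace (S n - 1 - 0)%nat with n by lia.
  rewrite (csum_ext (fun i => f (S n - 1 - S i)%nat) (fun i => f (n - 1 - i)%nat)).
  - ring.
  - intros i Hi. f_equal. lia.
Qed.

Lemma rsum_rev (f : nat -> R) (n : nat) : rsum f n = rsum (fun i => f (n - 1 - i)%nat) n.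
Proof. apply RtoC_inj. rewrite <- !csum_RtoC. apply csum_rev. Qed.

Lemma harmonic_le (n : nat) : (1 <= n)%nat -> rsum (fun i => / INR (S i)) n <= 1 + ln (INR n).
Proof.
  induction n as [|n IH]; intros Hn; [lia|].
  destruct (Nat.eq_dec n 0) as [->|Hn0]; [simpl; rewrite ln_1; lra|].
  change (rsum ?f (S n)) with (rsum f n + f n). specialize (IH ltac:(lia)). cbv beta.
  assert (Hpos : 0 < INR n) by (apply lt_0_INR; lia).
  assert (Hstep : / INR (S n) <= ln (INR (S n)) - ln (INR n)).
  { rewrite S_INR. unfold Rminus. rewrite <- ln_Rinv, <- ln_mult by (try apply Rinv_0_lt_compat; lra).
    pose proof (ln_ge_1_sub_inv ((INR n + 1) * / INR n)) as H.
    assert (H0 : 0 < (INR n + 1) * / INR n) by (apply Rmult_lt_0_compat; [lra|now apply Rinv_0_lt_compat]).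
    specialize (H H0). eapply Rle_trans; [|exact H]. right. field. lra. }
  lra.
Qed.

(** For b = i + 1 the number q - 1 - i is q - b; the minimum divided by q is the distance of b / q
    to the nearest integer, and |e(x) - 1| >= 4 |x| for |x| <= 1/2. *)
Lemma ez_dist_ge (q : nat) (i : nat) : (i < q - 1)%nat ->
  Rmin (INR (S i)) (INR (q - 1 - i)) * 4 / INR q <= Cmod (1 - ez q (- Z.of_nat (S i))).
Proof.
  intros Hi. assert (Hq : 0 < INR q) by (apply lt_0_INR; lia).
  assert (Hsum : INR (S i) + INR (q - 1 - i) = INR q) by (rewrite <- plus_INR; f_equal; lia).
  assert (H1 : 0 < INR (S i)) by (apply lt_0_INR; lia).
  assert (H2 : 0 < INR (q - 1 - i)) by (apply lt_0_INR; lia).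
  replace (Cmod (1 - ez q (- Z.of_nat (S i)))) with (Cmod (eul (INR (S i) / INR q) - 1)).
  2:{ rewrite ez_opp, <- Cmod_conj, <- Cmod_opp.
      f_equal. unfold ez. rewrite <- INR_IZR_INZ. C_components. }
  destruct (Rle_dec (INR (S i)) (INR q / 2)) as [Hle|Hgt].
  - assert (Habs : Rabs (INR (S i) / INR q) = INR (S i) / INR q).
    { apply Rabs_pos_eq. left. now apply Rdiv_lt_0_compat. }
    eapply Rle_trans; [|apply Cmod_eul_sub_1_ge].
    + rewrite Habs. unfold Rdiv. rewrite (Rmult_comm _ 4), Rmult_assoc. apply Rmult_le_compat_l; [lra|].
      apply Rmult_le_compat_r; [left; now apply Rinv_0_lt_compat|apply Rmin_l].
    + rewrite Habs. apply Rmult_le_reg_r with (INR q); auto.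
      replace (INR (S i) / INR q * INR q) with (INR (S i)) by (field; lra). lra.
  - assert (Heq : eul (INR (S i) / INR q) = eul (- (INR (q - 1 - i) / INR q))).
    { replace (INR (S i) / INR q) with (- (INR (q - 1 - i) / INR q) + 1)
        by (replace (INR (S i)) with (INR q - INR (q - 1 - i)) by lra; field; lra).
      rewrite eul_plus, eul_1. ring. }
    rewrite Heq.
    assert (Habs : Rabs (- (INR (q - 1 - i) / INR q)) = INR (q - 1 - i) / INR q).
    { rewrite Rabs_Ropp. apply Rabs_pos_eq. left. now apply Rdiv_lt_0_compat. }
    eapply Rle_trans; [|apply Cmod_eul_sub_1_ge].
    + rewrite Habs. unfold Rdiv. rewrite (Rmult_comm _ 4), Rmult_assoc. apply Rmult_le_compat_l; [lra|].
      apply Rmult_le_compat_r; [left; now apply Rinv_0_lt_compat|apply Rmin_r].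
    + rewrite Habs. apply Rmult_le_reg_r with (INR q); auto.
      replace (INR (q - 1 - i) / INR q * INR q) with (INR (q - 1 - i)) by (field; lra). lra.
Qed.

Lemma ez_dist_ge_const (q : nat) (i : nat) : (i < q - 1)%nat ->
  4 / INR q <= Cmod (1 - ez q (- Z.of_nat (S i))).
Proof.
  intros Hi. eapply Rle_trans; [|now apply ez_dist_ge].
  assert (Hq : 0 < INR q) by (apply lt_0_INR; lia).
  unfold Rdiv. apply Rmult_le_compat_r; [left; now apply Rinv_0_lt_compat|].
  assert (1 <= Rmin (INR (S i)) (INR (q - 1 - i))); [|lra].
  apply Rmin_glb; apply (le_INR 1); lia.
Qed.

Lemma ez_dist_inv_le (q : nat) (i : nat) : (i < q - 1)%nat ->
  / Cmod (1 - ez q (- Z.of_nat (S i))) <= INR q / 4 * (/ INR (S i) + / INR (q - 1 - i)).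
Proof.
  intros Hi. assert (Hq : 0 < INR q) by (apply lt_0_INR; lia).
  assert (H1 : 0 < INR (S i)) by (apply lt_0_INR; lia).
  assert (H2 : 0 < INR (q - 1 - i)) by (apply lt_0_INR; lia).
  pose proof (Rinv_0_lt_compat _ H1) as Hi1. pose proof (Rinv_0_lt_compat _ H2) as Hi2.
  pose proof (ez_dist_ge q i Hi) as H.
  set (m := Rmin (INR (S i)) (INR (q - 1 - i))) in *.
  assert (Hm : 0 < m) by (now apply Rmin_glb_lt).
  apply Rle_trans with (/ (m * 4 / INR q)).
  - apply Rinv_le_contravar; auto. apply Rdiv_lt_0_compat; lra.
  - replace (/ (m * 4 / INR q)) with (INR q / 4 * / m) by (field; lra).
    apply Rmult_le_compat_l; [lra|]. unfold m, Rmin. destruct Rle_dec; lra.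
Qed.

Lemma sum_ez_dist_inv_le (q : nat) : (2 <= q)%nat ->
  rsum (fun i => / Cmod (1 - ez q (- Z.of_nat (S i)))) (q - 1) <= INR q / 2 * (1 + ln (INR q)).
Proof.
  intros Hq. assert (Hq0 : 0 < INR q) by (apply lt_0_INR; lia).
  eapply Rle_trans; [apply rsum_le; intros i Hi; apply ez_dist_inv_le, Hi|].
  rewrite rsum_mult_l, rsum_plus.
  assert (Hrev : rsum (fun i => / INR (q - 1 - i)) (q - 1) = rsum (fun i => / INR (S i)) (q - 1)).
  { rewrite rsum_rev. apply rsum_ext. intros i Hi. do 2 f_equal. lia. }
  rewrite Hrev. pose proof (harmonic_le (q - 1) ltac:(lia)) as H.
  assert (Hln : ln (INR (q - 1)) <= ln (INR q)).
  { apply ln_le; [apply lt_0_INR; lia|apply le_INR; lia]. }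
  replace (INR q / 2 * (1 + ln (INR q))) with
    (INR q / 4 * ((1 + ln (INR q)) + (1 + ln (INR q)))) by field.
  apply Rmult_le_compat_l; lra.
Qed.

Lemma rel_prime_0 (q : nat) : (2 <= q)%nat -> ~ rel_prime 0 (Z.of_nat q).
Proof.
  intros Hq [_ _ H].
  assert (H1 : (Z.of_nat q | 1)%Z) by (apply H; [apply Z.divide_0_r|apply Z.divide_refl]).
  apply Z.divide_1_r_nonneg in H1; lia.
Qed.

(** The argument of the character and the base of the power start independently: a row of the double
    series has n1 = 0 and x = m, and passing to a later block shifts both by the same integer. *)
Definition chi_power_sum (chi : Z -> C) (n1 : Z) (x : R) (s : C) (K : nat) : C :=
  csum (fun n => chi (n1 + Z.of_nat n)%Z * npow (x + INR n) s)%C K.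

(** * Expansion of a primitive character in additive characters *)

Section PrimitiveCharacter.

Variables (q : nat) (chi : Z -> C).
Hypothesis Hq : (2 <= q)%nat.
Hypothesis Hchi : primitive_character (Z.of_nat q) chi.

Lemma gauss_sum_primitive_0 : gauss_sum q chi 0 = 0%C.
Proof. apply gauss_sum_primitive_nonunit; auto; [lia|]. now apply rel_prime_0. Qed.

(** Fourier inversion mod q. The frequency 0 is absent because G(0) = 0, so b = i + 1 runs over 1,
    ..., q - 1 and all 1 - e(-b/q) are invertible. *)
Lemma dirichlet_expansion (n : Z) :
  (RtoC (INR q) * chi n)%C =
  csum (fun i => gauss_sum q chi (Z.of_nat (S i)) * ez q (- Z.of_nat (S i) * n))%C (q - 1).
Proof.
  rewrite gauss_sum_inversion by (try lia; apply dirichlet_periodic, Hchi).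
  assert (Hsplit : forall f, csum f q = (f 0%nat + csum (fun i => f (S i)) (q - 1))%C).
  { intros f. replace q with (S (q - 1)) at 1 by lia. apply csum_S_l. }
  rewrite Hsplit. simpl (Z.of_nat 0). rewrite gauss_sum_primitive_0, Cmult_0_l, Cplus_0_l.
  apply csum_ext. intros i _. do 2 f_equal. ring.
Qed.

Lemma chi_power_sum_expansion (n1 : Z) (x : R) (s : C) (K : nat) :
  (RtoC (INR q) * chi_power_sum chi n1 x s K)%C =
  csum (fun i => gauss_sum q chi (Z.of_nat (S i)) * ez q (- Z.of_nat (S i) * n1) *
     csum (twisted_power (ez q (- Z.of_nat (S i))) x s) K)%C (q - 1).
Proof.
  unfold chi_power_sum. rewrite <- csum_mult_l.
  rewrite (csum_ext _ (fun n => csum (fun i => gauss_sum q chi (Z.of_nat (S i)) *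
    ez q (- Z.of_nat (S i) * n1) * twisted_power (ez q (- Z.of_nat (S i))) x s n)%C (q - 1))).
  - rewrite csum_swap. apply csum_ext. intros i _. apply csum_mult_l.
  - intros n _. rewrite Cmult_assoc, dirichlet_expansion, <- csum_mult_r.
    apply csum_ext. intros i _. unfold twisted_power.
    rewrite <- ez_mul_nat, Z.mul_add_distr_l, ez_plus. ring.
Qed.

Lemma Cmod_chi_power_sum_le (n1 : Z) (x : R) (s : C) (K : nat) (B : nat -> R) :
  (forall i, (i < q - 1)%nat ->
     Cmod (csum (twisted_power (ez q (- Z.of_nat (S i))) x s) K) <= B i) ->
  Cmod (chi_power_sum chi n1 x s K) <= rsum B (q - 1) / sqrt (INR q).
Proof.
  intros HB. assert (Hq0 : 0 < INR q) by (apply lt_0_INR; lia).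
  pose proof (sqrt_lt_R0 _ Hq0) as Hs.
  assert (H : Cmod (RtoC (INR q) * chi_power_sum chi n1 x s K) <= sqrt (INR q) * rsum B (q - 1)).
  { rewrite chi_power_sum_expansion, <- rsum_mult_l. apply Cmod_csum_le_rsum. intros i Hi.
    rewrite !Cmod_mult, Cmod_ez, Rmult_1_r.
    apply Rmult_le_compat; try apply Cmod_ge_0; [|now apply HB].
    apply Cmod_gauss_sum_primitive_le; auto; lia. }
  rewrite Cmod_mult, Cmod_R, Rabs_pos_eq in H by lra.
  apply Rmult_le_reg_l with (INR q); auto.
  replace (INR q * (rsum B (q - 1) / sqrt (INR q))) with (sqrt (INR q) * rsum B (q - 1)); auto.
  rewrite <- (sqrt_sqrt (INR q)) at 2 by lra. field. lra.
Qed.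

(** The condition on x says |s| / x <= 2 / q, which is at most |1 - e(-b/q)| / 2 for every b; so no
    frequency resonates any more, and summing 1 / |1 - e(-b/q)| over b costs one logarithm. *)
Lemma chi_power_sum_tail (n1 : Z) (x : R) (s : C) (K : nat) :
  0 <= Re s -> 0 < x -> INR q * Cmod s / 2 <= x ->
  Cmod (chi_power_sum chi n1 x s K) <=
    3 * sqrt (INR q) * (1 + ln (INR q)) * Rpower x (- Re s).
Proof.
  intros Hs Hx Hqx. assert (Hq0 : 0 < INR q) by (apply lt_0_INR; lia).
  pose proof (sqrt_lt_R0 _ Hq0) as Hsq. pose proof (Rpower_pos x (- Re s)) as Hp.
  eapply Rle_trans.
  { apply (Cmod_chi_power_sum_le n1 x s K
      (fun i => 6 * Rpower x (- Re s) * / Cmod (1 - ez q (- Z.of_nat (S i))))).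
    intros i Hi. pose proof (ez_dist_ge_const q i Hi) as Hd.
    assert (0 < 4 / INR q) by (apply Rdiv_lt_0_compat; lra).
    apply twisted_tail_bound; auto; try lra; [apply Cmod_ez|].
    apply Rle_trans with (2 / INR q); [|lra].
    apply Rmult_le_reg_r with x; auto. replace (Cmod s / x * x) with (Cmod s) by (field; lra).
    apply Rmult_le_reg_l with (INR q / 2); [lra|].
    replace (INR q / 2 * (2 / INR q * x)) with x by (field; lra). lra. }
  rewrite rsum_mult_l.
  pose proof (sum_ez_dist_inv_le q Hq) as H.
  apply Rmult_le_reg_r with (sqrt (INR q)); auto.
  replace (6 * Rpower x (- Re s) * rsum (fun i => / Cmod (1 - ez q (- Z.of_nat (S i)))) (q - 1) /
    sqrt (INR q) * sqrt (INR q)) with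
    (6 * Rpower x (- Re s) * rsum (fun i => / Cmod (1 - ez q (- Z.of_nat (S i)))) (q - 1))
    by (field; lra).
  replace (3 * sqrt (INR q) * (1 + ln (INR q)) * Rpower x (- Re s) * sqrt (INR q)) with
    (6 * Rpower x (- Re s) * ((sqrt (INR q) * sqrt (INR q)) / 2 * (1 + ln (INR q)))) by field.
  rewrite sqrt_sqrt by lra. apply Rmult_le_compat_l; lra.
Qed.

(* The value [L(0, chi)] of the Dirichlet L-function. *)
Definition L_at_0 : C :=
  (/ RtoC (INR q) * csum (fun i => gauss_sum q chi (Z.of_nat (S i)) *
     / (1 - ez q (- Z.of_nat (S i)))) (q - 1))%C.

Lemma ez_sub_neq_0 (i : nat) : (i < q - 1)%nat -> (1 - ez q (- Z.of_nat (S i)))%C <> 0%C.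
Proof.
  intros Hi H0. pose proof (ez_dist_ge_const q i Hi) as Hd. rewrite H0, Cmod_0 in Hd.
  assert (0 < 4 / INR q); [|lra]. apply Rdiv_lt_0_compat; [lra|apply lt_0_INR; lia].
Qed.

Lemma Cmod_L_at_0_le : Cmod L_at_0 <= sqrt (INR q) * (1 + ln (INR q)).
Proof.
  assert (Hq0 : 0 < INR q) by (apply lt_0_INR; lia).
  pose proof (sqrt_lt_R0 _ Hq0) as Hsq.
  assert (Hne : RtoC (INR q) <> 0%C) by (intros H0; apply RtoC_inj in H0; lra).
  unfold L_at_0. rewrite Cmod_mult, Cmod_inv, Cmod_R, Rabs_pos_eq by (auto; lra).
  assert (H : Cmod (csum (fun i => gauss_sum q chi (Z.of_nat (S i)) *
     / (1 - ez q (- Z.of_nat (S i))))%C (q - 1)) <= sqrt (INR q) * (INR q / 2 * (1 + ln (INR q)))).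
  { eapply Rle_trans.
    - apply (Cmod_csum_le_rsum _ (fun i => sqrt (INR q) * / Cmod (1 - ez q (- Z.of_nat (S i))))).
      intros i Hi. rewrite Cmod_mult, Cmod_inv by now apply ez_sub_neq_0.
      apply Rmult_le_compat_r.
      + left. apply Rinv_0_lt_compat, Cmod_gt_0. now apply ez_sub_neq_0.
      + apply Cmod_gauss_sum_primitive_le; auto; lia.
    - rewrite rsum_mult_l. apply Rmult_le_compat_l; [lra|]. now apply sum_ez_dist_inv_le. }
  assert (Hln : 0 <= ln (INR q)) by (rewrite <- ln_1; apply ln_le; [lra|apply (le_INR 1); lia]).
  apply Rmult_le_reg_l with (INR q); auto.
  rewrite <- Rmult_assoc, Rinv_r, Rmult_1_l by lra.
  eapply Rle_trans; [exact H|].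
  assert (0 <= INR q * (sqrt (INR q) * (1 + ln (INR q)))).
  { repeat apply Rmult_le_pos; lra. }
  lra.
Qed.

(** Pair b with q - b. For even chi the Gauss sums agree, and 1/(1 - v) + 1/(1 - conj v) = 1 when
    |v| = 1; so twice the sum is the sum of all G(b), which is q chi(0) = 0. *)
Lemma L_at_0_even : chi (-1)%Z = 1%C -> L_at_0 = 0%C.
Proof.
  intros Heven. pose proof (proj1 Hchi) as Hd.
  assert (Hq0 : 0 < INR q) by (apply lt_0_INR; lia).
  assert (Hne : RtoC (INR q) <> 0%C) by (intros H0; apply RtoC_inj in H0; lra).
  set (G := fun i => gauss_sum q chi (Z.of_nat (S i))).
  set (w := fun i => (1 - ez q (- Z.of_nat (S i)))%C).
  set (T := csum (fun i => G i * / w i)%C (q - 1)).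
  assert (Hsum : csum G (q - 1) = 0%C).
  { pose proof (dirichlet_expansion 0) as H.
    assert (H0 : chi 0%Z = 0%C).
    { destruct Hd as [_ [_ Hu]]. pose proof (rel_prime_0 q Hq) as Hr. rewrite <- Hu in Hr.
      destruct (Ceq_dec (chi 0%Z) 0%C); tauto. }
    rewrite H0, Cmult_0_r in H. rewrite H. apply csum_ext. intros i _.
    rewrite Z.mul_0_r, ez_0. unfold G. ring. }
  assert (HT : (T + T = 0)%C).
  { unfold T at 2. rewrite csum_rev. unfold T. rewrite <- csum_plus, <- Hsum.
    apply csum_ext. intros i Hi. set (j := (q - 1 - 1 - i)%nat).
    assert (Hj : Z.of_nat (S j) = (Z.of_nat q * 1 + - Z.of_nat (S i))%Z) by (unfold j; lia).
    assert (HGj : G j = G i).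
    { unfold G. rewrite Hj. rewrite (gauss_sum_periodic q chi ltac:(lia) _ (-1 * Z.of_nat (S i))%Z).
      2:{ exists 1%Z. ring. }
      rewrite <- (gauss_sum_unit q chi (-1) (Z.of_nat (S i))); auto; [rewrite Heven; ring|lia|].
      apply (inverse_rel_prime (-1) (-1)). exists 0%Z. ring. }
    assert (Hw := ez_sub_neq_0 i Hi). assert (Hwj := ez_sub_neq_0 j ltac:(unfold j; lia)).
    rewrite HGj. unfold w.
    assert (Hprod : (ez q (- Z.of_nat (S j)) * ez q (- Z.of_nat (S i)) = 1)%C).
    { rewrite <- ez_plus. replace (- Z.of_nat (S j) + - Z.of_nat (S i))%Z with (Z.of_nat q * -1)%Z by lia.
      apply ez_mult_q; lia. }
    set (u := ez q (- Z.of_nat (S j))) in *. set (v := ez q (- Z.of_nat (S i))) in *.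
    transitivity (G i * ((2 - u - v) * / ((1 - v) * (1 - u))))%C; [field; auto|].
    replace (2 - u - v)%C with ((1 - v) * (1 - u))%C; [field; auto|].
    replace ((1 - v) * (1 - u))%C with (1 - u - v + u * v)%C by ring. rewrite Hprod.
    C_components. }
  assert (HT0 : T = 0%C).
  { transitivity (/ 2 * (T + T))%C; [|rewrite HT; ring].
    field. }
  change (/ RtoC (INR q) * T = 0)%C. rewrite HT0. ring.
Qed.

(** The boundary terms x^{-s} / (1 - e(-b/q)), weighted by the Gauss sums, add up to [L_at_0]
    x^{-s}. In the error, one factor 1 / |1 - e(-b/q)| is bounded by q / 4 and the other is summed
    over b. *)
Lemma chi_power_sum_main (x : R) (s : C) (L : nat) :
  0 <= Re s -> 0 < x -> INR q * Cmod s / 2 <= x ->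
  Cmod (chi_power_sum chi 0 x s (S L) - L_at_0 * npow x s) <=
    sqrt (INR q) * (1 + ln (INR q)) *
      (Rpower (x + INR (S L)) (- Re s) + INR q * Cmod s / x * Rpower x (- Re s)).
Proof.
  intros Hs Hx Hqx. assert (Hq0 : 0 < INR q) by (apply lt_0_INR; lia).
  pose proof (sqrt_lt_R0 _ Hq0) as Hsq. pose proof (Rpower_pos x (- Re s)) as Hp.
  pose proof (Rpower_pos (x + INR (S L)) (- Re s)) as Hp'.
  assert (Hne : RtoC (INR q) <> 0%C) by (intros H0; apply RtoC_inj in H0; lra).
  set (P := Rpower (x + INR (S L)) (- Re s)) in *. set (P0 := Rpower x (- Re s)) in *.
  set (d := fun i => Cmod (1 - ez q (- Z.of_nat (S i)))).
  assert (Hsx0 : 0 <= Cmod s / x).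
  { apply Rmult_le_pos; [apply Cmod_ge_0|left; now apply Rinv_0_lt_compat]. }
  assert (Hln : 0 <= ln (INR q)) by (rewrite <- ln_1; apply ln_le; [lra|apply (le_INR 1); lia]).
  assert (H : Cmod (RtoC (INR q) * (chi_power_sum chi 0 x s (S L) - L_at_0 * npow x s)) <=
    sqrt (INR q) * ((2 * P + 3 / 2 * INR q * (Cmod s / x) * P0) * (INR q / 2 * (1 + ln (INR q))))).
  { replace (RtoC (INR q) * (chi_power_sum chi 0 x s (S L) - L_at_0 * npow x s))%C with
      (csum (fun i => gauss_sum q chi (Z.of_nat (S i)) *
        (csum (twisted_power (ez q (- Z.of_nat (S i))) x s) (S L)
         - npow x s / (1 - ez q (- Z.of_nat (S i)))))%C (q - 1)).
    2:{ unfold Cminus at 3. rewrite Cmult_plus_distr_l, chi_power_sum_expansion.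
        unfold L_at_0.
        replace (RtoC (INR q) * - (/ RtoC (INR q) * csum (fun i => gauss_sum q chi (Z.of_nat (S i)) *
          / (1 - ez q (- Z.of_nat (S i)))) (q - 1) * npow x s))%C with
          (- (csum (fun i => gauss_sum q chi (Z.of_nat (S i)) *
          / (1 - ez q (- Z.of_nat (S i)))) (q - 1) * npow x s))%C by (field; auto).
        rewrite <- csum_mult_r.
        match goal with |- _ = (?A + - ?B)%C => change (A + - B)%C with (A - B)%C end.
        rewrite <- csum_minus. apply csum_ext. intros i _.
        rewrite Z.mul_0_r, ez_0. unfold Cdiv. ring. }
    eapply Rle_trans.
    - apply (Cmod_csum_le_rsum _ (fun i => sqrt (INR q) *
        ((2 * P + 3 / 2 * INR q * (Cmod s / x) * P0) * / d i))).
      intros i Hi. rewrite Cmod_mult.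
      pose proof (ez_dist_ge_const q i Hi) as Hd. fold (d i) in Hd.
      assert (H4q : 0 < 4 / INR q) by (apply Rdiv_lt_0_compat; lra).
      apply Rmult_le_compat; try apply Cmod_ge_0.
      { apply Cmod_gauss_sum_primitive_le; auto; lia. }
      eapply Rle_trans; [apply twisted_tail; auto; try (fold (d i); lra); [apply Cmod_ez|]|].
      + fold (d i). apply Rle_trans with (2 / INR q); [|lra].
        apply Rmult_le_reg_r with x; auto. replace (Cmod s / x * x) with (Cmod s) by (field; lra).
        apply Rmult_le_reg_l with (INR q / 2); [lra|].
        replace (INR q / 2 * (2 / INR q * x)) with x by (field; lra). lra.
      + fold (d i). fold P P0. rewrite Rmult_plus_distr_r. apply Rplus_le_compat; [right; reflexivity|].
        assert (Hdi : / d i <= INR q / 4).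
        { replace (INR q / 4) with (/ (4 / INR q)) by (field; lra). now apply Rinv_le_contravar. }
        replace (6 * P0 * (Cmod s / x) / (d i * d i)) with
          (6 * P0 * (Cmod s / x) * / d i * / d i) by (field; lra).
        replace (3 / 2 * INR q * (Cmod s / x) * P0 * / d i) with
          (6 * P0 * (Cmod s / x) * / d i * (INR q / 4)) by (generalize (/ d i) (Cmod s / x); intros; field).
        apply Rmult_le_compat_l; auto.
        assert (0 < / d i) by (apply Rinv_0_lt_compat; lra).
        apply Rmult_le_pos; [apply Rmult_le_pos|]; lra.
    - rewrite !rsum_mult_l. apply Rmult_le_compat_l; [lra|].
      apply Rmult_le_compat_l; [|now apply sum_ez_dist_inv_le].
      assert (0 <= INR q * (Cmod s / x) * P0) by (apply Rmult_le_pos; [apply Rmult_le_pos|]; lra). lra. }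
  rewrite Cmod_mult, Cmod_R, Rabs_pos_eq in H by lra.
  apply Rmult_le_reg_l with (INR q); auto. eapply Rle_trans; [exact H|].
  assert (HA : 0 <= sqrt (INR q) * (INR q * (1 + ln (INR q)))).
  { repeat apply Rmult_le_pos; lra. }
  assert (HB : 0 <= INR q * (Cmod s / x) * P0) by (apply Rmult_le_pos; [apply Rmult_le_pos|]; lra).
  pose proof (Rmult_le_pos _ _ HA HB) as HC.
  replace (INR q * Cmod s / x) with (INR q * (Cmod s / x)) by (unfold Rdiv; ring).
  nra.
Qed.

End PrimitiveCharacter.

(** * Short blocks and resonances *)

Lemma Cexp_polar (a b : R) : Cexp (a, b) = (RtoC (exp a) * Cexp (0, b))%C.
Proof.
  unfold Cexp. simpl. rewrite exp_0. C_components.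
Qed.

(** The defect 1 - rho is itself at most |1 - rho w|. This removes the amplitude of the ratios,
    leaving only their phase. *)
Lemma one_sub_contraction_ge (rho : R) (w : C) : 0 <= rho <= 1 -> Cmod w = 1 ->
  Cmod (1 - w) / 2 <= Cmod (1 - RtoC rho * w).
Proof.
  intros Hrho Hw.
  assert (H1 : Cmod (1 - w) <= Cmod (1 - RtoC rho * w) + (1 - rho)).
  { replace (1 - w)%C with ((1 - RtoC rho * w) + - (RtoC (1 - rho) * w))%C
      by (rewrite RtoC_minus; ring).
    eapply Rle_trans; [apply Cmod_triangle|].
    rewrite Cmod_opp, Cmod_mult, Hw, Cmod_R, Rabs_pos_eq by lra. lra. }
  assert (H2 : 1 <= Cmod (1 - RtoC rho * w) + rho).
  { rewrite <- Cmod_1 at 1. replace (RtoC 1) with ((1 - RtoC rho * w) + RtoC rho * w)%C at 1 by ring.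
    eapply Rle_trans; [apply Cmod_triangle|].
    rewrite (Cmod_mult (RtoC rho) w), Hw, Cmod_R, Rabs_pos_eq by lra. lra. }
  lra.
Qed.

Lemma Cmod_eul_sub (x y : R) : Cmod (eul x - eul y) <= 2 * PI * Rabs (x - y).
Proof.
  replace (eul x - eul y)%C with (eul y * (eul (x - y) - 1))%C.
  - rewrite Cmod_mult, Cmod_eul, Rmult_1_l. apply Cmod_eul_sub_1_le.
  - replace x with (y + (x - y)) at 2 by ring. rewrite eul_plus. ring.
Qed.

(* [r] is, up to conjugation and a real contraction, [eul ((beta - u) / q)]. *)
Lemma twisted_ratio_dist (q : nat) (b : nat) (x : R) (s : C) (n : nat) :
  (2 <= q)%nat -> (0 < b < q)%nat -> 0 < x -> 0 <= Re s ->
  let beta := if Rle_dec (Im s) 0 then b else (q - b)%nat in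
  let u := INR q * Rabs (Im s) / (2 * PI * x) in
  (Cmod (1 - eul ((INR beta - u) / INR q)) - Rabs (Im s) * INR (S n) / (x * x)) / 2 <=
  Cmod (1 - twisted_ratio (ez q (- Z.of_nat b)) x s n).
Proof.
  intros Hq Hb Hx Hs beta u. pose proof PI_RGT_0 as Hpi.
  assert (Hq0 : 0 < INR q) by (apply lt_0_INR; lia).
  pose proof (pos_INR n) as Hn.
  set (T := Rabs (Im s)) in *. set (ls := log_step (x + INR n)).
  assert (Hls : 0 <= ls) by (apply log_step_nonneg; lra).
  (* y is the exact phase of the n-th ratio. In u, [log_step (x + n)] is replaced by 1 / x, an error
     of at most (n + 1) / x^2. *)
  set (y := (INR beta - INR q * T * ls / (2 * PI)) / INR q).
  assert (Hrho : 0 <= exp (- (Re s * ls)) <= 1).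
  { split; [left; apply exp_pos|]. rewrite <- exp_0. apply exp_le_mono.
    pose proof (Rmult_le_pos _ _ Hs Hls). lra. }
  assert (Hr : Cmod (1 - eul y) / 2 <= Cmod (1 - twisted_ratio (ez q (- Z.of_nat b)) x s n)).
  { unfold twisted_ratio. fold ls.
    replace (- (s * RtoC ls))%C with ((- (Re s * ls), - (Im s * ls)) : C)
      by (destruct s; C_components).
    rewrite Cexp_polar.
    replace (ez q (- Z.of_nat b) * (exp (- (Re s * ls)) * Cexp (0%R, (- (Im s * ls))%R)))%C with
      (RtoC (exp (- (Re s * ls))) * (ez q (- Z.of_nat b) * Cexp (0%R, (- (Im s * ls))%R)))%C by ring.
    set (w := (ez q (- Z.of_nat b) * Cexp (0%R, (- (Im s * ls))%R))%C).
    assert (Hw1 : Cmod w = 1).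
    { unfold w. rewrite Cmod_mult, Cmod_ez, Cmod_Cexp. simpl. rewrite exp_0. ring. }
    assert (Hwy : Cmod (1 - w) = Cmod (1 - eul y)).
    { assert (Hw : w = eul (- (INR b / INR q) - Im s * ls / (2 * PI))).
      { unfold w, ez. unfold Rminus. rewrite eul_plus. f_equal.
        - f_equal. rewrite opp_IZR, <- INR_IZR_INZ. unfold Rdiv; ring.
        - unfold eul. f_equal. apply injective_projections; simpl; [reflexivity|field; lra]. }
      (* For Im s <= 0 the ratio is conjugated, otherwise a full turn is added; either way the
         frequency is beta / q minus a nonnegative slope. *)
      unfold y, beta, T. destruct (Rle_dec (Im s) 0) as [Him|Him].
      - rewrite <- (Cmod_conj (1 - w)). f_equal. rewrite Cminus_conj. f_equal.
        { C_components. }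
        rewrite Hw, <- eul_opp. f_equal. rewrite Rabs_left1 by auto. field. lra.
      - f_equal. f_equal. rewrite Hw, <- (Cmult_1_r (eul _)), <- eul_1, <- eul_plus. f_equal.
        rewrite Rabs_pos_eq by lra. rewrite minus_INR by lia. field. lra. }
    rewrite <- Hwy. now apply one_sub_contraction_ge. }
  apply Rle_trans with (Cmod (1 - eul y) / 2); [|exact Hr].
  assert (Hd : Cmod (1 - eul ((INR beta - u) / INR q)) <= Cmod (1 - eul y) +
     Cmod (eul y - eul ((INR beta - u) / INR q))).
  { replace (1 - eul ((INR beta - u) / INR q))%C with
      ((1 - eul y) + (eul y - eul ((INR beta - u) / INR q)))%C by ring. apply Cmod_triangle. }
  assert (Hdiff : Cmod (eul y - eul ((INR beta - u) / INR q)) <= T * INR (S n) / (x * x)).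
  { eapply Rle_trans; [apply Cmod_eul_sub|].
    replace (y - (INR beta - u) / INR q) with (T / (2 * PI) * (/ x - ls))
      by (unfold y, u; field; lra).
    assert (HT : 0 <= T) by apply Rabs_pos.
    assert (H1 : ls <= / x).
    { eapply Rle_trans; [apply log_step_antitone with (x := x); lra|now apply log_step_le]. }
    assert (H2 : / (x + INR n + 1) <= ls).
    { unfold ls, log_step. assert (0 < / (x + INR n)) by (apply Rinv_0_lt_compat; lra).
      eapply Rle_trans; [|apply ln_ge_1_sub_inv; lra]. right. field. lra. }
    rewrite Rabs_pos_eq.
    2:{ apply Rmult_le_pos; [|lra]. apply Rmult_le_pos; [lra|]. left; apply Rinv_0_lt_compat; lra. }
    replace (2 * PI * (T / (2 * PI) * (/ x - ls))) with (T * (/ x - ls)) by (field; lra).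
    unfold Rdiv. rewrite Rmult_assoc. apply Rmult_le_compat_l; auto.
    apply Rle_trans with (/ x - / (x + INR n + 1)); [lra|].
    replace (/ x - / (x + INR n + 1)) with (INR (S n) * / (x * (x + INR n + 1)))
      by (rewrite S_INR; field; lra).
    apply Rmult_le_compat_l; [apply pos_INR|]. apply Rinv_le_contravar; [nra|]. nra. }
  lra.
Qed.

(** Let del = sqrt |t| / x, the reciprocal of the maximal block length. If d >= 2 del, the drift of
    the phase over the block leaves the ratios at distance at least D = d / 4 from 1, and
    Kusmin-Landau gives 8 / d + 12 / d. Otherwise the trivial bound 1 / del has the right size. *)
Lemma twisted_block (q : nat) (b : nat) (x : R) (s : C) (L : nat) :
  (2 <= q)%nat -> (0 < b < q)%nat -> 0 < x -> 0 <= Re s -> 2 <= Rabs (Im s) ->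
  Cmod s <= 3 / 2 * Rabs (Im s) -> INR L <= x / sqrt (Rabs (Im s)) ->
  let beta := if Rle_dec (Im s) 0 then b else (q - b)%nat in
  let u := INR q * Rabs (Im s) / (2 * PI * x) in
  Cmod (csum (twisted_power (ez q (- Z.of_nat b)) x s) L) <=
    30 * Rpower x (- Re s) /
      (sqrt (Rabs (Im s)) / x + Cmod (1 - eul ((INR beta - u) / INR q))).
Proof.
  intros Hq Hb Hx Hs HT Hcs HL beta u.
  set (T := Rabs (Im s)) in *.
  assert (Hsq : 0 < sqrt T) by (apply sqrt_lt_R0; lra).
  assert (Hss : sqrt T * sqrt T = T) by (apply sqrt_sqrt; lra).
  set (d := Cmod (1 - eul ((INR beta - u) / INR q))).
  assert (Hd0 : 0 <= d) by apply Cmod_ge_0.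
  set (del := sqrt T / x). assert (Hdel : 0 < del) by (now apply Rdiv_lt_0_compat).
  pose proof (Rpower_pos x (- Re s)) as Hp. set (P := Rpower x (- Re s)) in *.
  assert (Hxd : x / sqrt T = / del) by (unfold del; field; lra).
  destruct (Rle_dec (2 * del) d) as [Hcase|Hcase].
  - destruct L as [|L].
    { simpl. rewrite Cmod_0. apply Rmult_le_pos; [lra|left; apply Rinv_0_lt_compat; lra]. }
    assert (HL' : INR (S L) * del <= 1).
    { apply Rmult_le_reg_r with (/ del); [now apply Rinv_0_lt_compat|].
      rewrite Rmult_assoc, Rinv_r, <- Hxd by lra. lra. }
    assert (Hr : forall n, (n <= L)%nat -> d / 4 <= Cmod (1 - twisted_ratio (ez q (- Z.of_nat b)) x s n)).
    { intros n Hn. eapply Rle_trans; [|apply (twisted_ratio_dist q b x s n); auto].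
      fold T beta u d.
      assert (HSn : INR (S n) <= INR (S L)) by (apply le_INR; lia).
      assert (T * INR (S n) / (x * x) <= del).
      { replace (T * INR (S n) / (x * x)) with (del * (INR (S n) * del))
          by (unfold del; rewrite <- Hss at 3; field; lra).
        rewrite <- (Rmult_1_r del) at 3. apply Rmult_le_compat_l; [lra|].
        apply Rle_trans with (INR (S L) * del); auto. apply Rmult_le_compat_r; lra. }
      lra. }
    eapply Rle_trans; [apply (Kusmin_Landau_block _ x s (d / 4) L); auto; try lra; apply Cmod_ez|].
    fold P. replace (30 * P / (del + d)) with (P * (30 / (del + d))) by (unfold Rdiv; ring).
    apply Rmult_le_compat_l; [lra|].
    apply Rle_trans with (20 / d).
    2:{ apply Rmult_le_reg_r with (d * (del + d)); [nra|].
        replace (20 / d * (d * (del + d))) with (20 * (del + d)) by (field; lra).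
        replace (30 / (del + d) * (d * (del + d))) with (30 * d) by (field; lra). lra. }
    assert (HLs : INR L * del <= 1).
    { apply Rle_trans with (INR (S L) * del); auto. apply Rmult_le_compat_r; [lra|].
      apply le_INR; lia. }
    assert (Hv : Cmod s * INR L / (x * x) <= 3 / 2 * del).
    { apply Rle_trans with (3 / 2 * T * INR L / (x * x)).
      - unfold Rdiv at 1 2. apply Rmult_le_compat_r; [left; apply Rinv_0_lt_compat; nra|].
        apply Rmult_le_compat_r; [apply pos_INR|exact Hcs].
      - replace (3 / 2 * T * INR L / (x * x)) with (3 / 2 * del * (INR L * del))
          by (unfold del; rewrite <- Hss at 3; field; lra).
        rewrite <- (Rmult_1_r (3 / 2 * del)) at 2. apply Rmult_le_compat_l; lra. }
    apply Rle_trans with (2 / (d / 4) + (3 / 4 * d) / (d / 4 * (d / 4))).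
    + apply Rplus_le_compat_l. unfold Rdiv at 1 6. apply Rmult_le_compat_r.
      * left. apply Rinv_0_lt_compat. nra.
      * lra.
    + right. field. lra.
  - apply Rle_trans with (rsum (fun _ => P) L).
    + apply Cmod_csum_le_rsum. intros i Hi. rewrite Cmod_twisted_power by apply Cmod_ez.
      apply Rpower_neg_antitone; auto. pose proof (pos_INR i). lra.
    + rewrite rsum_const. replace (30 * P / (del + d)) with (30 / (del + d) * P) by (unfold Rdiv; ring).
      apply Rmult_le_compat_r; [lra|]. rewrite Hxd in HL. eapply Rle_trans; [exact HL|].
      apply Rmult_le_reg_r with (del * (del + d)); [nra|].
      replace (/ del * (del * (del + d))) with (del + d) by (field; lra).
      replace (30 / (del + d) * (del * (del + d))) with (30 * del) by (field; lra). lra.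
Qed.

(** The natural floor: [up x] is the integer in (x, x + 1]. *)
Definition nfl (x : R) : nat := Z.to_nat (up x - 1).

Lemma nfl_spec (x : R) : 0 <= x -> INR (nfl x) <= x < INR (nfl x) + 1.
Proof.
  intros Hx. destruct (archimed x) as [H1 H2].
  assert (H0 : (0 <= up x - 1)%Z).
  { assert (0 < up x)%Z by (apply lt_IZR; lra). lia. }
  unfold nfl. rewrite INR_IZR_INZ, Z2Nat.id, minus_IZR by auto. lra.
Qed.

Lemma rsum_window (f : nat -> R) (a n M : nat) :
  (forall i, 0 <= f i) -> (a + n <= M)%nat -> rsum (fun i => f (a + i)%nat) n <= rsum f M.
Proof.
  intros Hf H. replace M with (a + n + (M - a - n))%nat by lia.
  rewrite !rsum_add.
  pose proof (rsum_nonneg f a (fun i _ => Hf i)).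
  pose proof (rsum_nonneg (fun i => f (a + n + i)%nat) (M - a - n) (fun i _ => Hf _)). lra.
Qed.

(** Strength of the resonance between the slope u and the integer k. The summand u / rt is about the
    drift of u over one block of relative length 1 / rt, which caps the peak at k = u. *)
Definition resonance (rt u : R) (k : nat) : R := / (u / rt + Rabs (INR k - u)).

Lemma resonance_pos (rt u : R) (k : nat) : 0 < rt -> 0 < u -> 0 < resonance rt u k.
Proof.
  intros. unfold resonance. apply Rinv_0_lt_compat. assert (0 < u / rt) by now apply Rdiv_lt_0_compat.
  pose proof (Rabs_pos (INR k - u)). lra.
Qed.

(* The distance from [u] to [beta + q Z] is attained at one of three
   neighbouring lifts; a negative lift is harmless. *)
Lemma resonance_lifts (q beta : nat) (rt u : R) : (0 < beta < q)%nat -> 0 < rt -> 0 < u ->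
  let w := nfl (u / INR q) in
  / (2 * PI * u / (INR q * rt) + Cmod (1 - eul ((INR beta - u) / INR q))) <=
  INR q / 4 * (resonance rt u (beta + q * w) + resonance rt u (beta + q * (w + 1)) +
    resonance rt u (beta + q * (w - 1)) + / INR (q - beta)).
Proof.
  intros Hb Hrt Hu w. pose proof PI_RGT_0 as Hpi. pose proof PI2_3_2 as Hpi3.
  assert (Hq0 : 0 < INR q) by (apply lt_0_INR; lia).
  assert (Huq : 0 < u / INR q) by (now apply Rdiv_lt_0_compat).
  destruct (nfl_spec (u / INR q) ltac:(lra)) as [Hw1 Hw2]. fold w in Hw1, Hw2.
  pose proof (resonance_pos rt u (beta + q * w) Hrt Hu) as R1.
  pose proof (resonance_pos rt u (beta + q * (w + 1)) Hrt Hu) as R2.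
  pose proof (resonance_pos rt u (beta + q * (w - 1)) Hrt Hu) as R3.
  assert (R4 : 0 < / INR (q - beta)) by (apply Rinv_0_lt_compat, lt_0_INR; lia).
  set (d := Cmod (1 - eul ((INR beta - u) / INR q))).
  set (del := 2 * PI * u / (INR q * rt)).
  assert (Hdel : 4 / INR q * (u / rt) <= del).
  { unfold del. replace (2 * PI * u / (INR q * rt)) with (2 * PI / INR q * (u / rt)) by (field; lra).
    apply Rmult_le_compat_r; [left; now apply Rdiv_lt_0_compat|].
    unfold Rdiv. apply Rmult_le_compat_r; [left; now apply Rinv_0_lt_compat|]. lra. }
  assert (Hurt : 0 < u / rt) by (now apply Rdiv_lt_0_compat).
  assert (Hgen : forall l : Z, Rabs (INR beta / INR q - u / INR q + IZR l) <= 1 / 2 ->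
    4 / INR q * Rabs (INR beta + INR q * IZR l - u) <= d).
  { intros l Hl. unfold d.
    replace (Cmod (1 - eul ((INR beta - u) / INR q))) with
      (Cmod (eul (INR beta / INR q - u / INR q + IZR l) - 1)).
    - eapply Rle_trans; [|apply Cmod_eul_sub_1_ge; exact Hl]. right.
      replace (INR beta + INR q * IZR l - u) with (INR q * (INR beta / INR q - u / INR q + IZR l))
        by (field; lra).
      rewrite Rabs_mult, (Rabs_pos_eq (INR q)) by lra. field. lra.
    - rewrite <- Cmod_opp. f_equal. rewrite eul_plus, eul_IZR.
      replace (INR beta / INR q - u / INR q) with ((INR beta - u) / INR q) by (field; lra). ring. }
  assert (Hfin : forall a, 0 < u / rt + a -> 4 / INR q * a <= d ->
    / (del + d) <= INR q / 4 * / (u / rt + a)).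
  { intros a Ha Had. replace (INR q / 4 * / (u / rt + a)) with (/ (4 / INR q * (u / rt + a)))
      by (revert Ha; generalize (u / rt + a); intros A HA; field; lra).
    apply Rinv_le_contravar.
    - apply Rmult_lt_0_compat; auto. apply Rdiv_lt_0_compat; lra.
    - rewrite Rmult_plus_distr_l. lra. }
  assert (Hbq : 0 < INR beta / INR q < 1).
  { split; [apply Rdiv_lt_0_compat; [apply lt_0_INR; lia|lra]|].
    apply Rmult_lt_reg_r with (INR q); auto.
    replace (INR beta / INR q * INR q) with (INR beta) by (field; lra).
    rewrite Rmult_1_l. apply lt_INR; lia. }
  set (f := u / INR q - INR w).
  assert (Hcase : forall k r, r = resonance rt u k ->
     4 / INR q * Rabs (INR k - u) <= d -> / (del + d) <= INR q / 4 * r).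
  { intros k r -> Hk. apply Hfin; auto. pose proof (Rabs_pos (INR k - u)). lra. }
  assert (Hgoal : forall r, / (del + d) <= INR q / 4 * r ->
    r <= resonance rt u (beta + q * w) + resonance rt u (beta + q * (w + 1)) +
    resonance rt u (beta + q * (w - 1)) + / INR (q - beta) ->
    / (del + d) <= INR q / 4 * (resonance rt u (beta + q * w) + resonance rt u (beta + q * (w + 1)) +
    resonance rt u (beta + q * (w - 1)) + / INR (q - beta))).
  { intros r H1 H2. eapply Rle_trans; [exact H1|]. apply Rmult_le_compat_l; lra. }
  destruct (Rle_dec (Rabs (INR beta / INR q - f)) (1 / 2)) as [Hm|Hm].
  - apply Hgoal with (resonance rt u (beta + q * w)); [|lra].
    apply (Hcase _ _ eq_refl). specialize (Hgen (Z.of_nat w)).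
    rewrite <- INR_IZR_INZ in Hgen. rewrite plus_INR, mult_INR. apply Hgen.
    replace (INR beta / INR q - u / INR q + INR w) with (INR beta / INR q - f) by (unfold f; ring).
    exact Hm.
  - destruct (Rle_dec 0 (INR beta / INR q - f)) as [Hs|Hs].
    + rewrite Rabs_pos_eq in Hm by auto.
      assert (Habs : Rabs (INR beta / INR q - u / INR q + IZR (Z.of_nat w - 1)) <= 1 / 2).
      { rewrite minus_IZR, <- INR_IZR_INZ. unfold f in *. apply Rabs_le. lra. }
      specialize (Hgen _ Habs). rewrite minus_IZR, <- INR_IZR_INZ in Hgen.
      (* For w = 0 the natural number [w - 1] is 0, whereas the lift meant here is beta - q < 0. Its
         distance from u > 0 is at least q - beta, whence the last summand. *)
      destruct w as [|w'] eqn:Ew.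
      * apply Hgoal with (/ INR (q - beta)); [|lra].
        assert (Hpos : 0 < INR (q - beta)) by (apply lt_0_INR; lia).
        apply Rle_trans with (INR q / 4 * / (u / rt + INR (q - beta))).
        -- apply Hfin; [lra|]. eapply Rle_trans; [|exact Hgen].
           apply Rmult_le_compat_l; [left; apply Rdiv_lt_0_compat; lra|].
           rewrite minus_INR by lia. simpl (INR 0). rewrite <- Rabs_Ropp.
           eapply Rle_trans; [|apply Rle_abs]. lra.
        -- apply Rmult_le_compat_l; [lra|]. apply Rinv_le_contravar; lra.
      * apply Hgoal with (resonance rt u (beta + q * (S w' - 1))); [|lra].
        apply (Hcase _ _ eq_refl). rewrite plus_INR, mult_INR.
        replace (INR (S w' - 1)) with (INR (S w') - 1) by (rewrite minus_INR by lia; simpl; ring).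
        exact Hgen.
    + rewrite Rabs_left in Hm by lra.
      apply Hgoal with (resonance rt u (beta + q * (w + 1))); [|lra].
      apply (Hcase _ _ eq_refl). specialize (Hgen (Z.of_nat w + 1)%Z).
      rewrite plus_IZR, <- INR_IZR_INZ in Hgen. rewrite plus_INR, mult_INR, plus_INR. simpl (INR 1).
      apply Hgen. unfold f in *. apply Rabs_le. lra.
Qed.

(** For each of the three shifts v, the lifts of b = 1, ..., q - 1 fill a window of distinct
    positive integers below q (w + 2) <= u + 2 q, so each window is part of the sum up to [Kmax].
    The negative lifts give a harmonic sum. *)
Lemma twisted_block_sum (q : nat) (x : R) (s : C) (L Kmax : nat) :
  (2 <= q)%nat -> 0 < x -> 0 <= Re s -> 2 <= Rabs (Im s) ->
  Cmod s <= 3 / 2 * Rabs (Im s) -> INR L <= x / sqrt (Rabs (Im s)) ->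
  let u := INR q * Rabs (Im s) / (2 * PI * x) in
  u + 2 * INR q <= INR Kmax ->
  rsum (fun i => Cmod (csum (twisted_power (ez q (- Z.of_nat (S i))) x s) L)) (q - 1) <=
    30 * Rpower x (- Re s) * (INR q / 4) *
      (3 * rsum (fun k => resonance (sqrt (Rabs (Im s))) u (S k)) Kmax + (1 + ln (INR q))).
Proof.
  intros Hq Hx Hs HT Hcs HL u HK. pose proof PI_RGT_0 as Hpi.
  set (rt := sqrt (Rabs (Im s))) in *.
  assert (Hq0 : 0 < INR q) by (apply lt_0_INR; lia).
  assert (Hrt : 0 < rt) by (apply sqrt_lt_R0; lra).
  assert (Hss : rt * rt = Rabs (Im s)) by (apply sqrt_sqrt; lra).
  assert (Hu : 0 < u).
  { unfold u. apply Rdiv_lt_0_compat; [apply Rmult_lt_0_compat; lra|].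
    apply Rmult_lt_0_compat; lra. }
  pose proof (Rpower_pos x (- Re s)) as Hp. set (P := Rpower x (- Re s)) in *.
  set (w := nfl (u / INR q)).
  set (F := fun beta : nat => resonance rt u (beta + q * w) + resonance rt u (beta + q * (w + 1)) +
    resonance rt u (beta + q * (w - 1)) + / INR (q - beta)).
  set (bt := fun i => if Rle_dec (Im s) 0 then S i else (q - S i)%nat).
  apply Rle_trans with (rsum (fun i => 30 * P * (INR q / 4) * F (bt i)) (q - 1)).
  { apply rsum_le. intros i Hi.
    eapply Rle_trans; [apply twisted_block; auto; lia|]. fold rt u P. fold (bt i).
    unfold Rdiv at 1. rewrite (Rmult_assoc (30 * P)). apply Rmult_le_compat_l; [lra|].
    replace (rt / x) with (2 * PI * u / (INR q * rt)).
    - apply resonance_lifts; auto. unfold bt. destruct Rle_dec; lia.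
    - unfold u. rewrite <- Hss. field. lra. }
  rewrite rsum_mult_l. apply Rmult_le_compat_l.
  { apply Rmult_le_pos; lra. }
  assert (Hbt : rsum (fun i => F (bt i)) (q - 1) = rsum (fun i => F (S i)) (q - 1)).
  { unfold bt. destruct (Rle_dec (Im s) 0); auto.
    rewrite rsum_rev. apply rsum_ext. intros i Hi. f_equal. lia. }
  rewrite Hbt. unfold F. rewrite !rsum_plus.
  assert (Hw : INR w <= u / INR q) by (apply nfl_spec; left; now apply Rdiv_lt_0_compat).
  assert (HwK : (q * (w + 2) <= Kmax)%nat).
  { apply INR_le. rewrite mult_INR, plus_INR. simpl (INR 2).
    assert (INR q * INR w <= u).
    { apply (Rmult_le_compat_l (INR q)) in Hw; [|lra].
      replace (INR q * (u / INR q)) with u in Hw by (field; lra). exact Hw. }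
    lra. }
  assert (Hwin : forall v, (v <= w + 1)%nat -> rsum (fun i => resonance rt u (S i + q * v)) (q - 1) <=
     rsum (fun k => resonance rt u (S k)) Kmax).
  { intros v Hv.
    rewrite (rsum_ext _ (fun i => resonance rt u (S (q * v + i)))) by (intros; f_equal; lia).
    apply (rsum_window (fun k => resonance rt u (S k))).
    - intros i. left. now apply resonance_pos.
    - apply Nat.le_trans with (q * (w + 2))%nat; auto. nia. }
  pose proof (Hwin w ltac:(lia)). pose proof (Hwin (w + 1)%nat ltac:(lia)).
  pose proof (Hwin (w - 1)%nat ltac:(lia)).
  assert (Hlast : rsum (fun i => / INR (q - S i)) (q - 1) <= 1 + ln (INR q)).
  { rewrite rsum_rev. rewrite (rsum_ext _ (fun i => / INR (S i))) by (intros; do 2 f_equal; lia).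
    eapply Rle_trans; [apply harmonic_le; lia|].
    apply Rplus_le_compat_l, ln_le; [apply lt_0_INR; lia|apply le_INR; lia]. }
  lra.
Qed.

Lemma resonance_le (rt u : R) (k : nat) : 1 <= rt -> 0 < u -> (1 <= k)%nat ->
  resonance rt u k <= 2 * rt / INR k.
Proof.
  intros Hrt Hu Hk. assert (Hk0 : 1 <= INR k) by (apply (le_INR 1); lia).
  unfold resonance. replace (2 * rt / INR k) with (/ (INR k / (2 * rt))) by (field; lra).
  apply Rinv_le_contravar; [apply Rdiv_lt_0_compat; lra|].
  assert (Hurt : 0 < u / rt) by (apply Rdiv_lt_0_compat; lra).
  destruct (Rle_dec (INR k / 2) u) as [H|H].
  - pose proof (Rabs_pos (INR k - u)).
    assert (INR k / (2 * rt) <= u / rt); [|lra].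
    replace (INR k / (2 * rt)) with (INR k / 2 / rt) by (field; lra).
    unfold Rdiv at 1 3. apply Rmult_le_compat_r; auto. left; apply Rinv_0_lt_compat; lra.
  - pose proof (Rle_abs (INR k - u)).
    assert (INR k / (2 * rt) <= INR k / 2); [|lra].
    unfold Rdiv. apply Rmult_le_compat_l; [lra|]. apply Rinv_le_contravar; lra.
Qed.

(** Here i is the number of blocks separating u from k. Bernoulli's inequality gives a ratio of at
    least 1 + i / (2 rt), hence a distance |k - u| of at least k times h i / (1 + h i) with h = 1 /
    (2 rt). *)
Lemma resonance_decay (rt u : R) (k i : nat) : 1 <= rt -> 0 < u -> (1 <= k)%nat ->
  (INR k * (1 + / (2 * rt)) ^ i <= u \/ u * (1 + / (2 * rt)) ^ i <= INR k) ->
  resonance rt u k <= (8 * rt * / INR (S i) + 1) * / INR k.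
Proof.
  intros Hrt Hu Hk Hcase. assert (Hk0 : 1 <= INR k) by (apply (le_INR 1); lia).
  assert (Hki : 0 < / INR k) by (apply Rinv_0_lt_compat; lra).
  destruct i as [|i].
  { eapply Rle_trans; [now apply resonance_le|]. simpl. rewrite Rinv_1.
    unfold Rdiv. apply Rmult_le_compat_r; lra. }
  set (h := / (2 * rt)) in *.
  assert (Hh : 0 < h) by (apply Rinv_0_lt_compat; lra).
  pose proof (poly (S i) h Hh) as HB. set (R := (1 + h) ^ S i) in *.
  assert (Hi : 1 <= INR (S i)) by (apply (le_INR 1); lia).
  set (n := INR (S i)) in *.
  assert (Hnh : 0 < n * h) by (apply Rmult_lt_0_compat; lra).
  assert (Habs : INR k * (n * h / (1 + n * h)) <= Rabs (INR k - u)).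
  { assert (H1 : INR k * (n * h / (1 + n * h)) = INR k - INR k * / (1 + n * h)) by (field; lra).
    destruct Hcase as [Hc|Hc].
    - apply Rle_trans with (u - INR k).
      + apply Rle_trans with (INR k * (n * h)); [|nra].
        apply Rmult_le_compat_l; [lra|].
        apply Rmult_le_reg_r with (1 + n * h); [lra|].
        replace (n * h / (1 + n * h) * (1 + n * h)) with (n * h) by (field; lra). nra.
      + rewrite <- Rabs_Ropp. eapply Rle_trans; [|apply Rle_abs]. lra.
    - apply Rle_trans with (INR k - u); [|apply Rle_abs].
      rewrite H1. assert (u <= INR k * / (1 + n * h)); [|lra].
      apply Rmult_le_reg_r with (1 + n * h); [lra|].
      rewrite Rmult_assoc, Rinv_l, Rmult_1_r by lra. nra. }
  assert (Hpos : 0 < INR k * (n * h / (1 + n * h))).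
  { apply Rmult_lt_0_compat; [lra|]. apply Rdiv_lt_0_compat; lra. }
  unfold resonance.
  assert (Hurt : 0 < u / rt) by (apply Rdiv_lt_0_compat; lra).
  apply Rle_trans with (/ (INR k * (n * h / (1 + n * h)))).
  { apply Rinv_le_contravar; lra. }
  replace (/ (INR k * (n * h / (1 + n * h)))) with ((2 * rt * / n + 1) * / INR k)
    by (unfold h; field; repeat split; lra).
  apply Rmult_le_compat_r; [lra|]. apply Rplus_le_compat_r.
  apply Rle_trans with (8 * rt * (/ 4 * / n)); [right; field; lra|].
  apply Rmult_le_compat_l; [lra|].
  rewrite <- Rinv_mult. apply Rinv_le_contravar.
  - rewrite S_INR. fold n. lra.
  - rewrite S_INR. fold n. lra.
Qed.

Lemma threshold_index (u : nat -> R) (k : R) (J : nat) :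
  (forall j, u (S j) <= u j) ->
  exists l, (l <= J)%nat /\ (forall j, (j < l)%nat -> k <= u j) /\
    (forall j, (l <= j < J)%nat -> u j <= k).
Proof.
  intros Hu. induction J as [|J [l [Hl [H1 H2]]]].
  - exists 0%nat. repeat split; intros; lia.
  - destruct (Nat.eq_dec l J) as [->|Hne].
    + destruct (Rle_dec k (u J)) as [Hk|Hk].
      * exists (S J). repeat split; [lia| |intros; lia].
        intros j Hj. destruct (Nat.eq_dec j J) as [->|]; auto. apply H1; lia.
      * exists J. repeat split; [lia|auto|]. intros j Hj. replace j with J by lia. lra.
    + exists l. repeat split; [lia|auto|]. intros j Hj.
      destruct (Nat.eq_dec j J) as [->|]; [|apply H2; lia].
      assert (Hp := H2 (J - 1)%nat ltac:(lia)). specialize (Hu (J - 1)%nat).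
      replace (S (J - 1)) with J in Hu by lia. lra.
Qed.

(** Number the terms outward from the place where the sequence crosses k. The i-th on either side is
    separated from k by a factor rho^i, and the two sides account for the 2. *)
Lemma sum_near_threshold (u : nat -> R) (f : R -> R) (g : nat -> R) (rho k : R) (J : nat) :
  1 <= rho -> (forall j, 0 < u j) -> (forall j, rho * u (S j) <= u j) -> (forall i, 0 <= g i) ->
  (forall i v, 0 < v -> k * rho ^ i <= v \/ v * rho ^ i <= k -> f v <= g i) ->
  rsum (fun j => f (u j)) J <= 2 * rsum g J.
Proof.
  intros Hrho Hpos Hstep Hg Hf.
  assert (Hmono : forall j, u (S j) <= u j).
  { intros j. specialize (Hstep j). specialize (Hpos (S j)). nra. }
  destruct (threshold_index u k J Hmono) as [l [Hl [H1 H2]]].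
  assert (Hpow : forall j i, u (j + i)%nat * rho ^ i <= u j).
  { intros j i. induction i as [|i IH]; [rewrite Nat.add_0_r; simpl; lra|].
    rewrite Nat.add_succ_r. simpl. eapply Rle_trans; [|exact IH].
    rewrite <- Rmult_assoc. apply Rmult_le_compat_r; [apply pow_le; lra|].
    rewrite Rmult_comm. apply Hstep. }
  assert (Hsub : forall n, (n <= J)%nat -> rsum g n <= rsum g J).
  { intros n Hn. apply (rsum_window g 0 n J); auto. }
  replace J with (l + (J - l))%nat at 1 by lia. rewrite rsum_add.
  assert (Ha : rsum (fun j => f (u j)) l <= rsum g J).
  { eapply Rle_trans; [|apply (Hsub l); auto]. rewrite rsum_rev. apply rsum_le. intros i Hi.
    apply Hf; auto. left.
    eapply Rle_trans; [|apply (Hpow (l - 1 - i)%nat i)].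
    apply Rmult_le_compat_r; [apply pow_le; lra|]. apply H1; lia. }
  assert (Hb : rsum (fun i => f (u (l + i)%nat)) (J - l) <= rsum g J).
  { eapply Rle_trans; [|apply (Hsub (J - l)%nat); lia]. apply rsum_le. intros i Hi.
    apply Hf; auto. right. eapply Rle_trans; [apply Hpow|]. apply H2; lia. }
  lra.
Qed.

(** Exchange the sums: for a fixed integer k the slopes pass k geometrically, so adding over the
    blocks costs (rt log J + J) / k, although a single block may be fully resonant. *)
Lemma resonance_double_sum (rt : R) (u : nat -> R) (J Kmax : nat) :
  1 <= rt -> (1 <= J)%nat -> (1 <= Kmax)%nat ->
  (forall j, 0 < u j) -> (forall j, (1 + / (2 * rt)) * u (S j) <= u j) ->
  rsum (fun j => rsum (fun k => resonance rt (u j) (S k)) Kmax) J <=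
    2 * (1 + ln (INR Kmax)) * (8 * rt * (1 + ln (INR J)) + INR J).
Proof.
  intros Hrt HJ HK Hpos Hstep. rewrite rsum_swap.
  assert (Hh : 0 < / (2 * rt)) by (apply Rinv_0_lt_compat; lra).
  assert (HA : 0 <= rsum (fun i => 8 * rt * / INR (S i) + 1) J).
  { apply rsum_nonneg. intros i _.
    assert (0 < / INR (S i)) by (apply Rinv_0_lt_compat, lt_0_INR; lia). nra. }
  apply Rle_trans with (rsum (fun k => 2 * rsum (fun i => 8 * rt * / INR (S i) + 1) J * / INR (S k)) Kmax).
  - apply rsum_le. intros k _.
    apply Rle_trans with (2 * rsum (fun i => (8 * rt * / INR (S i) + 1) * / INR (S k)) J).
    + apply (sum_near_threshold u (fun v => resonance rt v (S k)) _ (1 + / (2 * rt)) (INR (S k))); auto.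
      * lra.
      * intros i. assert (0 < / INR (S i)) by (apply Rinv_0_lt_compat, lt_0_INR; lia).
        assert (0 < / INR (S k)) by (apply Rinv_0_lt_compat, lt_0_INR; lia).
        apply Rmult_le_pos; nra.
      * intros i v Hv Hc. apply resonance_decay; auto; lia.
    + right.
      rewrite (rsum_ext _ (fun i => / INR (S k) * (8 * rt * / INR (S i) + 1))) by (intros; ring).
      rewrite rsum_mult_l. ring.
  - rewrite rsum_mult_l. rewrite rsum_plus, rsum_mult_l, rsum_const, Rmult_1_r in *.
    pose proof (harmonic_le Kmax HK) as H1. pose proof (harmonic_le J HJ) as H2.
    assert (H3 : 8 * rt * rsum (fun i => / INR (S i)) J + INR J <= 8 * rt * (1 + ln (INR J)) + INR J).
    { apply Rplus_le_compat_r, Rmult_le_compat_l; lra. }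
    assert (HlnK : 0 <= ln (INR Kmax)) by (rewrite <- ln_1; apply ln_le; [lra|now apply (le_INR 1)]).
    set (X := 8 * rt * rsum (fun i => / INR (S i)) J + INR J) in *.
    rewrite Rmult_assoc, (Rmult_comm X), <- Rmult_assoc.
    apply Rmult_le_compat; try lra.
    { apply Rmult_le_pos; [lra|].
      apply rsum_nonneg. intros i _. left; apply Rinv_0_lt_compat, lt_0_INR; lia. }
Qed.

(** * Character sums twisted by a power *)

Lemma chi_power_sum_add (chi : Z -> C) (n1 : Z) (x : R) (s : C) (K L : nat) :
  chi_power_sum chi n1 x s (K + L) =
  (chi_power_sum chi n1 x s K + chi_power_sum chi (n1 + Z.of_nat K) (x + INR K) s L)%C.
Proof.
  unfold chi_power_sum. rewrite csum_add. f_equal. apply csum_ext. intros i _.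
  f_equal; f_equal; [lia|rewrite plus_INR; ring].
Qed.

Lemma chi_power_sum_trivial (q : nat) (chi : Z -> C) (n1 : Z) (x : R) (s : C) (K : nat) :
  (0 < q)%nat -> dirichlet_character (Z.of_nat q) chi -> 0 < x -> 0 <= Re s ->
  Cmod (chi_power_sum chi n1 x s K) <= INR K * Rpower x (- Re s).
Proof.
  intros Hq Hchi Hx Hs. rewrite <- rsum_const. apply Cmod_csum_le_rsum. intros i _.
  rewrite Cmod_mult, Cmod_npow. pose proof (pos_INR i).
  rewrite <- (Rmult_1_l (Rpower x (- Re s))).
  apply Rmult_le_compat; [apply Cmod_ge_0|left; apply Rpower_pos|eapply dirichlet_Cmod_le_1; eauto|].
  apply Rpower_neg_antitone; lra.
Qed.

(* Endpoints of consecutive blocks of relative length about [/ rt]. *)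
Definition block_next (rt x : R) : R := x + INR (nfl (x / rt)).

(** From x >= rt on, a block is nonempty, and the floor of y is at least y / 2 for y >= 1. *)
Lemma block_next_ge (rt x : R) : 1 <= rt -> rt <= x -> (1 + / (2 * rt)) * x <= block_next rt x.
Proof.
  intros Hrt Hx. unfold block_next.
  assert (H1 : 1 <= x / rt).
  { apply Rmult_le_reg_r with rt; [lra|]. replace (x / rt * rt) with x by (field; lra). lra. }
  destruct (nfl_spec (x / rt) ltac:(lra)) as [Hl Hu].
  assert (Hn : 1 <= INR (nfl (x / rt))).
  { apply (le_INR 1). apply INR_lt. simpl (INR 0). lra. }
  replace ((1 + / (2 * rt)) * x) with (x + x / rt / 2) by (field; lra). lra.
Qed.

Lemma block_iter_ge (rt x : R) (j : nat) : 1 <= rt -> rt <= x ->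
  rt <= Nat.iter j (block_next rt) x /\ (1 + / (2 * rt)) ^ j * x <= Nat.iter j (block_next rt) x.
Proof.
  intros Hrt Hx. assert (Hh : 0 < / (2 * rt)) by (apply Rinv_0_lt_compat; lra).
  induction j as [|j [IH1 IH2]]; [simpl; lra|].
  change (Nat.iter (S j) (block_next rt) x) with (block_next rt (Nat.iter j (block_next rt) x)).
  pose proof (block_next_ge rt _ Hrt IH1) as H. simpl. split; nra.
Qed.

(** The bound is uniform in the number K of terms: a sum either ends inside the current block or
    passes to the next starting point, and after J blocks the start has reached c, where [Tl] takes
    over. *)
Lemma chi_power_sum_chain (chi : Z -> C) (s : C) (rt c x0 Tl : R) (B : R -> R) (J : nat) :
  1 <= rt -> rt <= x0 -> 0 <= Tl -> (forall y, 0 <= B y) ->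
  (forall y n1 L, x0 <= y -> INR L <= y / rt -> Cmod (chi_power_sum chi n1 y s L) <= B y) ->
  (forall y n1 K, x0 <= y -> c <= y -> Cmod (chi_power_sum chi n1 y s K) <= Tl) ->
  forall x n1 K, x0 <= x -> c <= Nat.iter J (block_next rt) x ->
  Cmod (chi_power_sum chi n1 x s K) <= rsum (fun j => B (Nat.iter j (block_next rt) x)) J + Tl.
Proof.
  intros Hrt Hx0 HTl HB Hblock Htail. induction J as [|J IH]; intros x n1 K Hx Hc.
  { simpl in *. rewrite Rplus_0_l. now apply Htail. }
  rewrite rsum_S_l.
  rewrite (rsum_ext _ (fun j => B (Nat.iter j (block_next rt) (block_next rt x))))
    by (intros; f_equal; apply Nat.iter_succ_r).
  rewrite Nat.iter_succ_r in Hc.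
  assert (Hxr : 0 <= x / rt) by (apply Rmult_le_pos; [lra|left; apply Rinv_0_lt_compat; lra]).
  destruct (nfl_spec (x / rt) Hxr) as [Hl _].
  assert (Hnx : x0 <= block_next rt x).
  { unfold block_next. pose proof (pos_INR (nfl (x / rt))). lra. }
  simpl (Nat.iter 0 _ _).
  destruct (le_lt_dec K (nfl (x / rt))) as [HK|HK].
  - assert (HKr : INR K <= x / rt) by (apply le_INR in HK; lra).
    pose proof (Hblock x n1 K Hx HKr).
    pose proof (rsum_nonneg (fun j => B (Nat.iter j (block_next rt) (block_next rt x))) J
      (fun i _ => HB _)). lra.
  - replace K with (nfl (x / rt) + (K - nfl (x / rt)))%nat by lia.
    rewrite chi_power_sum_add. eapply Rle_trans; [apply Cmod_triangle|].
    pose proof (Hblock x n1 (nfl (x / rt)) Hx Hl).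
    pose proof (IH (block_next rt x) (n1 + Z.of_nat (nfl (x / rt)))%Z (K - nfl (x / rt))%nat Hnx Hc) as H2.
    change (x + INR (nfl (x / rt))) with (block_next rt x). lra.
Qed.

Lemma ln_4_ge_1 : 1 <= ln 4.
Proof.
  rewrite <- (ln_exp 1). apply ln_le; [apply exp_pos|]. pose proof exp_le_3. lra.
Qed.

(** J is about ln N / ln (1 + 1/(2 rt)), and the denominator is at least 1 / (2 rt + 1); ln N >= 1
    absorbs the rounding. *)
Lemma block_count (rt N : R) : 1 <= rt -> 4 <= N ->
  exists J : nat, (1 <= J)%nat /\ N <= (1 + / (2 * rt)) ^ J /\ INR J <= 4 * rt * ln N.
Proof.
  intros Hrt HN. set (h := / (2 * rt)).
  assert (Hh : 0 < h) by (apply Rinv_0_lt_compat; lra).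
  assert (Hl : 1 <= ln N) by (eapply Rle_trans; [apply ln_4_ge_1|apply ln_le; lra]).
  set (lh := ln (1 + h)).
  assert (Hlh : / (2 * rt + 1) <= lh).
  { unfold lh. eapply Rle_trans; [|apply ln_ge_1_sub_inv; lra].
    right. unfold h. field. lra. }
  assert (Hlh0 : 0 < / (2 * rt + 1)) by (apply Rinv_0_lt_compat; lra).
  assert (Hinv : / lh <= 2 * rt + 1).
  { rewrite <- (Rinv_inv (2 * rt + 1)). now apply Rinv_le_contravar. }
  assert (Hq : 0 <= ln N / lh).
  { apply Rmult_le_pos; [lra|]. left; apply Rinv_0_lt_compat; lra. }
  destruct (nfl_spec (ln N / lh) Hq) as [H1 H2].
  exists (S (nfl (ln N / lh))). split; [lia|]. rewrite S_INR. split.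
  - rewrite <- Rpower_pow by lra. unfold Rpower. fold lh.
    rewrite <- (exp_ln N) at 1 by lra. apply exp_le_mono. rewrite S_INR.
    apply Rle_trans with (ln N / lh * lh); [right; field; lra|]. apply Rmult_le_compat_r; lra.
  - assert (H3 : ln N / lh <= ln N * (2 * rt + 1)) by (apply Rmult_le_compat_l; lra). nra.
Qed.

Lemma Cmod_le_Re_Im (s : C) : Cmod s <= Rabs (Re s) + Rabs (Im s).
Proof.
  replace s with (RtoC (Re s) + RtoC (Im s) * Ci)%C at 1
    by (destruct s; C_components).
  eapply Rle_trans; [apply Cmod_triangle|].
  rewrite Cmod_mult, Cmod_Ci, !Cmod_R. lra.
Qed.

(** Three stretches: about sqrt |t| terms estimated trivially, blocks until N is reached, then the
    tail bound. Throughout, later powers are replaced by the first one, m^{- Re s}. *)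
Theorem chi_power_sum_bound (q : nat) (chi : Z -> C) (s : C) (n1 : Z) (m : R) (K : nat) :
  (2 <= q)%nat -> primitive_character (Z.of_nat q) chi -> 0 <= Re s <= 1 -> 2 <= Rabs (Im s) ->
  1 <= m ->
  let N := INR q * Rabs (Im s) in
  Cmod (chi_power_sum chi n1 m s K) <= 5000 * (sqrt N * (ln N * ln N)) * Rpower m (- Re s).
Proof.
  intros Hq Hchi Hs HT Hm N.
  set (T := Rabs (Im s)) in *. set (rt := sqrt T). set (l := ln N).
  assert (Hq2 : 2 <= INR q) by (apply (le_INR 2); lia).
  pose proof PI_RGT_0 as Hpi. pose proof PI2_3_2 as Hpi3.
  assert (Hss : rt * rt = T) by (apply sqrt_sqrt; lra).
  assert (Hrt : 1 <= rt) by (rewrite <- sqrt_1; apply sqrt_le_1_alt; lra).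
  assert (Hsq : 1 <= sqrt (INR q)) by (rewrite <- sqrt_1; apply sqrt_le_1_alt; lra).
  assert (HN : 4 <= N) by (unfold N; nra).
  assert (HqN : 2 * INR q <= N) by (unfold N; nra).
  assert (HTN : 2 * T <= N) by (unfold N; nra).
  assert (HrtT : rt <= T) by nra.
  assert (Hl : 1 <= l) by (eapply Rle_trans; [apply ln_4_ge_1|apply ln_le; lra]).
  assert (HlN : l <= N) by (pose proof (ln_le_sub_1 N ltac:(lra)); unfold l; lra).
  assert (HsqN : sqrt N = sqrt (INR q) * rt) by (unfold N, rt; apply sqrt_mult; lra).
  assert (Hlq : 1 + ln (INR q) <= 2 * l).
  { assert (ln (INR q) <= l) by (apply ln_le; lra). lra. }
  assert (Hcs : Cmod s <= 3 / 2 * T).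
  { eapply Rle_trans; [apply Cmod_le_Re_Im|]. fold T. rewrite Rabs_pos_eq; lra. }
  set (P := Rpower m (- Re s)). assert (HP : 0 < P) by apply Rpower_pos.
  assert (HPy : forall y, m <= y -> Rpower y (- Re s) <= P)
    by (intros; apply Rpower_neg_antitone; lra).
  destruct (block_count rt N Hrt HN) as [J [HJ1 [HJN HJ]]]. fold l in HJ.
  destruct (nfl_spec (N + 2 * INR q) ltac:(lra)) as [Hk1 Hk2].
  set (Kmax := S (nfl (N + 2 * INR q))).
  assert (HKmax : N + 2 * INR q <= INR Kmax <= 3 * N).
  { unfold Kmax. rewrite S_INR. lra. }
  (* Skipping [a0] terms ensures x0 >= rt, so that all blocks are nonempty; the skipped terms cost
     at most 2 rt P. *)
  set (a0 := S (nfl rt)).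
  destruct (nfl_spec rt ltac:(lra)) as [Ha1 Ha2].
  assert (Ha0 : rt <= INR a0 <= 2 * rt) by (unfold a0; rewrite S_INR; lra).
  set (x0 := m + INR a0).
  set (u := fun y => INR q * T / (2 * PI * y)).
  set (B := fun y => 15 / 2 * sqrt (INR q) * P *
    (3 * rsum (fun k => resonance rt (u y) (S k)) Kmax + (1 + ln (INR q)))).
  (* [chi_power_sum_chain] wants a nonnegative bound at every real argument, including those where
     [u y] has no meaning; the absolute value changes nothing for y >= rt. *)
  set (B' := fun y => Rabs (B y)).
  assert (HBpos : forall y, rt <= y -> 0 <= B y).
  { intros y Hy. unfold B.
    assert (Hu : 0 < u y).
    { unfold u. apply Rdiv_lt_0_compat; [nra|]. apply Rmult_lt_0_compat; lra. }
    pose proof (rsum_nonneg (fun k => resonance rt (u y) (S k)) Kmax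
      (fun k _ => Rlt_le _ _ (resonance_pos rt (u y) (S k) ltac:(lra) Hu))) as H1.
    assert (0 <= ln (INR q)) by (rewrite <- ln_1; apply ln_le; lra).
    apply Rmult_le_pos; [|lra]. apply Rmult_le_pos; [|lra]. lra. }
  assert (Hblock : forall y n1 L, x0 <= y -> INR L <= y / rt ->
    Cmod (chi_power_sum chi n1 y s L) <= B' y).
  { intros y n2 L Hy HL. unfold x0 in Hy. unfold B'. rewrite Rabs_pos_eq by (apply HBpos; lra).
    assert (Huy : u y <= N).
    { unfold u. fold N. apply Rmult_le_reg_r with (2 * PI * y); [apply Rmult_lt_0_compat; lra|].
      replace (N / (2 * PI * y) * (2 * PI * y)) with N by (field; lra).
      rewrite <- (Rmult_1_r N) at 1. apply Rmult_le_compat_l; nra. }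
    eapply Rle_trans.
    { apply (Cmod_chi_power_sum_le q chi Hq Hchi n2 y s L
        (fun i => Cmod (csum (twisted_power (ez q (- Z.of_nat (S i))) y s) L))). intros; lra. }
    pose proof (twisted_block_sum q y s L Kmax Hq ltac:(lra) ltac:(lra) HT Hcs HL ltac:(fold T; fold (u y); lra)) as Hsum.
    fold T rt in Hsum. fold (u y) in Hsum.
    set (Z := 3 * rsum (fun k => resonance rt (u y) (S k)) Kmax + (1 + ln (INR q))) in *.
    assert (HZ : 0 <= Z).
    { pose proof (HBpos y ltac:(lra)) as H0. unfold B in H0. fold Z in H0.
      apply Rmult_le_reg_l with (15 / 2 * sqrt (INR q) * P); [|lra].
      apply Rmult_lt_0_compat; lra. }
    apply Rmult_le_reg_r with (sqrt (INR q)); [lra|].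
    unfold Rdiv at 1. rewrite Rmult_assoc, Rinv_l, Rmult_1_r by lra.
    eapply Rle_trans; [exact Hsum|]. unfold B. fold Z.
    replace (15 / 2 * sqrt (INR q) * P * Z * sqrt (INR q)) with
      (15 / 2 * P * Z * (sqrt (INR q) * sqrt (INR q))) by ring.
    rewrite sqrt_sqrt by lra.
    replace (30 * Rpower y (- Re s) * (INR q / 4) * Z) with
      (Rpower y (- Re s) * (15 / 2 * Z * INR q)) by field.
    replace (15 / 2 * P * Z * INR q) with (P * (15 / 2 * Z * INR q)) by ring.
    apply Rmult_le_compat_r; [|apply HPy; lra]. apply Rmult_le_pos; [|lra]. lra. }
  set (Tl := 6 * sqrt (INR q) * l * P).
  assert (HTl : 0 <= Tl) by (unfold Tl; repeat apply Rmult_le_pos; lra).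
  assert (Htail : forall y n1 K, x0 <= y -> N <= y -> Cmod (chi_power_sum chi n1 y s K) <= Tl).
  { intros y n2 K' Hy HNy. unfold x0 in Hy.
    eapply Rle_trans; [apply (chi_power_sum_tail q chi Hq Hchi n2 y s K'); try lra|].
    - apply Rle_trans with N; auto. unfold N. nra.
    - unfold Tl. replace (6 * sqrt (INR q) * l * P) with (3 * sqrt (INR q) * (2 * l) * P) by ring.
      pose proof (Rpower_pos y (- Re s)).
      assert (0 <= ln (INR q)) by (rewrite <- ln_1; apply ln_le; lra).
      apply Rmult_le_compat; [|lra| |apply HPy; lra].
      + repeat apply Rmult_le_pos; lra.
      + apply Rmult_le_compat_l; lra. }
  assert (Hx0 : rt <= x0) by (unfold x0; lra).
  assert (Hmain : forall n2 K', Cmod (chi_power_sum chi n2 x0 s K') <=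
    4920 * (sqrt (INR q) * rt * (l * l)) * P + Tl).
  { intros n2 K'.
    eapply Rle_trans; [apply (chi_power_sum_chain chi s rt N x0 Tl B' J); auto; try lra|].
    - intros; apply Rabs_pos.
    - eapply Rle_trans; [exact HJN|]. destruct (block_iter_ge rt x0 J Hrt Hx0) as [_ H].
      eapply Rle_trans; [|exact H]. rewrite <- (Rmult_1_r ((1 + / (2 * rt)) ^ J)) at 1.
      apply Rmult_le_compat_l; [|unfold x0; lra]. apply pow_le.
      assert (0 < / (2 * rt)) by (apply Rinv_0_lt_compat; lra). lra.
    - apply Rplus_le_compat_r.
      set (X := fun j => Nat.iter j (block_next rt) x0).
      assert (HX : forall j, rt <= X j) by (intros j; now apply block_iter_ge).
      rewrite (rsum_ext _ (fun j => B (X j)))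
        by (intros j _; unfold B'; fold (X j); apply Rabs_pos_eq, HBpos, HX).
      unfold B. rewrite rsum_mult_l, rsum_plus, rsum_mult_l, rsum_const.
      assert (Hres : rsum (fun j => rsum (fun k => resonance rt (u (X j)) (S k)) Kmax) J <=
        2 * (1 + ln (INR Kmax)) * (8 * rt * (1 + ln (INR J)) + INR J)).
      { apply (resonance_double_sum rt (fun j => u (X j))); auto; [unfold Kmax; lia| |].
        - intros j. specialize (HX j). unfold u.
          apply Rdiv_lt_0_compat; [nra|]. apply Rmult_lt_0_compat; lra.
        - intros j. unfold u. pose proof (HX j). pose proof (HX (S j)).
          pose proof (block_next_ge rt (X j) Hrt (HX j)) as Hn.
          change (block_next rt (X j)) with (X (S j)) in Hn.
          apply Rmult_le_reg_r with (X (S j)); [lra|].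
          replace ((1 + / (2 * rt)) * (INR q * T / (2 * PI * X (S j))) * X (S j)) with
            ((1 + / (2 * rt)) * X j * (INR q * T / (2 * PI * X j))) by (field; lra).
          rewrite (Rmult_comm _ (X (S j))). apply Rmult_le_compat_r; auto.
          left. apply Rdiv_lt_0_compat; [nra|]. apply Rmult_lt_0_compat; lra. }
      assert (HlnK : 1 + ln (INR Kmax) <= 3 * l).
      { assert (ln (INR Kmax) <= ln (3 * N)) by (apply ln_le; lra).
        rewrite ln_mult in H by lra. fold l in H.
        assert (ln 3 <= l) by (apply ln_le; lra). lra. }
      assert (HJ0 : 1 <= INR J) by now apply (le_INR 1).
      assert (HlnJ : 1 + ln (INR J) <= 4 * l).
      { assert (HJN3 : INR J <= N * (N * N)).
        { eapply Rle_trans; [exact HJ|].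
          apply Rle_trans with (N * N * N); [|right; ring].
          apply Rmult_le_compat; try lra; nra. }
        apply ln_le in HJN3; [|lra].
        rewrite !ln_mult in HJN3 by nra. fold l in HJN3. lra. }
      assert (HlnJ0 : 0 <= ln (INR J)) by (rewrite <- ln_1; apply ln_le; lra).
      assert (HlnK0 : 0 <= ln (INR Kmax)) by (rewrite <- ln_1; apply ln_le; lra).
      assert (Hlq0 : 0 <= ln (INR q)) by (rewrite <- ln_1; apply ln_le; lra).
      assert (Hrl : 0 <= rt * l) by (apply Rmult_le_pos; lra).
      assert (H2 : 2 * (1 + ln (INR Kmax)) * (8 * rt * (1 + ln (INR J)) + INR J) <=
        216 * (rt * (l * l))).
      { apply Rle_trans with (2 * (3 * l) * (8 * rt * (4 * l) + 4 * rt * l)); [|right; ring].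
        apply Rmult_le_compat; try lra.
        - assert (0 <= 8 * rt * (1 + ln (INR J))) by (apply Rmult_le_pos; lra). lra.
        - apply Rplus_le_compat; [|lra]. apply Rmult_le_compat_l; lra. }
      assert (H3 : INR J * (1 + ln (INR q)) <= 8 * (rt * (l * l))).
      { apply Rle_trans with (4 * rt * l * (2 * l)); [|right; ring].
        apply Rmult_le_compat; lra. }
      (* 656 = 3 * 216 + 8, and 15/2 * 656 = 4920; the tail adds 6 and the skipped terms 2, which
         stays below 5000. *)
      apply Rle_trans with (15 / 2 * sqrt (INR q) * P * (656 * (rt * (l * l)))); [|right; field].
      apply Rmult_le_compat_l; [|lra]. apply Rmult_le_pos; lra. }
  rewrite HsqN.
  assert (Hll : 1 <= l * l) by nra.
  assert (HsP : 0 < sqrt (INR q) * rt * P) by (apply Rmult_lt_0_compat; nra).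
  assert (HTl2 : Tl <= 6 * (sqrt (INR q) * rt * (l * l) * P)).
  { unfold Tl. replace (6 * sqrt (INR q) * l * P) with (6 * (sqrt (INR q) * l * P)) by ring.
    apply Rmult_le_compat_l; [lra|]. apply Rmult_le_compat_r; [lra|].
    rewrite Rmult_assoc. apply Rmult_le_compat_l; [lra|]. nra. }
  assert (Hfirst : INR a0 * P <= 2 * (sqrt (INR q) * rt * (l * l) * P)).
  { rewrite <- Rmult_assoc. apply Rmult_le_compat_r; [lra|].
    apply Rle_trans with (2 * rt); [lra|]. apply Rmult_le_compat_l; [lra|].
    rewrite Rmult_assoc. rewrite <- (Rmult_1_l rt) at 1. apply Rmult_le_compat; try lra. nra. }
  assert (Hpos : 0 <= sqrt (INR q) * rt * (l * l) * P).
  { apply Rmult_le_pos; [|lra]. apply Rmult_le_pos; nra. }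
  pose proof (chi_power_sum_trivial q chi n1 m s) as Htriv.
  destruct (le_lt_dec K a0) as [HK|HK].
  - eapply Rle_trans; [apply Htriv; [lia|apply Hchi|lra|lra]|]. fold P.
    apply Rle_trans with (INR a0 * P); [|lra].
    apply Rmult_le_compat_r; [lra|]. now apply le_INR.
  - replace K with (a0 + (K - a0))%nat by lia. rewrite chi_power_sum_add.
    eapply Rle_trans; [apply Cmod_triangle|].
    pose proof (Htriv a0 ltac:(lia) (proj1 Hchi) ltac:(lra) ltac:(lra)) as H1. fold P in H1.
    pose proof (Hmain (n1 + Z.of_nat a0)%Z (K - a0)%nat) as H2. fold x0. lra.
Qed.

(** * Analytic continuation of the double series *)

(** The differential is linear over [C], so in the direction (1, 1) it is multiplication by its
    value there; [eps / 2] absorbs the sqrt 2 of the product norm. *)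
Lemma entire2_diagonal (L : C * C -> C) (s1 s2 : C) : entire2 L ->
  C_differentiable (fun z => L (s1 + z, s2 + z)%C).
Proof.
  intros HL z0. destruct (HL (s1 + z0, s2 + z0)%C) as [l [Hlin Hl]].
  exists (l (RtoC 1, RtoC 1)). apply is_C_derive_spec. intros eps Heps.
  specialize (Hl _ (fun P HP => HP) (mkposreal (eps / 2) ltac:(lra))).
  destruct Hl as [d Hd]. exists d. split; [apply cond_pos|]. intros z Hz.
  assert (Hz' : forall a : C, (a + z - (a + z0) = z - z0)%C) by (intros; ring).
  assert (Hball : forall a : C, ball (M := C_UniformSpace) (a + z0)%C d (a + z)%C).
  { intros a. pose proof (Rmax_Cmod (z - z0)%C) as Hm.
    split.
    - change (Rabs (Re (a + z)%C - Re (a + z0)%C) < d).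
      replace (Re (a + z)%C - Re (a + z0)%C) with (fst (z - z0)%C) by (destruct a, z, z0; simpl; ring).
      eapply Rle_lt_trans; [|exact Hz]. eapply Rle_trans; [|exact Hm]. apply Rmax_l.
    - change (Rabs (Im (a + z)%C - Im (a + z0)%C) < d).
      replace (Im (a + z)%C - Im (a + z0)%C) with (snd (z - z0)%C) by (destruct a, z, z0; simpl; ring).
      eapply Rle_lt_trans; [|exact Hz]. eapply Rle_trans; [|exact Hm]. apply Rmax_r. }
  specialize (Hd (s1 + z, s2 + z)%C (conj (Hball s1) (Hball s2))).
  change (Cmod (L (s1 + z, s2 + z)%C - L (s1 + z0, s2 + z0)%C -
      l (s1 + z - (s1 + z0), s2 + z - (s2 + z0))%C) <=
    eps / 2 * sqrt (Cmod (s1 + z - (s1 + z0)) ^ 2 + Cmod (s2 + z - (s2 + z0)) ^ 2)) in Hd.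
  rewrite !Hz' in Hd.
  assert (Hlz : l (z - z0, z - z0)%C = (l (RtoC 1, RtoC 1) * (z - z0))%C).
  { rewrite <- (Cmult_1_r (z - z0)) at 1 2.
    change (((z - z0) * 1, (z - z0) * 1)%C) with
      (scal (V := prod_NormedModule C_AbsRing C_NormedModule C_NormedModule) (z - z0)%C (RtoC 1, RtoC 1)).
    rewrite (linear_scal l Hlin). apply Cmult_comm. }
  rewrite Hlz in Hd. eapply Rle_trans; [exact Hd|].
  pose proof (Cmod_ge_0 (z - z0)) as H0.
  assert (Hsq : sqrt (Cmod (z - z0) ^ 2 + Cmod (z - z0) ^ 2) <= 2 * Cmod (z - z0)).
  { rewrite <- (sqrt_Rsqr (2 * Cmod (z - z0))) by lra. apply sqrt_le_1_alt. unfold Rsqr. nra. }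
  nra.
Qed.

Lemma csum_sum_n (a : nat -> C) (n : nat) :
  csum a (S n) = sum_n (G := C_NormedModule) a n.
Proof.
  induction n as [|n IH].
  - rewrite sum_O. simpl. ring.
  - rewrite sum_Sn. change (csum a (S (S n))) with (csum a (S n) + a (S n))%C. now rewrite IH.
Qed.

Lemma is_series_csum (a : nat -> C) (l : C) :
  is_series (K := C_AbsRing) (V := C_NormedModule) a l ->
  forall eps, 0 < eps -> exists N, forall n, (N <= n)%nat -> Cmod (csum a n - l) < eps.
Proof.
  intros H eps Heps.
  destruct (proj1 (filterlim_locally_ball_norm (K := C_AbsRing) (U := C_NormedModule) _ _) H
    (mkposreal eps Heps)) as [N HN].
  exists (S N). intros [|n] Hn; [lia|]. rewrite csum_sum_n. apply (HN n). lia.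
Qed.

(** At s = 0 the twisted sum is a plain character sum, and the tail estimate is available from x =
    1. *)
Lemma Polya_Vinogradov (q : nat) (chi : Z -> C) : (2 <= q)%nat ->
  primitive_character (Z.of_nat q) chi -> forall (a : Z) (n : nat),
  Cmod (csum (fun i => chi (a + Z.of_nat i)%Z) n) <= 3 * (sqrt (INR q) * (1 + ln (INR q))).
Proof.
  intros Hq Hchi a n. pose proof (chi_power_sum_tail q chi Hq Hchi a 1 0%C n) as H.
  simpl Re in H. rewrite Cmod_0, Ropp_0, Rpower_O in H by lra.
  specialize (H ltac:(lra) ltac:(lra) ltac:(lra)).
  unfold chi_power_sum in H.
  rewrite (csum_ext _ (fun i => chi (a + Z.of_nat i)%Z)) in H; [lra|].
  intros i _. unfold npow. rewrite Cmult_0_l.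
  replace (Copp 0) with (RtoC 0) by ring. rewrite Cexp_0. ring.
Qed.

(** * Partial summation against a power *)

Lemma Rpower_step (x sg : R) : 0 < x ->
  Rpower (x + 1) (- sg) = Rpower x (- sg) * exp (- (sg * log_step x)).
Proof.
  intros Hx. unfold Rpower. rewrite log_step_eq by auto. rewrite <- exp_plus. f_equal. ring.
Qed.

Lemma one_sub_exp_ge (v : R) : 0 <= v -> v / (1 + v) <= 1 - exp (- v).
Proof.
  intros Hv. rewrite exp_Ropp. pose proof (exp_ineq1_le v) as H.
  assert (/ exp v <= / (1 + v)) by (apply Rinv_le_contravar; lra).
  replace (v / (1 + v)) with (1 - / (1 + v)) by (field; lra). lra.
Qed.

(** Discrete form of x^{-sg-1} <= - (x^{-sg})' / sg: the right side is a difference of consecutive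
    values, so sums telescope. It rests on 1 - exp(-v) >= v / (1 + v) at v = sg [log_step x] <=
    sg. *)
Lemma log_step_le_drop (x sg : R) : 1 <= x -> 0 < sg ->
  Rpower x (- sg) * log_step x <= (1 + sg) / sg * (Rpower x (- sg) - Rpower (x + 1) (- sg)).
Proof.
  intros Hx Hsg. rewrite Rpower_step by lra. pose proof (Rpower_pos x (- sg)) as Hp.
  set (l := log_step x).
  assert (Hl0 : 0 <= l) by (apply log_step_nonneg; lra).
  assert (Hl1 : l <= 1).
  { eapply Rle_trans; [apply log_step_le; lra|]. rewrite <- Rinv_1. apply Rinv_le_contravar; lra. }
  assert (Hsl : 0 <= sg * l) by (apply Rmult_le_pos; lra).
  pose proof (one_sub_exp_ge (sg * l) Hsl) as H.
  assert (H2 : sg * l / (1 + sg) <= sg * l / (1 + sg * l)).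
  { unfold Rdiv. apply Rmult_le_compat_l; auto. apply Rinv_le_contravar; nra. }
  assert (H3 : l <= (1 + sg) / sg * (1 - exp (- (sg * l)))).
  { apply Rle_trans with ((1 + sg) / sg * (sg * l / (1 + sg))); [right; field; lra|].
    apply Rmult_le_compat_l; [|lra]. left. apply Rdiv_lt_0_compat; lra. }
  replace ((1 + sg) / sg * (Rpower x (- sg) - Rpower x (- sg) * exp (- (sg * l)))) with
    (Rpower x (- sg) * ((1 + sg) / sg * (1 - exp (- (sg * l))))) by ring.
  apply Rmult_le_compat_l; lra.
Qed.

Lemma npow_step (x : R) (s : C) : 0 < x ->
  npow (x + 1) s = (npow x s * Cexp (- (s * RtoC (log_step x))))%C.
Proof.
  intros Hx. unfold npow. rewrite log_step_eq by auto. rewrite <- Cexp_plus. f_equal.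
  rewrite RtoC_plus. ring.
Qed.

Lemma npow_increment (x : R) (s : C) : 1 <= x -> 0 < Re s ->
  Cmod (npow (x + 1) s - npow x s) <=
    Cmod s * ((1 + Re s) / Re s) * (Rpower x (- Re s) - Rpower (x + 1) (- Re s)).
Proof.
  intros Hx Hs. rewrite npow_step by lra.
  replace (npow x s * Cexp (- (s * RtoC (log_step x))) - npow x s)%C with
    (npow x s * (Cexp (- (s * RtoC (log_step x))) - Cexp (- (s * RtoC 0))))%C.
  2:{ replace (Cexp (- (s * RtoC 0))) with (RtoC 1); [ring|].
      rewrite <- Cexp_0. f_equal. ring. }
  rewrite Cmod_mult, Cmod_npow.
  pose proof (log_step_nonneg x ltac:(lra)) as Hl.
  pose proof (Cmod_Cexp_neg_sub_le s (log_step x) 0 ltac:(lra) ltac:(lra)) as H.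
  rewrite Rminus_0_r in H.
  apply Rle_trans with (Rpower x (- Re s) * (Cmod s * log_step x)).
  - apply Rmult_le_compat_l; [left; apply Rpower_pos|exact H].
  - replace (Rpower x (- Re s) * (Cmod s * log_step x)) with
      (Cmod s * (Rpower x (- Re s) * log_step x)) by ring.
    rewrite (Rmult_assoc (Cmod s)). apply Rmult_le_compat_l; [apply Cmod_ge_0|].
    now apply log_step_le_drop.
Qed.

Lemma rsum_Rpower_drop (x a : R) (n : nat) :
  rsum (fun i => Rpower (x + INR i) a - Rpower (x + INR i + 1) a) n =
  Rpower x a - Rpower (x + INR n) a.
Proof.
  induction n as [|n IH]; [simpl; rewrite Rplus_0_r; ring|].
  change (rsum ?f (S n)) with (rsum f n + f n). rewrite IH, S_INR, <- Rplus_assoc. ring.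
Qed.

(** Abel summation; the increments of x^{-s} are dominated by the telescoping drops of x^{- Re s},
    so the bound does not depend on n. *)
Lemma Dirichlet_test (c : nat -> C) (V x : R) (s : C) (n : nat) :
  (forall k, Cmod (csum c k) <= V) -> 1 <= x -> 0 < Re s ->
  Cmod (csum (fun i => c i * npow (x + INR i) s)%C n) <=
    V * (1 + Cmod s * ((1 + Re s) / Re s)) * Rpower x (- Re s).
Proof.
  intros HV Hx Hs.
  assert (HV0 : 0 <= V) by (eapply Rle_trans; [apply Cmod_ge_0|apply (HV 0%nat)]).
  assert (HAbel : csum (fun i => c i * npow (x + INR i) s)%C n =
    (csum c n * npow (x + INR n) s -
     csum (fun i => csum c (S i) * (npow (x + INR i + 1) s - npow (x + INR i) s)) n)%C).
  { induction n as [|n IH]; [simpl; ring|].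
    change (csum ?f (S n)) with (csum f n + f n)%C. cbv beta.
    rewrite IH, S_INR, <- Rplus_assoc.
    change (csum c (S n)) with (csum c n + c n)%C. ring. }
  rewrite HAbel. unfold Cminus at 1.
  eapply Rle_trans; [apply Cmod_triangle|]. rewrite Cmod_opp, Cmod_mult, Cmod_npow.
  set (k := Cmod s * ((1 + Re s) / Re s)).
  assert (Hk : 0 <= k).
  { unfold k. apply Rmult_le_pos; [apply Cmod_ge_0|]. left. apply Rdiv_lt_0_compat; lra. }
  assert (H2 : Cmod (csum (fun i => csum c (S i) * (npow (x + INR i + 1) s - npow (x + INR i) s))%C n)
    <= V * k * (Rpower x (- Re s) - Rpower (x + INR n) (- Re s))).
  { rewrite <- rsum_Rpower_drop, <- rsum_mult_l. apply Cmod_csum_le_rsum. intros i _.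
    rewrite Cmod_mult, Rmult_assoc. pose proof (pos_INR i).
    apply Rmult_le_compat; try apply Cmod_ge_0; [apply HV|]. apply npow_increment; lra. }
  pose proof (Rpower_pos (x + INR n) (- Re s)) as Hp.
  assert (H1 : Cmod (csum c n) * Rpower (x + INR n) (- Re s) <= V * Rpower (x + INR n) (- Re s)).
  { apply Rmult_le_compat_r; [lra|apply HV]. }
  assert (H3 : Rpower (x + INR n) (- Re s) <= Rpower x (- Re s)).
  { apply Rpower_neg_antitone; [lra|]. pose proof (pos_INR n). lra. }
  assert (H4 : V * Rpower (x + INR n) (- Re s) <= V * Rpower x (- Re s))
    by (apply Rmult_le_compat_l; lra).
  assert (H5 : 0 <= V * k * Rpower (x + INR n) (- Re s)).
  { apply Rmult_le_pos; [|lra]. now apply Rmult_le_pos. }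
  lra.
Qed.

Lemma rsum_inv_Rpower (x sg : R) (n : nat) : 1 <= x -> 0 < sg ->
  rsum (fun i => / (x + INR i) * Rpower (x + INR i) (- sg)) n <=
    2 * ((1 + sg) / sg) * Rpower x (- sg).
Proof.
  intros Hx Hsg. set (k := (1 + sg) / sg).
  assert (Hk : 0 < k) by (apply Rdiv_lt_0_compat; lra).
  apply Rle_trans with (rsum (fun i => 2 * k *
    (Rpower (x + INR i) (- sg) - Rpower (x + INR i + 1) (- sg))) n).
  - apply rsum_le. intros i _. pose proof (pos_INR i). set (y := x + INR i).
    assert (Hy : 1 <= y) by (unfold y; lra).
    pose proof (log_step_le_drop y sg Hy Hsg) as H1. fold k in H1.
    assert (H2 : / (y + 1) <= log_step y).
    { unfold log_step. assert (0 < / y) by (apply Rinv_0_lt_compat; lra).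
      eapply Rle_trans; [|apply ln_ge_1_sub_inv; lra]. right. field. lra. }
    assert (H3 : / y <= 2 * / (y + 1)).
    { apply Rmult_le_reg_r with (y * (y + 1)); [nra|].
      replace (/ y * (y * (y + 1))) with (y + 1) by (field; lra).
      replace (2 * / (y + 1) * (y * (y + 1))) with (2 * y) by (field; lra). lra. }
    pose proof (Rpower_pos y (- sg)). nra.
  - rewrite rsum_mult_l, rsum_Rpower_drop. apply Rmult_le_compat_l; [lra|].
    pose proof (Rpower_pos (x + INR n) (- sg)). lra.
Qed.

(** * Truncated rows of the double series *)

Section DoubleSum.

Variables (q : nat) (chi1 chi2 : Z -> C).
Hypothesis Hq : (2 <= q)%nat.
Hypothesis Hchi1 : primitive_character (Z.of_nat q) chi1.
Hypothesis Hchi2 : primitive_character (Z.of_nat q) chi2.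

(** Row m cut after n = K: the sum has [S K] terms starting from n = 0, and that first term vanishes
    because chi2(0) = 0. *)
Definition row_term (s1 s2 : C) (K m : nat) : C :=
  (chi1 (Z.of_nat m) * npow (INR m) s1 * chi_power_sum chi2 0 (INR m) s2 (S K))%C.

Let V := sqrt (INR q) * (1 + ln (INR q)).

Lemma sqrt_log_pos : 0 < V.
Proof.
  unfold V. assert (2 <= INR q) by (apply (le_INR 2); lia).
  apply Rmult_lt_0_compat; [apply sqrt_lt_R0; lra|].
  assert (0 <= ln (INR q)) by (rewrite <- ln_1; apply ln_le; lra). lra.
Qed.

(* Large [m]: the main term of each row is [L(0, chi2) m^{-s2}], whose sum over [m]
   is controlled by the Dirichlet test. *)
Lemma row_tail (s1 s2 : C) (M n K : nat) :
  0 <= Re s2 -> 0 < Re s1 + Re s2 -> (1 <= M)%nat -> INR q * Cmod s2 / 2 <= INR M ->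
  let tau := Re s1 + Re s2 in
  Cmod (csum (fun i => row_term s1 s2 K (M + i)) n) <=
    V * rsum (fun i => Rpower (INR (M + i)) (- Re s1) * Rpower (INR (M + i) + INR (S K)) (- Re s2)) n +
    2 * V * (INR q * Cmod s2) * ((1 + tau) / tau) * Rpower (INR M) (- tau) +
    3 * V * Cmod (L_at_0 q chi2) * (1 + Cmod (s1 + s2) * ((1 + tau) / tau)) * Rpower (INR M) (- tau).
Proof.
  intros Hs2 Htau HM HqM tau. pose proof sqrt_log_pos as HV.
  assert (HM1 : 1 <= INR M) by (apply (le_INR 1); lia).
  set (c := L_at_0 q chi2).
  assert (Hre : Re (s1 + s2) = tau) by (destruct s1, s2; reflexivity).
  assert (Hadd : forall m, (npow m s1 * npow m s2)%C = npow m (s1 + s2)).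
  { intros m. unfold npow. rewrite <- Cexp_plus. f_equal. ring. }
  rewrite (csum_ext _ (fun i => chi1 (Z.of_nat (M + i)) * npow (INR (M + i)) s1 *
      (chi_power_sum chi2 0 (INR (M + i)) s2 (S K) - c * npow (INR (M + i)) s2) +
      c * (chi1 (Z.of_nat M + Z.of_nat i)%Z * npow (INR M + INR i) (s1 + s2)))%C).
  2:{ intros i _. unfold row_term. rewrite <- Hadd, <- plus_INR, <- Nat2Z.inj_add. ring. }
  rewrite csum_plus, csum_mult_l.
  eapply Rle_trans; [apply Cmod_triangle|]. apply Rplus_le_compat.
  - apply Rle_trans with (rsum (fun i =>
      V * (Rpower (INR (M + i)) (- Re s1) * Rpower (INR (M + i) + INR (S K)) (- Re s2)) +
      V * (INR q * Cmod s2) * (/ (INR M + INR i) * Rpower (INR M + INR i) (- tau))) n).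
    + apply Cmod_csum_le_rsum. intros i _. rewrite !Cmod_mult, Cmod_npow.
      set (m := INR (M + i)). assert (Hm : 1 <= m) by (apply (le_INR 1); lia).
      assert (HMm : INR M <= m) by (apply le_INR; lia).
      pose proof (chi_power_sum_main q chi2 Hq Hchi2 m s2 K Hs2 ltac:(lra) ltac:(lra)) as H.
      fold c V in H.
      assert (Hc1 : Cmod (chi1 (Z.of_nat (M + i))) <= 1)
        by (apply (dirichlet_Cmod_le_1 q); [lia|apply Hchi1]).
      pose proof (Rpower_pos m (- Re s1)) as Hp1.
      replace (INR M + INR i) with m by (unfold m; apply plus_INR).
      replace (Rpower m (- tau)) with (Rpower m (- Re s1) * Rpower m (- Re s2))
        by (rewrite <- Rpower_plus; f_equal; unfold tau; ring).
      pose proof (Cmod_ge_0 (chi1 (Z.of_nat (M + i)))) as Hc0.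
      set (e := Cmod (chi_power_sum chi2 0 m s2 (S K) - c * npow m s2)) in *.
      assert (He : 0 <= e) by apply Cmod_ge_0.
      apply Rle_trans with (Rpower m (- Re s1) * e).
      { apply Rmult_le_compat_r; auto. rewrite <- (Rmult_1_l (Rpower m (- Re s1))) at 2.
        apply Rmult_le_compat_r; lra. }
      eapply Rle_trans; [apply Rmult_le_compat_l; [lra|exact H]|].
      right. unfold Rdiv. ring.
    + rewrite rsum_plus, !rsum_mult_l. apply Rplus_le_compat_l.
      apply Rle_trans with (V * (INR q * Cmod s2) * (2 * ((1 + tau) / tau) * Rpower (INR M) (- tau)));
        [|right; ring].
      apply Rmult_le_compat_l; [|now apply rsum_inv_Rpower].
      apply Rmult_le_pos; [lra|]. apply Rmult_le_pos; [apply pos_INR|apply Cmod_ge_0].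
  - rewrite Cmod_mult. fold c.
    apply Rle_trans with (Cmod c * (3 * V * (1 + Cmod (s1 + s2) * ((1 + tau) / tau)) * Rpower (INR M) (- tau)));
      [|right; ring].
    apply Rmult_le_compat_l; [apply Cmod_ge_0|].
    rewrite <- Hre at 1 2 3. apply (Dirichlet_test (fun i => chi1 (Z.of_nat M + Z.of_nat i)%Z)); auto.
    intros k. apply Polya_Vinogradov; auto.
Qed.

Lemma row_difference (s1 s2 : C) (K K' m : nat) :
  0 <= Re s2 -> (1 <= m)%nat -> (K <= K')%nat -> INR q * Cmod s2 / 2 <= INR K ->
  Cmod (row_term s1 s2 K' m - row_term s1 s2 K m) <=
    3 * V * Rpower (INR m) (- Re s1) * Rpower (INR (S K)) (- Re s2).
Proof.
  intros Hs2 Hm HKK HK. pose proof sqrt_log_pos as HV. pose proof (S_INR K) as HSK. pose proof (pos_INR K).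
  assert (Hm1 : 1 <= INR m) by (apply (le_INR 1); lia).
  unfold row_term. replace (S K') with (S K + (K' - K))%nat by lia.
  rewrite chi_power_sum_add.
  match goal with |- Cmod ?u <= _ => replace u with
    (chi1 (Z.of_nat m) * npow (INR m) s1 *
      chi_power_sum chi2 (0 + Z.of_nat (S K)) (INR m + INR (S K)) s2 (K' - K))%C by ring end.
  rewrite !Cmod_mult, Cmod_npow.
  assert (Hc1 : Cmod (chi1 (Z.of_nat m)) <= 1)
    by (apply (dirichlet_Cmod_le_1 q); [lia|apply Hchi1]).
  pose proof (chi_power_sum_tail q chi2 Hq Hchi2 (0 + Z.of_nat (S K)) (INR m + INR (S K)) s2 (K' - K)
    Hs2 ltac:(lra) ltac:(lra)) as H1.
  assert (H2 : Rpower (INR m + INR (S K)) (- Re s2) <= Rpower (INR (S K)) (- Re s2))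
    by (apply Rpower_neg_antitone; lra).
  pose proof (Rpower_pos (INR m) (- Re s1)) as Hp.
  pose proof (Cmod_ge_0 (chi1 (Z.of_nat m))).
  apply Rle_trans with (1 * Rpower (INR m) (- Re s1) * (3 * V * Rpower (INR (S K)) (- Re s2))).
  - apply Rmult_le_compat; try apply Cmod_ge_0.
    + apply Rmult_le_pos; lra.
    + apply Rmult_le_compat_r; lra.
    + eapply Rle_trans; [exact H1|]. unfold V. rewrite <- !Rmult_assoc in *.
      apply Rmult_le_compat_l; [|lra]. unfold V in HV. lra.
  - right; ring.
Qed.

End DoubleSum.

Lemma decay_eventually (C1 C2 sg eps : R) : 0 < C1 -> 0 < C2 -> 0 < sg -> 0 < eps ->
  exists N : nat, forall n, (N <= n)%nat ->
    C1 * / INR (S n) + C2 * Rpower (INR (S n)) (- sg) <= eps.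
Proof.
  intros H1 H2 Hsg Heps.
  set (X := Rpower (2 * C2 / eps) (/ sg)).
  assert (HX : 0 < X) by apply Rpower_pos.
  assert (Hc1 : 0 < 2 * C1 / eps) by (apply Rdiv_lt_0_compat; lra).
  assert (Hc2 : 0 < 2 * C2 / eps) by (apply Rdiv_lt_0_compat; lra).
  exists (nfl (X + 2 * C1 / eps)). intros n Hn.
  destruct (nfl_spec (X + 2 * C1 / eps) ltac:(lra)) as [_ Hf].
  assert (Hn' : X + 2 * C1 / eps <= INR (S n)).
  { apply le_INR in Hn. rewrite S_INR. lra. }
  assert (Ha : C1 * / INR (S n) <= eps / 2).
  { apply Rle_trans with (C1 * / (2 * C1 / eps)); [|right; field; lra].
    apply Rmult_le_compat_l; [lra|]. apply Rinv_le_contravar; lra. }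
  assert (Hb : C2 * Rpower (INR (S n)) (- sg) <= eps / 2).
  { apply Rle_trans with (C2 * Rpower X (- sg)).
    - apply Rmult_le_compat_l; [lra|]. apply Rpower_neg_antitone; lra.
    - unfold X. rewrite Rpower_mult.
      replace (/ sg * - sg) with (- (1)) by (field; lra).
      rewrite Rpower_Ropp, Rpower_1 by auto. right. field. lra. }
  lra.
Qed.

Lemma Rpower_ge_1 (x a : R) : 1 <= x -> 0 <= a -> 1 <= Rpower x a.
Proof.
  intros Hx Ha. unfold Rpower. rewrite <- exp_0 at 1. apply exp_le_mono.
  assert (0 <= ln x) by (rewrite <- ln_1; apply ln_le; lra). now apply Rmult_le_pos.
Qed.

(** * Convergence of the truncated double sums along a complex line *)

Section Continuation.

Variables (q : nat) (chi1 chi2 : Z -> C) (L : C * C -> C) (s1 s2 : C).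
Hypothesis Hq : (2 <= q)%nat.
Hypothesis Hchi1 : primitive_character (Z.of_nat q) chi1.
Hypothesis Hchi2 : primitive_character (Z.of_nat q) chi2.
Hypothesis HL : is_double_L chi1 chi2 L.
Hypothesis Hs2 : 0 < Re s2.
Hypothesis Hs12 : 0 < Re s1 + Re s2.

Let V := sqrt (INR q) * (1 + ln (INR q)).
(** On the rectangle used for continuation |z| <= 2 + 4, so A bounds |s2 + z| and 2 A bounds |s1 +
    s2 + 2 z|. *)
Let A := Cmod s1 + Cmod s2 + 6.
Let a := Rabs (Re s1).
Let sg := Re s1 + Re s2.
Let k := (1 + sg) / sg.
(** Dominates the sum of |m^{-(s1 + z)}| over the rows m <= n + 1, uniformly in the rectangle. *)
Let W (n : nat) := INR (S n) * Rpower (INR (S n)) a.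

(** The first summand brings the cut into the range of the tail estimate; the second makes [W n]
    times the cut to the power - Re s2 at most 1 / (n + 1). Cutting at n itself would only give n^{1
    + a - Re s2}, which need not tend to 0. *)
Definition row_length (n : nat) : nat :=
  S (nfl (INR q * A / 2)) + nfl (Rpower (W n * INR (S n)) (/ Re s2)).

Definition partial_L (z : C) (n : nat) : C :=
  csum (fun i => row_term chi1 chi2 (s1 + z) (s2 + z) (row_length n) (S i)) n.

Lemma radius_pos : 0 < A.
Proof. unfold A. pose proof (Cmod_ge_0 s1). pose proof (Cmod_ge_0 s2). lra. Qed.

Lemma row_weight_pos (n : nat) : 0 < W n.
Proof.
  unfold W. apply Rmult_lt_0_compat; [apply lt_0_INR; lia|apply Rpower_pos].
Qed.

Lemma row_length_ge (n : nat) : INR q * A / 2 <= INR (row_length n).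
Proof.
  unfold row_length. rewrite plus_INR, S_INR. pose proof radius_pos.
  destruct (nfl_spec (INR q * A / 2)) as [_ H1]; [pose proof (pos_INR q); nra|].
  pose proof (pos_INR (nfl (Rpower (W n * INR (S n)) (/ Re s2)))). lra.
Qed.

Lemma row_length_decay (n : nat) :
  W n * Rpower (INR (S (row_length n))) (- Re s2) <= / INR (S n).
Proof.
  pose proof (row_weight_pos n) as HW. assert (Hn : 0 < INR (S n)) by (apply lt_0_INR; lia).
  set (X := Rpower (W n * INR (S n)) (/ Re s2)).
  assert (HX : 0 < X) by apply Rpower_pos.
  assert (HK : X <= INR (S (row_length n))).
  { unfold row_length. fold X. destruct (nfl_spec X ltac:(lra)) as [_ H1].
    rewrite S_INR, plus_INR. pose proof (pos_INR (S (nfl (INR q * A / 2)))). lra. }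
  apply Rle_trans with (W n * Rpower X (- Re s2)).
  - apply Rmult_le_compat_l; [lra|]. apply Rpower_neg_antitone; lra.
  - unfold X. rewrite Rpower_mult. replace (/ Re s2 * - Re s2) with (- (1)) by (field; lra).
    rewrite Rpower_Ropp, Rpower_1 by nra. right. field. lra.
Qed.

Lemma row_weight_mono (n n' : nat) : (n <= n')%nat -> W n <= W n'.
Proof.
  intros H. assert (H1 : INR (S n) <= INR (S n')) by (apply le_INR; lia).
  assert (H0 : 0 < INR (S n)) by (apply lt_0_INR; lia).
  unfold W. apply Rmult_le_compat; [lra|left; apply Rpower_pos|auto|].
  apply Rle_Rpower_l; [apply Rabs_pos|lra].
Qed.

(** The rectangle of [unique_continuation] for c = 2, with 4 written accordingly. On its right side
    Re (s2 + z) > 2 and Re (s1 + s2 + 2 z) > 4, inside the region where the double series defines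
    [L]. *)
Definition in_rectangle (z : C) : Prop := 0 <= Re z <= 2 /\ -(2 * 2) <= Im z <= 2 * 2.

Lemma rectangle_bounds (z : C) : in_rectangle z ->
  Re s1 <= Re (s1 + z) /\ Re s2 <= Re (s2 + z) /\ Cmod (s2 + z) <= A /\
  Cmod (s1 + z + (s2 + z)) <= 2 * A.
Proof.
  intros [Hre Him].
  assert (Hz : Cmod z <= 6).
  { eapply Rle_trans; [apply Cmod_le_Re_Im|]. rewrite Rabs_pos_eq by lra.
    assert (Rabs (Im z) <= 4) by (apply Rabs_le; lra). lra. }
  pose proof (Cmod_ge_0 s1). pose proof (Cmod_ge_0 s2).
  pose proof (Cmod_triangle s1 z). pose proof (Cmod_triangle s2 z).
  pose proof (Cmod_triangle (s1 + z) (s2 + z)).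
  unfold A. destruct s1, s2, z. simpl in *. repeat split; lra.
Qed.

Lemma row_power_le (z : C) (m n : nat) : in_rectangle z -> (1 <= m)%nat -> (m <= S n)%nat ->
  Rpower (INR m) (- Re (s1 + z)) <= Rpower (INR (S n)) a.
Proof.
  intros Hz Hm Hmn. destruct (rectangle_bounds z Hz) as [H1 _].
  assert (Hm1 : 1 <= INR m) by (apply (le_INR 1); lia).
  apply Rle_trans with (Rpower (INR m) a).
  - apply Rle_Rpower; auto. unfold a. pose proof (Rle_abs (- Re s1)).
    rewrite Rabs_Ropp in *. lra.
  - apply Rle_Rpower_l; [apply Rabs_pos|]. split; [lra|]. now apply le_INR.
Qed.

Lemma column_power_le (z : C) (K : nat) (x : R) : in_rectangle z -> INR (S K) <= x ->
  Rpower x (- Re (s2 + z)) <= Rpower (INR (S K)) (- Re s2).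
Proof.
  intros Hz Hx. destruct (rectangle_bounds z Hz) as [_ [H2 _]].
  assert (HK : 1 <= INR (S K)) by (apply (le_INR 1); lia).
  apply Rle_trans with (Rpower (INR (S K)) (- Re (s2 + z))).
  - apply Rpower_neg_antitone; lra.
  - apply Rle_Rpower; lra.
Qed.

Lemma row_difference_rectangle (z : C) (K K' m n : nat) : in_rectangle z ->
  (1 <= m)%nat -> (m <= S n)%nat -> (K <= K')%nat -> INR q * A / 2 <= INR K ->
  Cmod (row_term chi1 chi2 (s1 + z) (s2 + z) K' m - row_term chi1 chi2 (s1 + z) (s2 + z) K m) <=
    3 * V * (Rpower (INR (S n)) a * Rpower (INR (S K)) (- Re s2)).
Proof.
  intros Hz Hm Hmn HKK HK. destruct (rectangle_bounds z Hz) as [H1 [H2 [H3 _]]].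
  pose proof (sqrt_log_pos q Hq) as HV. fold V in HV.
  assert (HqA : INR q * Cmod (s2 + z) / 2 <= INR q * A / 2).
  { pose proof (pos_INR q). assert (INR q * Cmod (s2 + z) <= INR q * A) by (apply Rmult_le_compat_l; lra). lra. }
  eapply Rle_trans; [apply (row_difference q chi1 chi2); auto; lra|]. fold V.
  rewrite (Rmult_assoc (3 * V)). apply Rmult_le_compat_l; [lra|].
  apply Rmult_le_compat; try (left; apply Rpower_pos).
  - now apply row_power_le.
  - apply column_power_le; auto. lra.
Qed.

(** Two changes are compared: the first n rows get a different cut, and the rows from n + 1 on are
    added. The 7 is 6 from the cuts plus 1 from the truncation term of [row_tail]; nothing depends
    on z. *)
Lemma partial_L_cauchy_le (z : C) (n n' : nat) : in_rectangle z -> (n <= n')%nat ->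
  INR q * A / 2 <= INR (S n) ->
  Cmod (partial_L z n' - partial_L z n) <=
    7 * V * / INR (S n) +
    (2 * V * (INR q * A) * k + 3 * V * Cmod (L_at_0 q chi2) * (1 + 2 * A * k)) * Rpower (INR (S n)) (- sg).
Proof.
  intros Hz Hnn Hn. pose proof (sqrt_log_pos q Hq) as HV. fold V in HV.
  destruct (rectangle_bounds z Hz) as [B1 [B2 [B3 B4]]]. pose proof radius_pos as HA.
  assert (Hn0 : 0 < INR (S n)) by (apply lt_0_INR; lia).
  assert (Hinv : / INR (S n') <= / INR (S n)).
  { apply Rinv_le_contravar; auto. apply le_INR; lia. }
  set (K := row_length n). set (K' := row_length n').
  set (dn := Rpower (INR (S K)) (- Re s2)). set (dn' := Rpower (INR (S K')) (- Re s2)).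
  assert (Hdn : 0 < dn) by apply Rpower_pos. assert (Hdn' : 0 < dn') by apply Rpower_pos.
  assert (D1 : W n * dn <= / INR (S n)) by apply row_length_decay.
  assert (D2 : W n' * dn' <= / INR (S n')) by apply row_length_decay.
  assert (DW : W n <= W n') by now apply row_weight_mono.
  pose proof (row_weight_pos n) as HWn.
  assert (Hq0 : 0 <= INR q) by apply pos_INR.
  unfold partial_L. fold K K'.
  replace n' with (n + (n' - n))%nat by lia. rewrite csum_add.
  set (f' := row_term chi1 chi2 (s1 + z) (s2 + z) K').
  set (f := row_term chi1 chi2 (s1 + z) (s2 + z) K).
  replace (csum (fun i => f' (S i)) n + csum (fun i => f' (S (n + i))) (n' - n) - csum (fun i => f (S i)) n)%C
    with (csum (fun i => f' (S i) - f (S i)) n + csum (fun i => f' (S (n + i))) (n' - n))%C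
    by (rewrite csum_minus; ring).
  change (fun i => f' (S (n + i))) with (fun i => f' (S n + i)%nat).
  eapply Rle_trans; [apply Cmod_triangle|].
  assert (H1 : Cmod (csum (fun i => f' (S i) - f (S i))%C n) <= 6 * V * / INR (S n)).
  { apply Rle_trans with (rsum (fun _ => 3 * V * (Rpower (INR (S n)) a * (dn + dn'))) n).
    - apply Cmod_csum_le_rsum. intros i Hi.
      pose proof (row_length_ge n) as G1. pose proof (row_length_ge n') as G2.
      pose proof (Rpower_pos (INR (S n)) a) as Hpa.
      destruct (le_lt_dec K K') as [HKK|HKK].
      + eapply Rle_trans; [apply (row_difference_rectangle z K K' (S i) n); auto; lia|].
        fold dn. apply Rmult_le_compat_l; [lra|]. apply Rmult_le_compat_l; lra.
      + unfold f, f'. rewrite <- Cmod_opp, Copp_minus_distr.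
        eapply Rle_trans; [apply (row_difference_rectangle z K' K (S i) n); auto; lia|].
        fold dn'. apply Rmult_le_compat_l; [lra|]. apply Rmult_le_compat_l; lra.
    - rewrite rsum_const.
      assert (Hsn : INR n <= INR (S n)) by (apply le_INR; lia).
      apply Rle_trans with (3 * V * (W n * dn + W n * dn')).
      + unfold W. pose proof (Rpower_pos (INR (S n)) a) as Hpa.
        replace (INR n * (3 * V * (Rpower (INR (S n)) a * (dn + dn')))) with
          (3 * V * (INR n * (Rpower (INR (S n)) a * (dn + dn')))) by ring.
        apply Rmult_le_compat_l; [lra|].
        replace (INR (S n) * Rpower (INR (S n)) a * dn + INR (S n) * Rpower (INR (S n)) a * dn') with
          (INR (S n) * (Rpower (INR (S n)) a * (dn + dn'))) by ring.
        apply Rmult_le_compat_r; auto. apply Rmult_le_pos; lra.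
      + assert (W n * dn' <= W n' * dn') by (apply Rmult_le_compat_r; lra).
        replace (6 * V * / INR (S n)) with (3 * V * (/ INR (S n) + / INR (S n))) by ring.
        apply Rmult_le_compat_l; lra. }
  set (tau := Re (s1 + z) + Re (s2 + z)).
  assert (Htau : sg <= tau) by (unfold sg, tau; lra).
  assert (HqA : INR q * Cmod (s2 + z) / 2 <= INR q * A / 2).
  { assert (INR q * Cmod (s2 + z) <= INR q * A) by (apply Rmult_le_compat_l; lra). lra. }
  assert (H2 := row_tail q chi1 chi2 Hq Hchi1 Hchi2 (s1 + z) (s2 + z) (S n) (n' - n) K'
    ltac:(lra) ltac:(fold tau; unfold sg in *; lra) ltac:(lia) ltac:(lra)).
  fold f' tau V in H2. cbv zeta in H2.
  set (E := rsum (fun i => Rpower (INR (S n + i)) (- Re (s1 + z)) *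
    Rpower (INR (S n + i) + INR (S K')) (- Re (s2 + z))) (n' - n)) in H2.
  assert (HE : E <= / INR (S n)).
  { apply Rle_trans with (rsum (fun _ => Rpower (INR (S n')) a * dn') (n' - n)).
    - apply rsum_le. intros i Hi. apply Rmult_le_compat; try (left; apply Rpower_pos).
      + apply row_power_le; auto; lia.
      + apply column_power_le; auto. pose proof (pos_INR (S n + i)). lra.
    - rewrite rsum_const. apply Rle_trans with (W n' * dn'); [|lra].
      unfold W. rewrite Rmult_assoc. apply Rmult_le_compat_r.
      + apply Rmult_le_pos; left; [apply Rpower_pos|auto].
      + apply le_INR; lia. }
  assert (Hsg0 : 0 < sg) by exact Hs12.
  assert (Hk : 0 <= (1 + tau) / tau <= k).
  { split; [left; apply Rdiv_lt_0_compat; lra|]. unfold k.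
    replace ((1 + tau) / tau) with (/ tau + 1) by (field; lra).
    replace ((1 + sg) / sg) with (/ sg + 1) by (field; lra).
    apply Rplus_le_compat_r. apply Rinv_le_contravar; lra. }
  assert (HP : Rpower (INR (S n)) (- tau) <= Rpower (INR (S n)) (- sg)).
  { apply Rle_Rpower; [apply (le_INR 1); lia|lra]. }
  pose proof (Rpower_pos (INR (S n)) (- tau)) as HP0.
  pose proof (Cmod_ge_0 (s2 + z)) as Hz2. pose proof (Cmod_ge_0 (L_at_0 q chi2)) as Hc0.
  pose proof (Cmod_ge_0 (s1 + z + (s2 + z))) as Hz12.
  assert (T1 : 2 * V * (INR q * Cmod (s2 + z)) * ((1 + tau) / tau) * Rpower (INR (S n)) (- tau) <=
    2 * V * (INR q * A) * k * Rpower (INR (S n)) (- sg)).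
  { assert (0 <= INR q * Cmod (s2 + z)) by (apply Rmult_le_pos; lra).
    apply Rmult_le_compat; try lra; [apply Rmult_le_pos; try lra; apply Rmult_le_pos; lra|].
    apply Rmult_le_compat; try lra; [apply Rmult_le_pos; lra|].
    apply Rmult_le_compat_l; [lra|]. apply Rmult_le_compat_l; lra. }
  assert (T2 : 3 * V * Cmod (L_at_0 q chi2) * (1 + Cmod (s1 + z + (s2 + z)) * ((1 + tau) / tau)) *
      Rpower (INR (S n)) (- tau) <=
    3 * V * Cmod (L_at_0 q chi2) * (1 + 2 * A * k) * Rpower (INR (S n)) (- sg)).
  { assert (0 <= 3 * V * Cmod (L_at_0 q chi2)) by (apply Rmult_le_pos; lra).
    assert (0 <= Cmod (s1 + z + (s2 + z)) * ((1 + tau) / tau)) by (apply Rmult_le_pos; lra).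
    apply Rmult_le_compat; try lra; [apply Rmult_le_pos; lra|].
    apply Rmult_le_compat_l; [lra|]. apply Rplus_le_compat_l. apply Rmult_le_compat; lra. }
  assert (T0 : V * E <= V * / INR (S n)) by (apply Rmult_le_compat_l; lra).
  rewrite Rmult_plus_distr_r. lra.
Qed.

Lemma dirichlet_0 (chi : Z -> C) : dirichlet_character (Z.of_nat q) chi -> chi 0%Z = 0%C.
Proof.
  intros [_ [_ Hu]]. pose proof (rel_prime_0 q Hq) as Hr. rewrite <- Hu in Hr.
  destruct (Ceq_dec (chi 0%Z) 0%C); tauto.
Qed.

Lemma csum_double_L_term (w1 w2 : C) (i K : nat) :
  csum (double_L_term chi1 chi2 w1 w2 i) K = row_term chi1 chi2 w1 w2 K (S i).
Proof.
  unfold row_term, chi_power_sum. rewrite csum_S_l. simpl (0 + Z.of_nat 0)%Z.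
  rewrite (dirichlet_0 chi2) by apply Hchi2. rewrite Cmult_0_l, Cplus_0_l.
  rewrite <- csum_mult_l. apply csum_ext. intros j _.
  unfold double_L_term, npow, real_Cpow. rewrite !Cexp_opp, plus_INR.
  rewrite Z.add_0_l. field. split; apply Cexp_neq_0.
Qed.

(** In this region [L] is an iterated series with complete rows [b i]. Letting the longer cut in
    [row_difference_rectangle] go to infinity compares [b i] with its truncation, and the choice of
    [row_length] makes the n differences add up to O(1 / n). *)
Lemma partial_L_right_side (z : C) (eps : R) : in_rectangle z -> Re z = 2 -> 0 < eps ->
  exists N, forall n, (N <= n)%nat -> Cmod (L (s1 + z, s2 + z)%C - partial_L z n) <= eps.
Proof.
  intros Hz Hz2 Heps. pose proof (sqrt_log_pos q Hq) as HV. fold V in HV.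
  destruct (proj2 HL (s1 + z)%C (s2 + z)%C) as [b [Hb HbL]].
  { destruct s2, z; simpl in *. lra. } { destruct s1, s2, z; simpl in *. lra. }
  destruct (is_series_csum _ _ HbL (eps / 2) ltac:(lra)) as [N1 HN1].
  destruct (decay_eventually (3 * V) 1 1 (eps / 2) ltac:(lra) ltac:(lra) ltac:(lra) ltac:(lra)) as [N2 HN2].
  exists (Nat.max N1 N2). intros n Hn. specialize (HN1 n ltac:(lia)). specialize (HN2 n ltac:(lia)).
  pose proof (Rpower_pos (INR (S n)) (- (1))) as Hp1.
  set (K := row_length n). set (dn := Rpower (INR (S K)) (- Re s2)).
  assert (Hrow : forall i, (i < n)%nat ->
    Cmod (b i - row_term chi1 chi2 (s1 + z) (s2 + z) K (S i)) <= 3 * V * (Rpower (INR (S n)) a * dn)).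
  { intros i Hi. apply le_epsilon. intros e He.
    destruct (is_series_csum _ _ (Hb i) e He) as [N3 HN3].
    set (K' := Nat.max K N3). specialize (HN3 K' ltac:(lia)). rewrite csum_double_L_term in HN3.
    set (r' := row_term chi1 chi2 (s1 + z) (s2 + z) K' (S i)) in *.
    set (r := row_term chi1 chi2 (s1 + z) (s2 + z) K (S i)).
    replace (b i - r)%C with (- (r' - b i) + (r' - r))%C by ring.
    eapply Rle_trans; [apply Cmod_triangle|]. rewrite Cmod_opp.
    assert (Cmod (r' - r) <= 3 * V * (Rpower (INR (S n)) a * dn)); [|lra].
    apply (row_difference_rectangle z K K' (S i) n); auto; try lia. apply row_length_ge. }
  replace (L ((s1 + z)%C, (s2 + z)%C) - partial_L z n)%C with
    (- (csum b n - L ((s1 + z)%C, (s2 + z)%C)) +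
     csum (fun i => b i - row_term chi1 chi2 (s1 + z) (s2 + z) K (S i)) n)%C.
  2:{ unfold partial_L. fold K. rewrite csum_minus. ring. }
  eapply Rle_trans; [apply Cmod_triangle|]. rewrite Cmod_opp.
  assert (Cmod (csum (fun i => b i - row_term chi1 chi2 (s1 + z) (s2 + z) K (S i))%C n) <=
    3 * V * / INR (S n)); [|lra].
  eapply Rle_trans; [apply (Cmod_csum_le_rsum _ _ n Hrow)|]. rewrite rsum_const.
  pose proof (row_length_decay n) as D. fold K dn in D.
  assert (Hsn : INR n <= INR (S n)) by (apply le_INR; lia).
  apply Rle_trans with (3 * V * (W n * dn)); [|apply Rmult_le_compat_l; lra].
  unfold W. replace (INR n * (3 * V * (Rpower (INR (S n)) a * dn))) with
    (3 * V * (INR n * (Rpower (INR (S n)) a * dn))) by ring.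
  apply Rmult_le_compat_l; [lra|]. rewrite Rmult_assoc. apply Rmult_le_compat_r; auto.
  apply Rmult_le_pos; left; apply Rpower_pos.
Qed.

Lemma C_differentiable_npow (x : R) (w : C) : C_differentiable (fun z => npow x (w + z)).
Proof.
  unfold npow. apply C_differentiable_Cexp.
  apply (C_differentiable_ext (fun z => - (w * RtoC (ln x)) + (- RtoC (ln x)) * z)%C);
    [intros; ring|apply C_differentiable_affine].
Qed.

Lemma C_differentiable_csum (f : nat -> C -> C) (n : nat) :
  (forall i, C_differentiable (f i)) -> C_differentiable (fun z => csum (fun i => f i z) n).
Proof.
  intros Hf. induction n as [|n IH]; simpl; [apply C_differentiable_const|].
  now apply C_differentiable_plus.
Qed.

Lemma C_differentiable_partial_L (n : nat) : C_differentiable (fun z => partial_L z n).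
Proof.
  unfold partial_L.
  apply (C_differentiable_csum
    (fun i z => row_term chi1 chi2 (s1 + z) (s2 + z) (row_length n) (S i))).
  intros i. unfold row_term, chi_power_sum.
  apply C_differentiable_mult.
  - apply C_differentiable_mult; [apply C_differentiable_const|apply C_differentiable_npow].
  - apply (C_differentiable_csum (fun j z => (chi2 (0 + Z.of_nat j)%Z * npow (INR (S i) + INR j) (s2 + z))%C)).
    intros j. apply C_differentiable_mult; [apply C_differentiable_const|apply C_differentiable_npow].
Qed.

(** Apply unique continuation to z -> L(s1 + z, s2 + z) minus the n-th partial sum. Differences of
    two such functions no longer contain [L], so the Cauchy condition concerns finite sums only. *)
Theorem partial_L_limit (eps : R) : 0 < eps ->
  exists N, forall n, (N <= n)%nat -> Cmod (L (s1, s2) - partial_L 0 n) <= eps.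
Proof.
  intros Heps. pose proof (sqrt_log_pos q Hq) as HV. fold V in HV. pose proof radius_pos as HA.
  assert (Hsg0 : 0 < sg) by exact Hs12.
  assert (Hk : 0 < k) by (apply Rdiv_lt_0_compat; lra).
  pose proof (Cmod_ge_0 (L_at_0 q chi2)) as Hc0. pose proof (pos_INR q) as Hq0.
  assert (Hrect : forall x y, 0 <= x <= 2 -> -(2 * 2) <= y <= 2 * 2 -> in_rectangle (x, y))
    by (intros; split; auto).
  destruct (unique_continuation
    (fun n z => (L (s1 + z, s2 + z) - partial_L z n)%C) 2 ltac:(lra)) with (eps := eps)
    as [N HN]; auto.
  - intros n. apply C_differentiable_minus.
    + apply entire2_diagonal, HL.
    + apply C_differentiable_partial_L.
  - intros e He.
    set (C2 := 2 * V * (INR q * A) * k + 3 * V * Cmod (L_at_0 q chi2) * (1 + 2 * A * k)).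
    assert (HC2 : 0 <= C2).
    { unfold C2. apply Rplus_le_le_0_compat.
      - apply Rmult_le_pos; [|lra]. apply Rmult_le_pos; [lra|]. apply Rmult_le_pos; lra.
      - apply Rmult_le_pos; [apply Rmult_le_pos; lra|]. pose proof (Rmult_le_pos A k). lra. }
    destruct (decay_eventually (7 * V) (C2 + 1) sg e ltac:(lra) ltac:(lra) Hsg0 He) as [N1 HN1].
    exists (N1 + S (nfl (INR q * A / 2)))%nat.
    assert (Hcau : forall n m x y, (N1 + S (nfl (INR q * A / 2)) <= n)%nat -> (n <= m)%nat ->
      0 <= x <= 2 -> -(2 * 2) <= y <= 2 * 2 ->
      Cmod (partial_L (x, y) m - partial_L (x, y) n) <= e).
    { intros n m x y Hn Hnm Hx Hy.
      eapply Rle_trans; [apply partial_L_cauchy_le; auto|].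
      - destruct (nfl_spec (INR q * A / 2)) as [_ H1]; [nra|].
        assert (H2 : (S (nfl (INR q * A / 2)) <= S n)%nat) by lia.
        apply le_INR in H2. rewrite S_INR in H2. lra.
      - fold C2. specialize (HN1 n ltac:(lia)).
        pose proof (Rpower_pos (INR (S n)) (- sg)). lra. }
    intros n m x y Hn Hm Hx Hy.
    destruct (le_lt_dec n m) as [Hnm|Hnm].
    + match goal with |- Cmod ?u <= _ => replace u with (partial_L (x, y) m - partial_L (x, y) n)%C by ring end.
      now apply Hcau.
    + match goal with |- Cmod ?u <= _ => replace u with (- (partial_L (x, y) n - partial_L (x, y) m))%C by ring end.
      rewrite Cmod_opp. apply Hcau; auto; lia.
  - intros y Hy e He. apply (partial_L_right_side (2, y) e); auto. apply Hrect; lra.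
  - exists N. intros n Hn. specialize (HN n Hn). simpl in HN.
    rewrite !Cplus_0_r in HN. exact HN.
Qed.

End Continuation.

(** * The bound *)

Lemma ln_le_Rpower (x b : R) : 0 < x -> 0 < b -> ln x <= / b * Rpower x b.
Proof.
  intros Hx Hb.
  pose proof (ln_le_sub_1 (Rpower x b) (Rpower_pos x b)) as H.
  unfold Rpower at 1 in H. rewrite ln_exp in H.
  apply Rmult_le_reg_l with b; auto. rewrite <- Rmult_assoc, Rinv_r, Rmult_1_l by lra. lra.
Qed.

Lemma ln_cube_le (N eps : R) : 1 <= N -> 0 < eps ->
  ln N * (ln N * ln N) <= (3 / eps) * ((3 / eps) * (3 / eps)) * Rpower N eps.
Proof.
  intros HN Heps. assert (H0 : 0 <= ln N) by (rewrite <- ln_1; apply ln_le; lra).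
  pose proof (ln_le_Rpower N (eps / 3) ltac:(lra) ltac:(lra)) as H.
  replace (/ (eps / 3)) with (3 / eps) in H by (field; lra).
  set (P := Rpower N (eps / 3)) in *. set (c := 3 / eps) in *.
  assert (HP : Rpower N eps = P * (P * P)).
  { unfold P. rewrite <- !Rpower_plus. f_equal. field. }
  rewrite HP. replace (c * (c * c) * (P * (P * P))) with ((c * P) * ((c * P) * (c * P))) by ring.
  apply Rmult_le_compat; auto; [now apply Rmult_le_pos|].
  apply Rmult_le_compat; auto.
Qed.

(** Applied to x = q: the logarithms of |L(0, chi2)| and of the Polya-Vinogradov bound are paid for
    with q^{1/2}, which turns their q into q^{3/2}. The 25 is (1 + 4)^2, from ln x <= 4 x^{1/4}. *)
Lemma one_add_ln_sq_le (x : R) : 1 <= x ->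
  (1 + ln x) * (1 + ln x) <= 25 * Rpower x (1 / 2).
Proof.
  intros Hx. assert (H0 : 0 <= ln x) by (rewrite <- ln_1; apply ln_le; lra).
  pose proof (ln_le_Rpower x (1 / 4) ltac:(lra) ltac:(lra)) as H.
  pose proof (Rpower_ge_1 x (1 / 4) Hx ltac:(lra)) as H1.
  replace (Rpower x (1 / 2)) with (Rpower x (1 / 4) * Rpower x (1 / 4)).
  2:{ rewrite <- Rpower_plus. f_equal. field. }
  set (P := Rpower x (1 / 4)) in *. replace (/ (1 / 4)) with 4 in H by field.
  replace (25 * (P * P)) with ((5 * P) * (5 * P)) by ring.
  apply Rmult_le_compat; lra.
Qed.

Section Bound.

Variables (q : nat) (chi1 chi2 : Z -> C) (s1 s2 : C).
Hypothesis Hq : (2 <= q)%nat.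
Hypothesis Hchi1 : primitive_character (Z.of_nat q) chi1.
Hypothesis Hchi2 : primitive_character (Z.of_nat q) chi2.
Hypothesis Hs2 : 0 < Re s2 < 1.
Hypothesis Hs12 : 0 < Re s1 + Re s2.
Hypothesis Ht2 : 2 <= Rabs (Im s2).

Let V := sqrt (INR q) * (1 + ln (INR q)).
Let N := INR q * Rabs (Im s2).
Let sg := Re s1 + Re s2.
Let k := (1 + sg) / sg.
Let delta := Rmax 0 (1 - sg).

(** Every row is at most sqrt N (log N)^2 m^{- sg}, and m^{- sg} = m^{1 - sg} / m <= N^delta / m;
    the harmonic sum brings the third logarithm. *)
Lemma small_rows (K M : nat) : (1 <= M)%nat -> INR M <= N ->
  Cmod (csum (fun i => row_term chi1 chi2 s1 s2 K (S i)) M) <=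
    10000 * (Rpower N (1 / 2) * Rpower N delta * (ln N * (ln N * ln N))).
Proof.
  intros HM HMN. assert (Hq2 : 2 <= INR q) by (apply (le_INR 2); lia).
  assert (HN : 4 <= N) by (unfold N; nra).
  assert (Hl : 1 <= ln N) by (eapply Rle_trans; [apply ln_4_ge_1|apply ln_le; lra]).
  set (l := ln N) in *.
  assert (Hsq : sqrt N = Rpower N (1 / 2)).
  { rewrite <- Rpower_sqrt by lra. f_equal. field. }
  pose proof (Rpower_pos N (1 / 2)) as HR. pose proof (Rpower_pos N delta) as HD.
  apply Rle_trans with (rsum (fun i => 5000 * (Rpower N (1 / 2) * (l * l)) * Rpower N delta * / INR (S i)) M).
  - apply Cmod_csum_le_rsum. intros i Hi. unfold row_term. rewrite !Cmod_mult, Cmod_npow.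
    set (m := INR (S i)). assert (Hm : 1 <= m) by (apply (le_INR 1); lia).
    assert (HmN : m <= N) by (apply Rle_trans with (INR M); auto; apply le_INR; lia).
    pose proof (chi_power_sum_bound q chi2 s2 0 m (S K) Hq Hchi2 ltac:(lra) Ht2 Hm) as H.
    cbv zeta in H. fold N l in H. rewrite Hsq in H.
    assert (Hc1 : Cmod (chi1 (Z.of_nat (S i))) <= 1)
      by (apply (dirichlet_Cmod_le_1 q); [lia|apply Hchi1]).
    pose proof (Cmod_ge_0 (chi1 (Z.of_nat (S i)))) as Hc0.
    pose proof (Rpower_pos m (- Re s1)) as Hp1.
    assert (Hpow : Rpower m (- Re s1) * Rpower m (- Re s2) <= Rpower N delta * / m).
    { rewrite <- Rpower_plus.
      replace (- Re s1 + - Re s2) with ((1 - sg) + - (1)) by (unfold sg; ring).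
      rewrite Rpower_plus, (Rpower_Ropp m 1), (Rpower_1 m) by lra.
      apply Rmult_le_compat_r; [left; apply Rinv_0_lt_compat; lra|].
      apply Rle_trans with (Rpower m delta).
      - apply Rle_Rpower; auto. apply Rmax_r.
      - apply Rle_Rpower_l; [apply Rmax_l|lra]. }
    assert (Hll : 0 < Rpower N (1 / 2) * (l * l)) by (apply Rmult_lt_0_compat; nra).
    apply Rle_trans with (1 * Rpower m (- Re s1) *
      (5000 * (Rpower N (1 / 2) * (l * l)) * Rpower m (- Re s2))).
    + apply Rmult_le_compat; try apply Cmod_ge_0; [apply Rmult_le_pos; lra| |exact H].
      apply Rmult_le_compat_r; lra.
    + replace (1 * Rpower m (- Re s1) * (5000 * (Rpower N (1 / 2) * (l * l)) * Rpower m (- Re s2))) with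
        (5000 * (Rpower N (1 / 2) * (l * l)) * (Rpower m (- Re s1) * Rpower m (- Re s2))) by ring.
      rewrite (Rmult_assoc (5000 * _)). apply Rmult_le_compat_l; lra.
  - rewrite rsum_mult_l. pose proof (harmonic_le M HM) as H.
    assert (HlM : ln (INR M) <= l) by (apply ln_le; auto; apply lt_0_INR; lia).
    apply Rle_trans with (5000 * (Rpower N (1 / 2) * (l * l)) * Rpower N delta * (2 * l)); [|right; ring].
    apply Rmult_le_compat_l; [|lra]. apply Rmult_le_pos; [|lra]. apply Rmult_le_pos; [lra|].
    apply Rmult_le_pos; nra.
Qed.

Lemma partial_L_bound (n : nat) : N <= INR n ->
  Cmod (partial_L q chi1 chi2 s1 s2 0 n) <=
    (10002 + 6 * k * Rpower 2 sg) * (Rpower N (1 / 2) * Rpower N delta * (ln N * (ln N * ln N))) +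
    3 * V * Cmod (L_at_0 q chi2) * (1 + Cmod (s1 + s2) * k) * (Rpower 2 sg * Rpower N (- sg)).
Proof.
  intros Hn. assert (Hq2 : 2 <= INR q) by (apply (le_INR 2); lia).
  assert (HN : 4 <= N) by (unfold N; nra).
  assert (HqN : INR q <= N) by (unfold N; nra).
  assert (Hl : 1 <= ln N) by (eapply Rle_trans; [apply ln_4_ge_1|apply ln_le; lra]).
  set (l := ln N) in *.
  assert (Hcs : INR q * Cmod s2 <= 3 / 2 * N).
  { pose proof (Cmod_le_Re_Im s2) as H. rewrite Rabs_pos_eq in H by lra.
    replace (3 / 2 * N) with (INR q * (3 / 2 * Rabs (Im s2))) by (unfold N; field).
    apply Rmult_le_compat_l; lra. }
  pose proof (sqrt_log_pos q Hq) as HV. fold V in HV.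
  (* |t2| >= 2 and Re s2 < 1 give |s2| <= 3/2 |t2|, so q |s2| / 2 <= 3/4 N: this is where [row_tail]
     becomes applicable. *)
  set (M := nfl (3 / 4 * N)). destruct (nfl_spec (3 / 4 * N) ltac:(lra)) as [HM1 HM2]. fold M in HM1, HM2.
  assert (HM0 : (1 <= M)%nat) by (apply INR_le; simpl; destruct M; [simpl in *; lra|rewrite S_INR; pose proof (pos_INR M); lra]).
  assert (HMn : (M < n)%nat) by (apply INR_lt; lra).
  unfold partial_L. rewrite (csum_ext _ (fun i => row_term chi1 chi2 s1 s2 (row_length q s1 s2 n) (S i)))
    by (intros; now rewrite !Cplus_0_r).
  set (K := row_length q s1 s2 n).
  replace n with (M + (n - M))%nat by lia. rewrite csum_add.
  eapply Rle_trans; [apply Cmod_triangle|].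
  pose proof (small_rows K M HM0 ltac:(lra)) as H1. fold l in H1.
  set (R := Rpower N (1 / 2) * Rpower N delta * (l * (l * l))) in *.
  assert (HSM : INR (S M) = INR M + 1) by apply S_INR.
  assert (H2 := row_tail q chi1 chi2 Hq Hchi1 Hchi2 s1 s2 (S M) (n - M) K
    ltac:(lra) Hs12 ltac:(lia) ltac:(lra)).
  cbv zeta in H2. fold V sg in H2. fold k in H2.
  change (fun i => row_term chi1 chi2 s1 s2 K (S M + i)) with
    (fun i => row_term chi1 chi2 s1 s2 K (S (M + i))) in H2.
  set (E := rsum (fun i => Rpower (INR (S M + i)) (- Re s1) *
    Rpower (INR (S M + i) + INR (S K)) (- Re s2)) (n - M)) in H2.
  assert (Hsg : 0 < sg) by exact Hs12.
  assert (Hk : 0 < k) by (apply Rdiv_lt_0_compat; lra).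
  (* E comes from cutting the rows; [row_length] keeps it below 1 / (n + 1). *)
  assert (HE : E <= 1).
  { pose proof (row_length_decay q s1 s2 Hq ltac:(lra) n) as D. cbv beta in D. fold K in D.
    assert (Hrect : in_rectangle 0) by (unfold in_rectangle; simpl; lra).
    assert (Hn1 : 1 <= INR (S n)) by (apply (le_INR 1); lia).
    apply Rle_trans with (rsum (fun _ => Rpower (INR (S n)) (Rabs (Re s1)) * Rpower (INR (S K)) (- Re s2)) (n - M)).
    - apply rsum_le. intros i Hi. apply Rmult_le_compat; try (left; apply Rpower_pos).
      + rewrite <- (Cplus_0_r s1) at 1. apply (row_power_le q s1 s2); auto; (lra || lia).
      + rewrite <- (Cplus_0_r s2) at 1. apply (column_power_le q s1 s2); auto; [lra|].
        pose proof (pos_INR (S M + i)). lra.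
    - rewrite rsum_const.
      apply Rle_trans with (INR (S n) * Rpower (INR (S n)) (Rabs (Re s1)) * Rpower (INR (S K)) (- Re s2)).
      + rewrite Rmult_assoc. apply Rmult_le_compat_r.
        * apply Rmult_le_pos; left; apply Rpower_pos.
        * apply le_INR; lia.
      + eapply Rle_trans; [exact D|]. rewrite <- Rinv_1. apply Rinv_le_contravar; lra. }
  (* M + 1 > 3/4 N >= N / 2, which explains the factor 2^sg. *)
  assert (HPM : Rpower (INR (S M)) (- sg) <= Rpower 2 sg * Rpower N (- sg)).
  { apply Rle_trans with (Rpower (N / 2) (- sg)).
    - apply Rpower_neg_antitone; lra.
    - right. unfold Rpower. rewrite <- exp_plus. f_equal. unfold Rdiv.
      rewrite ln_mult, ln_Rinv by lra. ring. }
  assert (HVN : V <= 2 * (Rpower N (1 / 2) * l)).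
  { unfold V. replace (2 * (Rpower N (1 / 2) * l)) with (Rpower N (1 / 2) * (2 * l)) by ring.
    assert (Hlq0 : 0 <= ln (INR q)) by (rewrite <- ln_1; apply ln_le; lra).
    apply Rmult_le_compat; try lra; [apply sqrt_pos| |].
    - rewrite <- Rpower_sqrt by lra. replace (/ 2) with (1 / 2) by field.
      apply Rle_Rpower_l; lra.
    - assert (ln (INR q) <= l) by (apply ln_le; lra). lra. }
  pose proof (Rpower_ge_1 N delta ltac:(lra) (Rmax_l _ _)) as HD.
  pose proof (Rpower_pos N (1 / 2)) as HR.
  assert (Hlll : l <= l * (l * l)) by nra.
  assert (HRl : Rpower N (1 / 2) * l <= Rpower N (1 / 2) * Rpower N delta * l).
  { apply Rmult_le_compat_r; [lra|]. rewrite <- (Rmult_1_r (Rpower N (1 / 2))) at 1.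
    apply Rmult_le_compat_l; lra. }
  assert (HRl2 : Rpower N (1 / 2) * Rpower N delta * l <= R).
  { unfold R. apply Rmult_le_compat_l; auto. apply Rmult_le_pos; lra. }
  assert (HVE : V * E <= 2 * R).
  { apply Rle_trans with (V * 1); [apply Rmult_le_compat_l; lra|]. lra. }
  assert (H2sg : 0 < Rpower 2 sg) by apply Rpower_pos.
  assert (HNd : N * Rpower N (- sg) <= Rpower N delta).
  { rewrite <- (Rpower_1 N) at 1 by lra. rewrite <- Rpower_plus.
    apply Rle_Rpower; [lra|]. replace (1 + - sg) with (1 - sg) by ring. apply Rmax_r. }
  assert (Ht : 2 * V * (INR q * Cmod s2) * k * Rpower (INR (S M)) (- sg) <=
    6 * k * Rpower 2 sg * R).
  { apply Rle_trans with (2 * (2 * (Rpower N (1 / 2) * l)) * (3 / 2 * N) * k * (Rpower 2 sg * Rpower N (- sg))).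
    - assert (0 <= INR q * Cmod s2) by (apply Rmult_le_pos; [lra|apply Cmod_ge_0]).
      apply Rmult_le_compat; auto; [|left; apply Rpower_pos|].
      + apply Rmult_le_pos; [|lra]. apply Rmult_le_pos; lra.
      + apply Rmult_le_compat_r; [lra|]. apply Rmult_le_compat; lra.
    - replace (2 * (2 * (Rpower N (1 / 2) * l)) * (3 / 2 * N) * k * (Rpower 2 sg * Rpower N (- sg))) with
        (6 * k * Rpower 2 sg * (Rpower N (1 / 2) * (N * Rpower N (- sg)) * l)) by field.
      apply Rmult_le_compat_l; [apply Rmult_le_pos; [lra|lra]|].
      eapply Rle_trans; [|exact HRl2]. apply Rmult_le_compat_r; [lra|].
      apply Rmult_le_compat_l; lra. }
  assert (Hodd : 3 * V * Cmod (L_at_0 q chi2) * (1 + Cmod (s1 + s2) * k) * Rpower (INR (S M)) (- sg) <=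
    3 * V * Cmod (L_at_0 q chi2) * (1 + Cmod (s1 + s2) * k) * (Rpower 2 sg * Rpower N (- sg))).
  { apply Rmult_le_compat_l; auto. apply Rmult_le_pos.
    - apply Rmult_le_pos; [lra|apply Cmod_ge_0].
    - pose proof (Rmult_le_pos (Cmod (s1 + s2)) k (Cmod_ge_0 _) ltac:(lra)). lra. }
  lra.
Qed.

(** The bound on the partial sums is uniform in n, so one partial sum within distance 1 of [L]
    suffices; that 1 raises 10002 to 10003. *)
Lemma double_L_bound (L : C * C -> C) : is_double_L chi1 chi2 L ->
  Cmod (L (s1, s2)) <=
    (10003 + 6 * k * Rpower 2 sg) * (Rpower N (1 / 2) * Rpower N delta * (ln N * (ln N * ln N))) +
    3 * V * Cmod (L_at_0 q chi2) * (1 + Cmod (s1 + s2) * k) * (Rpower 2 sg * Rpower N (- sg)).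
Proof.
  intros HL. assert (Hq2 : 2 <= INR q) by (apply (le_INR 2); lia).
  assert (HN : 4 <= N) by (unfold N; nra).
  assert (Hl : 1 <= ln N) by (eapply Rle_trans; [apply ln_4_ge_1|apply ln_le; lra]).
  destruct (partial_L_limit q chi1 chi2 L s1 s2 Hq Hchi1 Hchi2 HL ltac:(lra) Hs12 1 ltac:(lra)) as [n0 Hn0].
  set (n := (n0 + S (nfl N))%nat). specialize (Hn0 n ltac:(lia)).
  assert (Hn : N <= INR n).
  { destruct (nfl_spec N ltac:(lra)) as [_ H]. unfold n. rewrite plus_INR, S_INR.
    pose proof (pos_INR n0). lra. }
  pose proof (partial_L_bound n Hn) as H.
  replace (L (s1, s2)) with ((L (s1, s2) - partial_L q chi1 chi2 s1 s2 0 n) +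
    partial_L q chi1 chi2 s1 s2 0 n)%C by ring.
  eapply Rle_trans; [apply Cmod_triangle|].
  assert (H1 : 1 <= Rpower N (1 / 2) * Rpower N delta * (ln N * (ln N * ln N))).
  { pose proof (Rpower_ge_1 N delta ltac:(lra) (Rmax_l _ _)) as Ha.
    pose proof (Rpower_ge_1 N (1 / 2) ltac:(lra) ltac:(lra)) as Hb.
    assert (1 <= Rpower N (1 / 2) * Rpower N delta) by nra.
    assert (1 <= ln N * ln N) by nra. assert (1 <= ln N * (ln N * ln N)) by nra. nra. }
  rewrite (Rmult_plus_distr_r 10003), (Rmult_plus_distr_r 10002) in *. lra.
Qed.

End Bound.

Theorem theorem1 :
  forall sigma1 sigma2 eps : R,
    0 < sigma1 + sigma2 -> 0 < sigma2 < 1 -> 0 < eps ->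
    let delta := Rmax 0 (1 - sigma1 - sigma2) in
    exists K : R, 0 < K /\
      forall (q : Z) (chi1 chi2 : Z -> C) (L : C * C -> C) (t1 t2 : R),
        (2 <= q)%Z ->
        primitive_character q chi1 ->
        primitive_character q chi2 ->
        is_double_L chi1 chi2 L ->
        2 <= Rabs t2 ->
        let s1 : C := (sigma1, t1) in
        let s2 : C := (sigma2, t2) in
        let Q := IZR q * Rabs t2 in
        (chi2 (-1)%Z = RtoC 1 ->
           Cmod (L (s1, s2)) <= K * Rpower Q (1 / 2 + delta + eps)) /\
        (chi2 (-1)%Z = RtoC (-1) ->
           Cmod (L (s1, s2)) <=
             K * (Rpower Q (1 / 2 + delta + eps) +
                  (1 + Rabs (t1 + t2)) * Rpower (IZR q) (3 / 2 + eps) *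
                    Rpower Q (- Rmin 1 ((sigma1 + sigma2) / 2)))).
Proof.
  intros sigma1 sigma2 eps Hs Hs2 Heps delta.
  set (sg := sigma1 + sigma2) in *. set (k := (1 + sg) / sg). set (e := 3 / eps).
  assert (Hk : 0 < k) by (apply Rdiv_lt_0_compat; lra).
  assert (He : 0 < e) by (apply Rdiv_lt_0_compat; lra).
  assert (H2sg : 0 < Rpower 2 sg) by apply Rpower_pos.
  (* [K1] contains e^3 with e = 3 / eps, the price of turning (ln Q)^3 into Q^eps. In [K2], 75 is 3
     from the Dirichlet test times 25 from V^2 <= 25 q^{3/2}. *)
  set (K1 := (10003 + 6 * k * Rpower 2 sg) * (e * (e * e))).
  set (K2 := 75 * Rpower 2 sg * (1 + k * (sg + 1))).
  assert (HK1 : 0 < K1).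
  { unfold K1. apply Rmult_lt_0_compat; [|apply Rmult_lt_0_compat; [lra|apply Rmult_lt_0_compat; lra]].
    assert (0 < k * Rpower 2 sg) by now apply Rmult_lt_0_compat. lra. }
  assert (HK2 : 0 < K2).
  { unfold K2. apply Rmult_lt_0_compat; [lra|]. pose proof (Rmult_lt_0_compat k (sg + 1)). lra. }
  exists (K1 + K2). split; [lra|].
  intros q chi1 chi2 L t1 t2 Hq Hchi1 Hchi2 HL Ht2 s1 s2 Q.
  set (n := Z.to_nat q). assert (Hn : (2 <= n)%nat) by (unfold n; lia).
  assert (Hqn : q = Z.of_nat n) by (unfold n; lia).
  assert (HqR : IZR q = INR n) by (rewrite Hqn; symmetry; apply INR_IZR_INZ).
  rewrite Hqn in Hchi1, Hchi2.
  pose proof (double_L_bound n chi1 chi2 s1 s2 Hn Hchi1 Hchi2 Hs2 Hs Ht2 L HL) as H.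
  simpl Re in H. simpl Im in H. fold sg in H. fold k in H.
  rewrite <- HqR in H. fold Q in H.
  assert (Hq2 : 2 <= IZR q) by (apply IZR_le; lia).
  assert (HQ : 4 <= Q) by (unfold Q; nra).
  replace (1 - sg) with (1 - sigma1 - sigma2) in H by (unfold sg; ring). fold delta in H.
  assert (Hmain : (10003 + 6 * k * Rpower 2 sg) *
      (Rpower Q (1 / 2) * Rpower Q delta * (ln Q * (ln Q * ln Q))) <=
    K1 * Rpower Q (1 / 2 + delta + eps)).
  { rewrite !Rpower_plus. unfold K1.
    assert (HF : 0 < 10003 + 6 * k * Rpower 2 sg).
    { assert (0 < k * Rpower 2 sg) by now apply Rmult_lt_0_compat. lra. }
    set (F := 10003 + 6 * k * Rpower 2 sg) in *.
    rewrite (Rmult_assoc F). apply Rmult_le_compat_l; [lra|].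
    apply Rle_trans with (Rpower Q (1 / 2) * Rpower Q delta * (e * (e * e) * Rpower Q eps)); [|right; ring].
    apply Rmult_le_compat_l; [apply Rmult_le_pos; left; apply Rpower_pos|].
    apply ln_cube_le; lra. }
  pose proof (Rpower_pos Q (1 / 2 + delta + eps)) as HP.
  split.
  - intros Heven. rewrite (L_at_0_even n chi2 Hn Hchi2 Heven), Cmod_0 in H.
    rewrite Rmult_0_r, !Rmult_0_l, Rplus_0_r in H. nra.
  - intros _.
    set (B := (1 + Rabs (t1 + t2)) * Rpower (IZR q) (3 / 2 + eps) * Rpower Q (- Rmin 1 (sg / 2))).
    assert (Ht0 : 0 <= Rabs (t1 + t2)) by apply Rabs_pos.
    assert (HB0 : 0 <= B).
    { unfold B. apply Rmult_le_pos; [apply Rmult_le_pos; [lra|]|]; left; apply Rpower_pos. }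
    set (V := sqrt (IZR q) * (1 + ln (IZR q))) in *.
    assert (HV0 : 0 <= V).
    { unfold V. apply Rmult_le_pos; [apply sqrt_pos|].
      assert (0 <= ln (IZR q)) by (rewrite <- ln_1; apply ln_le; lra). lra. }
    assert (HVV : V * V <= 25 * Rpower (IZR q) (3 / 2)).
    { unfold V. replace (sqrt (IZR q) * (1 + ln (IZR q)) * (sqrt (IZR q) * (1 + ln (IZR q)))) with
        ((sqrt (IZR q) * sqrt (IZR q)) * ((1 + ln (IZR q)) * (1 + ln (IZR q)))) by ring.
      rewrite sqrt_sqrt by lra.
      replace (3 / 2) with (1 + 1 / 2) by field. rewrite Rpower_plus, Rpower_1 by lra.
      replace (25 * (IZR q * Rpower (IZR q) (1 / 2))) with (IZR q * (25 * Rpower (IZR q) (1 / 2))) by ring.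
      apply Rmult_le_compat_l; [lra|]. apply one_add_ln_sq_le. lra. }
    assert (Hc : Cmod (L_at_0 n chi2) <= V).
    { unfold V. rewrite HqR. now apply Cmod_L_at_0_le. }
    (* The factor 1 + |t1 + t2| originates in |s1 + s2| from the Dirichlet test. *)
    assert (Hs12 : Cmod (s1 + s2) <= sg + Rabs (t1 + t2)).
    { eapply Rle_trans; [apply Cmod_le_Re_Im|]. unfold s1, s2. simpl. fold sg.
      rewrite (Rabs_pos_eq sg) by lra. lra. }
    assert (Hlin : 1 + Cmod (s1 + s2) * k <= (1 + k * (sg + 1)) * (1 + Rabs (t1 + t2))).
    { assert (Cmod (s1 + s2) * k <= (sg + Rabs (t1 + t2)) * k) by (apply Rmult_le_compat_r; lra).
      pose proof (Rmult_le_pos k sg ltac:(lra) ltac:(lra)).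
      pose proof (Rmult_le_pos (k * sg) (Rabs (t1 + t2)) ltac:(lra) Ht0). nra. }
    (* The argument yields Q^{-sg}, and min(1, sg / 2) <= sg. *)
    assert (Hpow : Rpower Q (- sg) <= Rpower Q (- Rmin 1 (sg / 2))).
    { apply Rle_Rpower; [lra|]. pose proof (Rmin_r 1 (sg / 2)). lra. }
    assert (Hqe : Rpower (IZR q) (3 / 2) <= Rpower (IZR q) (3 / 2 + eps))
      by (apply Rle_Rpower; lra).
    pose proof (Cmod_ge_0 (L_at_0 n chi2)) as Hc0.
    assert (Hodd : 3 * V * Cmod (L_at_0 n chi2) * (1 + Cmod (s1 + s2) * k) *
        (Rpower 2 sg * Rpower Q (- sg)) <= K2 * B).
    { apply Rle_trans with (3 * (25 * Rpower (IZR q) (3 / 2 + eps)) *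
        ((1 + k * (sg + 1)) * (1 + Rabs (t1 + t2))) * (Rpower 2 sg * Rpower Q (- Rmin 1 (sg / 2)))).
      - pose proof (Rmult_le_pos (Cmod (s1 + s2)) k (Cmod_ge_0 _) ltac:(lra)) as H0.
        pose proof (Rpower_pos Q (- sg)).
        apply Rmult_le_compat.
        + apply Rmult_le_pos; [|lra]. apply Rmult_le_pos; lra.
        + apply Rmult_le_pos; lra.
        + apply Rmult_le_compat; [apply Rmult_le_pos; lra|lra| |exact Hlin].
          rewrite Rmult_assoc. apply Rmult_le_compat_l; [lra|].
          apply Rle_trans with (V * V); [apply Rmult_le_compat_l; lra|lra].
        + apply Rmult_le_compat_l; lra.
      - right. unfold K2, B. ring. }
    assert (0 <= K1 * B) by (apply Rmult_le_pos; lra).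
    assert (0 <= K2 * Rpower Q (1 / 2 + delta + eps)) by (apply Rmult_le_pos; lra).
    nra.
Qed.
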